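(* Let $\zeta\in\mathbb C\setminus\mathbb Q$. For $n\ge 1$, the following Verma modules in the principal block $\mathcal B_0$ of category $\mathcal O$ for $D(2|1;\zeta)$ have the following composition factors: \begin{align*} M_n^{---}&=L_n^{---}+L_{n+1}^{---},\\ M_n^{--+}&=L_n^{--+}+L_n^{---}+L_{n+1}^{--+}+L_{n+1}^{---},\\ M_n^{-+-}&=L_n^{-+-}+L_n^{---}+L_{n+1}^{-+-}+L_{n+1}^{---},\\ M_n^{-++}&=L_n^{-++}+L_n^{-+-}+L_n^{--+}+L_n^{---}+L_{n+1}^{-++}+L_{n+1}^{-+-}+L_{n+1}^{--+}+L_{n+1}^{---}. \end{align*}
   Context: $\mathfrak g=D(2|1;\zeta)$ is the $17$-dimensional simple Lie superalgebra of basic type with Cartan matrix $\begin{pmatrix}0&1&\zeta\\-1&2&0\\-1&0&2\end{pmatrix}$, whose first simple root is odd and whose other two simple roots are even. Its Cartan subalgebra $\mathfrak h$ has basis $h_{2\delta},h_{2\epsilon_1},h_{2\epsilon_2}$ with dual basis $\delta,\epsilon_1,\epsilon_2$ of $\mathfrak h^*$. The simple roots are $\delta-\epsilon_1-\epsilon_2$ (odd), $2\epsilon_1$, $2\epsilon_2$; positive even roots $2\delta,2\epsilon_1,2\epsilon_2$; positive odd roots $\delta\pm\epsilon_1\pm\epsilon_2$. $\mathfrak n_+$ is the sum of positive root spaces and $\rho=-\delta+\epsilon_1+\epsilon_2$. The weight lattice is $X=\mathbb Z\delta+\mathbb Z\epsilon_1+\mathbb Z\epsilon_2$, and $(x,y,z)$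 stands for $x\delta+y\epsilon_1+z\epsilon_2$. $\mathcal O$ is the category of finitely generated $\mathfrak h$-semisimple $\mathfrak g$-modules with weights in $X$ that are locally finite over $\mathfrak n_+$. For $\lambda\in X$, $M_\lambda$ is the Verma module of highest weight $\lambda-\rho$ (note the $\rho$-shift) and $L_\lambda$ its unique irreducible quotient. For $\zeta\notin\mathbb Q$, $\mathcal B_0$ is the block containing the trivial module; its simple objects are the $L_\lambda$ with $\lambda\in\{(\pm n,\pm n,\pm n)\mid n\ge1\}\cup\{(0,0,0)\}$. Notation: for $n\ge1$ and signs $a,b,c\in\{+,-\}$, $M_n^{abc}=M_{an,bn,cn}$ and $L_n^{abc}=L_{an,bn,cn}$. Writing $M_\mu=\sum_\lambda p_{\lambda\mu}L_\lambda$ means that the composition multiplicity $[M_\mu:L_\lambda]$ equals $p_{\lambda\mu}$ for every $\lambda$ (zero if $L_\lambda$ does not appear). *)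

(* Defs.v *)
From HB Require Import structures.
From mathcomp Require Import all_boot all_order all_algebra.
From mathcomp Require Import ring_quotient generic_quotient.
From mathcomp Require Import boolp classical_sets.
From mathcomp Require Import monalg.
From Stdlib Require Import Relation_Operators.

Set Implicit Arguments.
Unset Strict Implicit.
Unset Printing Implicit Defensive.

Import GRing.Theory Num.Theory.
Local Open Scope quotient_scope.
Local Open Scope classical_set_scope.
Local Open Scope ring_scope.

Inductive axis := Delta | Eps1 | Eps2.

Definition axis_code (i : axis) : nat :=
  match i with Delta => 0 | Eps1 => 1 | Eps2 => 2 end.
Definition axis_decode (n : nat) : option axis :=
  match n with 0 => Some Delta | 1 => Some Eps1 | 2 => Some Eps2 | _ => None end.
Lemma axis_codeK : pcancel axis_code axis_decode. Proof. by case. Qed.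
HB.instance Definition _ := Countable.copy axis (pcan_type axis_codeK).
Lemma axis_enumP : Finite.axiom [:: Delta; Eps1; Eps2]. Proof. by case. Qed.
HB.instance Definition _ := isFinite.Build axis axis_enumP.

Definition at3 (T : Type) (t : T * T * T) (i : axis) : T :=
  match i with Delta => t.1.1 | Eps1 => t.1.2 | Eps2 => t.2 end.

Definition flip3 (s : bool * bool * bool) (i : axis) : bool * bool * bool :=
  match i with
  | Delta => (~~ s.1.1, s.1.2, s.2)
  | Eps1 => (s.1.1, ~~ s.1.2, s.2)
  | Eps2 => (s.1.1, s.1.2, ~~ s.2)
  end.

(* The even part is sl_2 x sl_2 x sl_2, the factor of axis i having the basis
   E i (root 2i), H i = h_{2i}, F i (root -2i).  The odd part is the tensor
   product of the three natural modules C^2; Q s is the tensor product of the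
   basis vectors v_(s Delta), v_(s Eps1), v_(s Eps2), of root
   (+-delta, +-epsilon_1, +-epsilon_2), where true stands for +. *)
Inductive basis :=
  | E of axis | H of axis | F of axis | Q of (bool * bool * bool).

Definition basis_code (x : basis) :=
  match x with
  | E i => inl (inl (inl i)) | H i => inl (inl (inr i))
  | F i => inl (inr i) | Q s => inr s
  end.
Definition basis_decode (c : axis + axis + axis + bool * bool * bool) :=
  match c with
  | inl (inl (inl i)) => E i | inl (inl (inr i)) => H i
  | inl (inr i) => F i | inr s => Q s
  end.
Lemma basis_codeK : cancel basis_code basis_decode. Proof. by case. Qed.
HB.instance Definition _ := Finite.copy basis (can_type basis_codeK).

Lemma card_basis : #|{: basis}| = 17.
Proof.
have /bij_eq_card -> : bijective basis_code.
  by exists basis_decode; [exact: basis_codeK | move=> [[[]|]|]].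
have c3 : #|{: axis}| = 3 by rewrite cardT enumT unlock.
by rewrite !card_sum !card_prod c3 card_bool.
Qed.

Definition odd_basis (x : basis) : bool := if x is Q _ then true else false.

Definition in_nplus (x : basis) : bool :=
  match x with E _ => true | Q s => s.1.1 | _ => false end.

Section Bracket.
Variables (K : nzRingType) (zeta : K).

(* The scalars sigma_i, of sum 0, are the squared lengths of delta, epsilon_1,
   epsilon_2; the odd bracket is
     [u1 u2 u3, v1 v2 v3] =
       \sum_i sigma_i * (\prod_(j != i) psi(uj, vj)) * p(ui, vi)
   with psi the symplectic form such that psi(v_+, v_-) = 1 and
   p(u, v) w = psi(v, w) u + psi(u, w) v, an element of sl_2. *)
Definition sigma (i : axis) : K :=
  match i with Delta => - (1 + zeta) | Eps1 => 1 | Eps2 => zeta end.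

Definition psi (a b : bool) : K := if a == b then 0 else if a then 1 else -1.

Definition psi_others (s t : bool * bool * bool) (i : axis) : K :=
  match i with
  | Delta => psi s.1.2 t.1.2 * psi s.2 t.2
  | Eps1 => psi s.1.1 t.1.1 * psi s.2 t.2
  | Eps2 => psi s.1.1 t.1.1 * psi s.1.2 t.1.2
  end.

Definition odd_term (s t : bool * bool * bool) (i : axis) : K * basis :=
  let c := sigma i * psi_others s t i in
  match at3 s i, at3 t i with
  | true, true => (c * 2, E i)
  | false, false => (- (c * 2), F i)
  | _, _ => (- c, H i)
  end.

(* A list of pairs (c, z) stands for the sum of the c z. *)
Definition bracket (x y : basis) : seq (K * basis) :=
  match x, y with
  | E i, F j => if i == j then [:: (1, H i)] else [::]
  | F i, E j => if i == j then [:: (-1, H i)] else [::]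
  | H i, E j => if i == j then [:: (2, E i)] else [::]
  | E i, H j => if i == j then [:: (-2, E i)] else [::]
  | H i, F j => if i == j then [:: (-2, F i)] else [::]
  | F i, H j => if i == j then [:: (2, F i)] else [::]
  | H i, Q s => [:: (if at3 s i then 1 else -1, Q s)]
  | Q s, H i => [:: (if at3 s i then -1 else 1, Q s)]
  | E i, Q s => if at3 s i then [::] else [:: (1, Q (flip3 s i))]
  | Q s, E i => if at3 s i then [::] else [:: (-1, Q (flip3 s i))]
  | F i, Q s => if at3 s i then [:: (1, Q (flip3 s i))] else [::]
  | Q s, F i => if at3 s i then [:: (-1, Q (flip3 s i))] else [::]
  | Q s, Q t => [seq odd_term s t i | i <- [:: Delta; Eps1; Eps2]]
  | _, _ => [::]
  end.

(* With e_0 = Q (+,-,-) and f_0 = Q (-,+,+) / 2, the coroot h_0 = [e_0, f_0]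
   takes on delta - epsilon_1 - epsilon_2, 2 epsilon_1, 2 epsilon_2 the values
   0, 1, zeta: this is the first row of the Cartan matrix. *)
Lemma bracket_simple_odd :
  bracket (Q (true, false, false)) (Q (false, true, true))
  = [:: (1 + zeta, H Delta); (1, H Eps1); (zeta, H Eps2)].
Proof. by rewrite /= /odd_term /psi /= !(mulr1, mulrN1, mulrNN, opprK). Qed.

End Bracket.

(* (x, y, z) is x delta + y epsilon_1 + z epsilon_2. *)
Notation weight := (int * int * int)%type.

Definition rho : weight := (-1, 1, 1).

Section Modules.
Variables (K : numFieldType) (zeta : K).

(* Left modules over U(g).  No Z/2-grading is imposed: when the weights lie in
   X the parity of the first coordinate of the weight provides one, and all
   submodules and homomorphisms are compatible with it. *)
Record gmodule := GModule {
  gm_sort :> lmodType K;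
  act : basis -> {linear gm_sort -> gm_sort};
  act_bracket : forall x y v,
    act x (act y v) - (-1) ^+ (odd_basis x && odd_basis y) *: act y (act x v)
      = \sum_(p <- bracket zeta x y) p.1 *: act p.2 v
}.

Definition is_submod (M : gmodule) (N : set M) : Prop :=
  [/\ N 0, forall (a : K) u v, N u -> N v -> N (a *: u + v)
    & forall x v, N v -> N (act M x v)].

Definition is_hom (M N : gmodule) (f : {linear M -> N}) : Prop :=
  forall x v, f (act M x v) = act N x (f v).

Definition indecomposable (M : gmodule) : Prop :=
  (exists v : M, v != 0) /\
  forall A B : set M, is_submod A -> is_submod B -> A `&` B = [set 0] ->
    (forall v, exists a b, [/\ A a, B b & v = a + b]) ->
    A = [set 0] \/ B = [set 0].

Definition simple (M : gmodule) : Prop :=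
  (exists v : M, v != 0) /\
  forall N : set M, is_submod N -> N = [set 0] \/ N = setT.

(* A / B is isomorphic to L: f restricts to a surjective homomorphism from A
   onto L, of kernel B. *)
Definition subquot_iso (M : gmodule) (A B : set M) (L : gmodule) : Prop :=
  exists f : M -> L,
    [/\ forall (a : K) u v, A u -> A v -> f (a *: u + v) = a *: f u + f v,
        forall x v, A v -> f (act M x v) = act L x (f v),
        forall w, exists2 v, A v & f v = w
      & forall v, A v -> (f v = 0 <-> B v)].

Definition weight_vector (M : gmodule) (mu : weight) (v : M) : Prop :=
  forall i, act M (H i) v = (at3 mu i)%:~R *: v.

Definition in_span (M : gmodule) (s : seq M) (v : M) : Prop :=
  exists c : 'I_(size s) -> K, v = \sum_i c i *: s`_i.

Definition finitely_generated (M : gmodule) : Prop :=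
  exists s : seq M, forall N : set M,
    is_submod N -> (forall v, v \in s -> N v) -> N = setT.

Definition weight_module (M : gmodule) : Prop :=
  forall v : M, exists s : seq M,
    v = \sum_(u <- s) u /\ forall u, u \in s -> exists mu, weight_vector mu u.

Definition locally_nplus_finite (M : gmodule) : Prop :=
  forall v : M, exists s : seq M,
    in_span s v /\
    forall x u, in_nplus x -> in_span s u -> in_span s (act M x u).

Definition category_O (M : gmodule) : Prop :=
  [/\ finitely_generated M, weight_module M & locally_nplus_finite M].

End Modules.

Arguments is_submod {K zeta M} N.
Arguments simple {K zeta} M.
Arguments indecomposable {K zeta} M.
Arguments category_O {K zeta} M.
Arguments weight_vector {K zeta M} mu v.
Arguments subquot_iso {K zeta M} A B L.

Section Verma.
Variables (K : numFieldType) (zeta : K) (mu : weight).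

(* The tensor algebra T(g), as the free algebra on the basis of g *)
Notation T := {malg K[{fmonom basis}]}.

Definition gen (x : basis) : T := << fmu x >>.

(* The left ideal generated by the kernel of T(g) -> U(g), by n_+ and by the
   h - mu(h), h in the Cartan subalgebra; the quotient of T(g) by it is the
   tensor product over U(b) of U(g) and the one-dimensional b-module of
   weight mu. *)
Inductive verma_rel : T -> Prop :=
  | VermaRelD u v : verma_rel u -> verma_rel v -> verma_rel (u + v)
  | VermaRelM t u : verma_rel u -> verma_rel (t * u)
  | VermaRelBracket x y t :
      verma_rel ((gen x * gen y
        - (-1) ^+ (odd_basis x && odd_basis y) *: (gen y * gen x)
        - \sum_(p <- bracket zeta x y) p.1 *: gen p.2) * t)
  | VermaRelPos x : in_nplus x -> verma_rel (gen x)
  | VermaRelH i : verma_rel (gen (H i) - (at3 mu i)%:~R%:A).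

Definition verma_ideal : {pred T} := fun v => `[< verma_rel v >].

Lemma verma_ideal_zmod : zmod_closed verma_ideal.
Proof.
split=> [|u v /asboolP hu /asboolP hv]; apply/asboolP.
  by rewrite -(mul0r (gen (E Delta))); apply/VermaRelM/VermaRelPos.
by apply: VermaRelD => //; rewrite -mulN1r; apply: VermaRelM.
Qed.
HB.instance Definition _ :=
  GRing.isZmodClosed.Build T verma_ideal verma_ideal_zmod.

Definition verma_sort := Quotient.quot verma_ideal.
HB.instance Definition _ := GRing.Zmodule.on verma_sort.
HB.instance Definition _ := EqQuotient.on verma_sort.

Definition vpi (u : T) : verma_sort := \pi_verma_sort u.

Lemma vpiP u v : vpi u = vpi v <-> verma_rel (u - v).
Proof.
split=> [/eqmodP|/asboolP huv]; last exact/eqmodP.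
by rewrite /equiv /= => /asboolP.
Qed.

Lemma vpiK (x : verma_sort) : vpi (repr x) = x. Proof. exact: reprK. Qed.

Lemma vpiB : {morph vpi : u v / u - v}.
Proof. by move=> u v; rewrite /vpi !piE. Qed.

Lemma vpiD : {morph vpi : u v / u + v}.
Proof. by move=> u v; rewrite /vpi !piE. Qed.

Definition verma_scale (a : K) (x : verma_sort) : verma_sort :=
  vpi (a *: repr x).

Lemma vpiZ a u : vpi (a *: u) = verma_scale a (vpi u).
Proof.
apply/vpiP; rewrite -scalerBr -[X in _ *: X]mul1r scalerAl.
by apply/VermaRelM/vpiP; rewrite vpiK.
Qed.

Lemma verma_scaleA a b x :
  verma_scale a (verma_scale b x) = verma_scale (a * b) x.
Proof. by rewrite -[x]vpiK -!vpiZ scalerA. Qed.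
Lemma verma_scale1 : left_id 1 verma_scale.
Proof. by move=> x; rewrite -[x]vpiK -!vpiZ scale1r. Qed.
Lemma verma_scaleDr : right_distributive verma_scale +%R.
Proof.
move=> a x y; rewrite -[x]vpiK -[y]vpiK.
by rewrite -vpiD -!vpiZ -vpiD scalerDr.
Qed.
Lemma verma_scaleDl x : {morph verma_scale^~ x : a b / a + b}.
Proof. by move=> a b; rewrite -[x]vpiK -!vpiZ -vpiD scalerDl. Qed.
HB.instance Definition _ := GRing.Zmodule_isLmodule.Build K verma_sort
  verma_scaleA verma_scale1 verma_scaleDr verma_scaleDl.

Lemma vpi_is_linear : linear vpi.
Proof. by move=> a u v; rewrite vpiD vpiZ. Qed.
HB.instance Definition _ :=
  GRing.isLinear.Build K T verma_sort _ vpi vpi_is_linear.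

Lemma malg_scalerAr a (u v : T) : u * (a *: v) = a *: (u * v).
Proof.
have uC : u * a%:MP = a%:MP * u.
  rewrite !malgM_def fgmulUg fgmulgU; apply: eq_bigr => k _.
  by rewrite mulm1 mul1m mulrC.
by rewrite -[a *: v]mul_malgC mulrA uC -mulrA mul_malgC.
Qed.

Definition verma_act (x : basis) (v : verma_sort) : verma_sort :=
  vpi (gen x * repr v).

Lemma verma_act_pi x u : verma_act x (vpi u) = vpi (gen x * u).
Proof.
by apply/vpiP; rewrite -mulrBr; apply/VermaRelM/vpiP; rewrite vpiK.
Qed.

Lemma verma_act_is_linear x : linear (verma_act x).
Proof.
move=> a u v.
have -> : a *: u + v = vpi (a *: repr u + repr v).
  by rewrite vpi_is_linear !vpiK.
by rewrite verma_act_pi [gen x * _]mulrDr malg_scalerAr vpi_is_linear.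
Qed.
HB.instance Definition _ x := GRing.isLinear.Build K verma_sort verma_sort _
  (verma_act x) (verma_act_is_linear x).

Lemma verma_act_bracket x y v :
  verma_act x (verma_act y v)
    - (-1) ^+ (odd_basis x && odd_basis y) *: verma_act y (verma_act x v)
  = \sum_(p <- bracket zeta x y) p.1 *: verma_act p.2 v.
Proof.
rewrite -[v]vpiK !verma_act_pi.
under eq_bigr => p _ do rewrite verma_act_pi -linearZ scalerAl.
rewrite -linearZ -linearB -linear_sum /=; apply/vpiP.
by rewrite -mulr_suml !mulrA scalerAl -!mulrBl; apply: VermaRelBracket.
Qed.

Definition verma_hw : gmodule zeta :=
  @GModule K zeta verma_sort verma_act verma_act_bracket.

End Verma.

Section Multiplicities.
Variables (K : numFieldType) (zeta : K).

Definition verma (lam : weight) : gmodule zeta := verma_hw zeta (lam - rho).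

(* L is (isomorphic to) L_lam. *)
Definition is_irr (lam : weight) (L : gmodule zeta) : Prop :=
  simple L /\
  exists2 f : {linear verma lam -> L}, is_hom f & forall w, exists v, f v = w.

(* A / B is isomorphic to L_lam. *)
Definition factor_is (M : gmodule zeta) (A B : set M) (lam : weight) : Prop :=
  exists2 L, is_irr lam L & subquot_iso A B L.

Definition comp_factor (M : gmodule zeta) (lam : weight) : Prop :=
  exists A B : set M,
    [/\ is_submod A, is_submod B, B `<=` A & factor_is A B lam].

Definition comp_series (M : gmodule zeta) (k : nat) (N : nat -> set M) : Prop :=
  [/\ N 0%N = [set 0], N k = setT, forall i, (i <= k)%N -> is_submod (N i)
    & forall i, (i < k)%N -> N i `<=` N i.+1 /\
        exists2 L, simple L & subquot_iso (N i.+1) (N i) L].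

(* [M : L_lam] = p; M has finite length. *)
Definition comp_mult (M : gmodule zeta) (lam : weight) (p : nat) : Prop :=
  exists k (N : nat -> set M),
    comp_series k N /\
    #|[pred i : 'I_k | `[< factor_is (N i.+1) (N i) lam >]]| = p.

(* M = \sum_(lam <- s) L_lam *)
Definition comp_factors (M : gmodule zeta) (s : seq weight) : Prop :=
  forall lam : weight, comp_mult M lam (count_mem lam s).

(* The blocks of O are given by the equivalence relation on simple objects
   generated by being composition factors of a common indecomposable object. *)
Definition linked : weight -> weight -> Prop :=
  clos_refl_sym_trans weight (fun lam mu =>
    exists M : gmodule zeta, [/\ category_O M, indecomposable M,
      comp_factor M lam & comp_factor M mu]).

(* The block B_0; L_rho, of highest weight 0, is the trivial module. *)
Definition principal_block (M : gmodule zeta) : Prop :=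
  category_O M /\ forall lam, comp_factor M lam -> linked lam rho.

End Multiplicities.

Inductive sign := Plus | Minus.

Definition signz (a : sign) : int := if a is Plus then 1 else -1.

Definition sgn_weight (n : nat) (a b c : sign) : weight :=
  (signz a * n%:Z, signz b * n%:Z, signz c * n%:Z).

(* Main.v *)
From HB Require Import structures.
Require Import Defs.
From mathcomp Require Import all_boot all_order all_algebra.
From mathcomp Require Import finmap ring_quotient generic_quotient.
From mathcomp Require Import boolp classical_sets functions.
From mathcomp Require Import monalg.
From mathcomp Require Import reals complex.
From mathcomp Require Import zify ring.
From Stdlib Require Import Relation_Operators.

Set Implicit Arguments.
Unset Strict Implicit.
Unset Printing Implicit Defensive.

Import Order.TTheory GRing.Theory Num.Theory.
Local Open Scope quotient_scope.
Local Open Scope classical_set_scope.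
Local Open Scope ring_scope.

(** Let M be the Verma module of rho-shifted highest weight (-n, bn, cn), with
    highest weight vector v.  The weights of singular vectors of quotients of M
    bound its length from above, explicit singular vectors of M bound it from
    below, and the two bounds agree.

    Upper bound.  Let y be a weight vector that is singular modulo a submodule
    N and not in N.  The Casimir element of g acts on M by the squared length
    of the rho-shifted highest weight, here 0, so the rho-shifted weight
    (x1, x2, x3) of y satisfies -(1 + zeta) x1^2 + x2^2 + zeta x3^2 = 0, and as
    zeta is irrational the three squares are equal ([casimir_norm],
    [sq_length_eq0]).  Now restrict to the even part, the sum of three copies
    of sl_2.  Over it M has a filtration of 16 steps whose layers are generated
    by the vectors Q^I v, for I a set of negative odd roots, each singular
    modulo the previous step.  The three sl_2 Casimirs are scalars on each
    layer, so modulo N and some step of the filtration y is a multiple of a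
    single F_delta^p F_1^q F_2^r Q^I v, on which all three Casimirs take the
    values that the weight of y prescribes ([singular_mod_filt]).  The
    resulting quadratic equations for p, q, r, I leave I empty, or I reduced to
    -delta + b epsilon_1 + c epsilon_2; they give p = 0, and q and r are zero
    or, when the corresponding sign is +, such that F_i^q reflects the weight
    ([weight_arith]).  There remain 2^(1 + number of signs +) possibilities,
    called marks below.  A submodule strictly larger than N meets, modulo the
    filtration, at least one more mark than N ([reach_lt]), so the length of M
    is at most the number of marks.

    Lower bound.  Besides v, the module M has a singular vector w of rho-shifted
    weight (-(n+1), b(n+1), c(n+1)), combination of the F^m q v with q an odd
    root vector ([odd_sing_vec]).  Applying to v and w the powers of F_1 and F_2
    that reflect signs + gives singular vectors as well, so there is one for
    each mark ([chain_vec_sing]).  Order them so that none has a weight below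
    that of an earlier one: then none lies in the submodule generated by the
    earlier ones ([chain_strict]).  This chain of submodules has as many steps
    as there are marks, so each step gains exactly one mark, the successive
    quotients are simple, and their highest weights are those of the singular
    vectors ([chain_max], [chain_factor]).

    The singular vectors are nonzero because the monomials F^m v and F^m q v in
    M are linearly independent ([verma_coord]).  This is seen on the functions
    on the set of formal monomials F^m Q^I v, on which the tensor algebra acts
    on the right by (f . x)(u) = f(x u), where x u is expanded in monomials.
    The coefficients of that expansion are polynomials in zeta, in the weight
    and in the exponents, so that the relations of U(g) amount to finitely many
    polynomial identities, verified by computation ([right_op_rel]).

    Finally M is indecomposable and, for b = c = +, it has factors of levels n
    and n + 1; hence all the factors that occur are linked, from one level to
    the next, to the trivial module ([linked_rho]). *)

(** * Linear combinations with symbolic coefficients *)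

(** An integer times a monomial, given by the sorted list of its variables.
    Variable 0 is zeta; 1, 2, 3 are the coordinates of a highest weight (1 can
    also be the integer n); 4, 5, 6 are the exponents of the three F_i. *)
Definition coefmon := (int * seq nat)%type.
Definition lincomb (T : Type) := seq (coefmon * T).

Definition coefmon_mul (c d : coefmon) : coefmon := (c.1 * d.1, merge leq c.2 d.2).
Definition scale_lin T (c : coefmon) (L : lincomb T) : lincomb T :=
  [seq (coefmon_mul c t.1, t.2) | t <- L].
Definition bind_lin S T (L : lincomb S) (f : S -> lincomb T) : lincomb T :=
  flatten [seq scale_lin t.1 (f t.2) | t <- L].
Definition coef_1 : coefmon := (1, [::]).
Definition coef_N1 : coefmon := (-1, [::]).

Fixpoint insert_term (T : eqType) (t : coefmon * T) (L : lincomb T) : lincomb T :=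
  if L is s :: L' then
    if (s.2 == t.2) && (s.1.2 == t.1.2) then ((s.1.1 + t.1.1, s.1.2), s.2) :: L'
    else s :: insert_term t L'
  else [:: t].
Definition collect (T : eqType) (L : lincomb T) : lincomb T :=
  [seq t <- foldr (@insert_term T) [::] L | t.1.1 != 0].

Section Eval.
Variables (K : comNzRingType) (V : lmodType K) (env : nat -> K).

Definition ev_coef (c : coefmon) : K := c.1%:~R * \prod_(i <- c.2) env i.
Definition ev_lin T (g : T -> V) (L : lincomb T) : V := \sum_(t <- L) ev_coef t.1 *: g t.2.

Lemma ev_coef_mul c d : ev_coef (coefmon_mul c d) = ev_coef c * ev_coef d.
Proof.
rewrite /ev_coef /= intrM (perm_big (c.2 ++ d.2)) /= ?perm_merge // big_cat /=.
by rewrite mulrACA.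
Qed.
Lemma ev_coef_1 : ev_coef coef_1 = 1. Proof. by rewrite /ev_coef big_nil mulr1. Qed.
Lemma ev_coef_N1 : ev_coef coef_N1 = -1. Proof. by rewrite /ev_coef big_nil mulr1. Qed.

Lemma ev_lin_nil T (g : T -> V) : ev_lin g [::] = 0. Proof. exact: big_nil. Qed.
Lemma ev_lin_cons T (g : T -> V) t L : ev_lin g (t :: L) = ev_coef t.1 *: g t.2 + ev_lin g L.
Proof. exact: big_cons. Qed.
Lemma ev_lin_cat T (g : T -> V) L L' : ev_lin g (L ++ L') = ev_lin g L + ev_lin g L'.
Proof. exact: big_cat. Qed.
Lemma ev_lin_scale T (g : T -> V) c L : ev_lin g (scale_lin c L) = ev_coef c *: ev_lin g L.
Proof.
rewrite /ev_lin big_map scaler_sumr; apply: eq_bigr => t _.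
by rewrite ev_coef_mul scalerA.
Qed.
Lemma ev_lin_bind S T (g : T -> V) (L : lincomb S) f :
  ev_lin g (bind_lin L f) = ev_lin (fun s => ev_lin g (f s)) L.
Proof.
elim: L => [|t L IH]; first by rewrite !ev_lin_nil.
by rewrite /bind_lin /= ev_lin_cat ev_lin_scale ev_lin_cons -IH.
Qed.
Lemma ev_lin_map S T (g : T -> V) (h : S -> T) (L : lincomb S) :
  ev_lin g [seq (t.1, h t.2) | t <- L] = ev_lin (g \o h) L.
Proof. by rewrite /ev_lin big_map. Qed.
Lemma eq_ev_lin T (g h : T -> V) L : g =1 h -> ev_lin g L = ev_lin h L.
Proof. by move=> e; apply: eq_bigr => t _; rewrite e. Qed.

Lemma ev_lin_insert (T : eqType) (g : T -> V) t L :
  ev_lin g (insert_term t L) = ev_coef t.1 *: g t.2 + ev_lin g L.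
Proof.
elim: L => [|s L IH] /=; first by rewrite ev_lin_cons.
case: andP => [[/eqP e2 /eqP e1]|_]; last by rewrite !ev_lin_cons IH addrCA.
rewrite !ev_lin_cons /=; have -> : ev_coef (s.1.1 + t.1.1, s.1.2) = ev_coef t.1 + ev_coef s.1.
  by rewrite /ev_coef /= intrD mulrDl addrC e1.
by rewrite e2 scalerDl addrA.
Qed.
Lemma ev_lin_collect (T : eqType) (g : T -> V) L : ev_lin g (collect L) = ev_lin g L.
Proof.
have -> : ev_lin g L = ev_lin g (foldr (@insert_term T) [::] L).
  by elim: L => //= t L IH; rewrite ev_lin_insert -IH ev_lin_cons.
rewrite /collect; elim: (foldr _ _ _) => //= t L' IH; rewrite ev_lin_cons -IH.
case: eqP => [e|_] /=; last by rewrite ev_lin_cons.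
by rewrite /ev_coef e mul0r scale0r add0r.
Qed.
Lemma ev_lin_zero (T : eqType) (g : T -> V) L : collect L = [::] -> ev_lin g L = 0.
Proof. by move=> e; rewrite -ev_lin_collect e ev_lin_nil. Qed.
End Eval.

(** The bracket is affine in zeta, hence determined by its values over the
    integers at zeta = 0 and zeta = 1. *)
Definition sym_bracket (x y : basis) : lincomb basis :=
  flatten [seq [:: ((p.1.1, [::]), p.1.2); ((p.2.1 - p.1.1, [:: 0%N]), p.1.2)]
          | p <- zip (bracket (0 : int) x y) (bracket (1 : int) x y)].

Lemma odd_term_lin (K : numFieldType) (z : K) s t i :
  (odd_term (0 : int) s t i).1%:~R
    + ((odd_term (1 : int) s t i).1%:~R - (odd_term (0 : int) s t i).1%:~R) * z
  = (odd_term z s t i).1.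
Proof.
have psiz a b : (psi int a b)%:~R = psi K a b.
  by rewrite /psi; case: eqP => // _; case: a => //; rewrite intrN.
by rewrite /odd_term; case: (at3 s i); case: (at3 t i); case: i;
  rewrite /= ?(intrN, intrM, intrD) !psiz; ring.
Qed.

Lemma sym_bracketE (K : numFieldType) (V : lmodType K) (env : nat -> K) (g : basis -> V) x y :
  ev_lin env g (sym_bracket x y) = \sum_(p <- bracket (env 0) x y) p.1 *: g p.2.
Proof.
have E c c' b : ev_lin env g [:: ((c, [::]), b); ((c' - c, [:: 0%N]), b)]
    = (c%:~R + (c'%:~R - c%:~R) * env 0) *: g b.
  by rewrite !ev_lin_cons ev_lin_nil /ev_coef !big_seq1 big_nil /= addr0 -scalerDl mulr1 intrB.
have F c c' d b L : c%:~R + (c'%:~R - c%:~R) * env 0 = d ->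
    ev_lin env g [:: ((c, [::]), b), ((c' - c, [:: 0%N]), b) & L]
    = d *: g b + ev_lin env g L.
  by move=> <-; rewrite -E -ev_lin_cat.
case: x => [i|i|i|s]; case: y => [j|j|j|t]; rewrite /sym_bracket //=;
  try by case: (i == j); rewrite /= ?big_seq1 ?big_nil ?E ?ev_lin_nil //= ?subrr ?mul0r ?addr0
      ?intrN.
1-3: by case: (at3 t i); rewrite /= ?big_seq1 ?big_nil ?E ?ev_lin_nil //= ?subrr ?mul0r ?addr0
    ?intrN.
1-3: by case: (at3 s j); rewrite /= ?big_seq1 ?big_nil ?E ?ev_lin_nil //= ?subrr ?mul0r ?addr0
    ?intrN.
rewrite !big_cons big_nil !(F _ _ _ _ _ (odd_term_lin _ _ _ _)) ev_lin_nil.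
by rewrite /odd_term; case: (at3 s _); case: (at3 s _); case: (at3 s _);
  case: (at3 t _); case: (at3 t _); case: (at3 t _).
Qed.

(** * Straightening words in the enveloping algebra *)

(** The PBW order: even lowering, odd lowering, Cartan, even raising, odd
    raising.  Words ordered in this way are of the form F^m Q^I H^k E^l Q^J. *)
Definition pbw_rank (x : basis) : nat :=
  match x with
  | F i => axis_code i
  | Q (false, a, b) => 3 + (~~ a).*2 + ~~ b
  | H i => 7 + axis_code i
  | E i => 10 + axis_code i
  | Q (true, a, b) => 13 + (~~ a).*2 + ~~ b
  end.

(** Expands the product of a letter by a word in ordered words, moving the
    letter to the right until it meets the same letter or one of higher rank; a
    letter that reaches the end of the word acts on the vector according to
    [base].  Odd root vectors square to zero.  When the fuel [n] runs out the
    product is left as it is, so that the result is correct for every [n] and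
    only its being in normal form depends on [n]. *)
Fixpoint straighten (base : basis -> lincomb (seq basis)) (n : nat) (x : basis)
    (w : seq basis) : lincomb (seq basis) :=
  if n is n'.+1 then
    if w is y :: w' then
      if (pbw_rank x < pbw_rank y)%N then [:: (coef_1, x :: w)]
      else if x == y then
        if odd_basis x then [::] else [:: (coef_1, x :: w)]
      else scale_lin (if odd_basis x && odd_basis y then coef_N1 else coef_1)
             (bind_lin (straighten base n' x w') (straighten base n' y))
           ++ bind_lin (sym_bracket x y) (fun z => straighten base n' z w')
    else base x
  else [:: (coef_1, x :: w)].

Section Sound.
Variables (K : numFieldType) (zeta : K) (M : gmodule zeta).

Definition word_act (w : seq basis) (u : M) : M := foldr (fun x => act M x) u w.

Lemma word_act_is_linear w : linear (word_act w).
Proof. by move=> a u v; elim: w => //= x w ->; rewrite linearP. Qed.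
HB.instance Definition _ w := GRing.isLinear.Build K M M _ (word_act w) (word_act_is_linear w).

Lemma word_act_cat w w' u : word_act (w ++ w') u = word_act w (word_act w' u).
Proof. by rewrite /word_act foldr_cat. Qed.

(** Twice the square is the bracket [Q s, Q s], which is zero because 2 alpha
    is not a root for an odd root alpha. *)
Lemma act_Q_sq s u : act M (Q s) (act M (Q s) u) = 0.
Proof.
have := act_bracket (Q s) (Q s) u; rewrite /= expr1 scaleN1r opprK.
have psi_id a : psi K a a = 0 by rewrite /psi eqxx.
have oz i : (odd_term zeta s s i).1 = 0.
  by rewrite /odd_term; case: (at3 s i); case: i; rewrite /= !psi_id !(mulr0, mul0r) ?oppr0.
rewrite !big_cons big_nil !oz !scale0r !addr0 -mulr2n -scaler_nat => /eqP.
by rewrite scaler_eq0 pnatr_eq0 => /eqP.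
Qed.

Variables (env : nat -> K) (u : M) (base : basis -> lincomb (seq basis)).
Hypothesis env0 : env 0 = zeta.
Hypothesis base_sound : forall x, act M x u = ev_lin env (word_act^~ u) (base x).

Lemma sym_swap x y v : act M x (act M y v) =
  (if odd_basis x && odd_basis y then -1 else 1) *: act M y (act M x v)
  + ev_lin env (fun z => act M z v) (sym_bracket x y).
Proof.
rewrite sym_bracketE env0 -act_bracket addrCA; case: (_ && _).
  by rewrite expr1 subrr addr0.
by rewrite expr0 subrr addr0.
Qed.

(** The base must describe the action on [u] only, since straightening never
    acts on anything but words applied to [u]. *)
Lemma straighten_sound n x w : act M x (word_act w u) = ev_lin env (word_act^~ u) (straighten
    base n x w).
Proof.
have triv y t : act M y (word_act t u) = ev_lin env (word_act^~ u) [:: (coef_1, y :: t)].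
  by rewrite ev_lin_cons ev_lin_nil ev_coef_1 scale1r addr0.
elim: n x w => [|n IH] x w; first exact: triv.
case: w => [|y w] /=; first exact: base_sound.
case: ifP => _; first exact: (triv x (y :: w)).
case: eqP => [-> | _].
  case: y => [i|i|i|s] /=;
    rewrite ?ev_lin_cons ?ev_lin_nil ?ev_coef_1 ?scale1r ?addr0 //.
  exact: act_Q_sq.
rewrite ev_lin_cat ev_lin_scale !ev_lin_bind sym_swap; congr (_ + _).
  rewrite IH /ev_lin linear_sum /=.
  set L := straighten _ _ _ _; rewrite !scaler_sumr.
  apply: eq_bigr => t _; rewrite linearZ /= IH.
  by case: (_ && _); rewrite ?ev_coef_N1 ?ev_coef_1.
by apply: eq_ev_lin => z; rewrite IH.
Qed.
End Sound.

(** With this base nothing is known of the vector, and straightening computes in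
    U(g) itself. *)
Definition free_base (x : basis) : lincomb (seq basis) := [:: (coef_1, [:: x])].
(** The base of a highest weight vector on which the coroot [H i] acts by the
    polynomial [h i]. *)
Definition hw_base (h : axis -> seq coefmon) (x : basis) : lincomb (seq basis) :=
  match x with
  | H i => [seq (c, [::]) | c <- h i]
  | E _ => [::]
  | F _ => [:: (coef_1, [:: x])]
  | Q s => if s.1.1 then [::] else [:: (coef_1, [:: x])]
  end.
Definition generic_weight (i : axis) : seq coefmon := [:: (1, [:: (axis_code i).+1])].

Definition straighten_word base n (w : seq basis) (L : lincomb (seq basis)) : lincomb (seq basis) :=
  foldr (fun x L => collect (bind_lin L (straighten base n x))) L w.

Definition negQ : seq basis :=
  [:: Q (false, true, true); Q (false, true, false);
      Q (false, false, true); Q (false, false, false)].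

Fixpoint sublists (T : Type) (k : nat) (s : seq T) : seq (seq T) :=
  match k, s with
  | 0, _ => [:: [::]]
  | k'.+1, x :: s' => [seq x :: t | t <- sublists k' s'] ++ sublists k s'
  | _, [::] => [::]
  end.
(** The 16 products of distinct negative odd root vectors.  They are listed by
    increasing size, and for each size in an order that even raising operators
    decrease: this makes the list the index set of a filtration. *)
Definition odd_words : seq (seq basis) := flatten [seq sublists k negQ | k <- iota 0 5].

Definition isF (x : basis) := if x is F _ then true else false.
Definition axes := [:: Delta; Eps1; Eps2].
(** Large enough for all the words below to be brought to normal form. *)
Definition fuel := 12%N.

Definition lies_below (j : nat) (L : lincomb (seq basis)) : bool :=
  all (fun t => let w := t.2 in let q := filter odd_basis w in
     (w == filter isF w ++ q) && (index q odd_words < j)%N) L.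

(** This makes each step of the filtration stable under the even part, the
    generator of each layer being singular modulo the previous step. *)
Lemma raising_check : all (fun j => all (fun i =>
   lies_below j (collect (straighten (hw_base generic_weight) fuel (E i) (nth [::] odd_words
       j)))) axes) (iota 0 16).
Proof. by vm_compute. Qed.
(** This makes the last step stable under negative odd root vectors. *)
Lemma odd_mul_check : all (fun j => all (fun q =>
   lies_below 16 (collect (straighten (hw_base generic_weight) fuel q (nth [::] odd_words j))))
       negQ) (iota 0 16).
Proof. by vm_compute. Qed.

Definition bools3 := [seq (ab, c) | ab <- [seq (a, b) | a <- [:: true; false], b <- [:: true;
    false]], c <- [:: true; false]].
Definition sym_sigma (i : axis) : lincomb unit :=
  match i with
  | Delta => [:: (coef_N1, tt); ((-1, [:: 0%N]), tt)]
  | Eps1 => [:: (coef_1, tt)]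
  | Eps2 => [:: ((1, [:: 0%N]), tt)]
  end.
(** The even part is the combination of the Casimirs H^2 + 2H + 4FE of the
    three sl_2 by the squared lengths [sigma]; the odd part pairs each odd
    basis vector with its dual for the product of the three symplectic forms,
    the signs being those of that pairing. *)
Definition casimir : lincomb (seq basis) :=
  flatten [seq bind_lin (sym_sigma i) (fun _ : unit =>
    [:: (coef_1, [:: H i; H i]); ((2, [::]), [:: H i]); ((4, [::]), [:: F i; E i])]) | i <- axes]
  ++ [seq ((if s.1.1 (+) s.1.2 (+) s.2 then coef_1 else coef_N1),
           [:: Q s; Q (~~ s.1.1, ~~ s.1.2, ~~ s.2)]) | s <- bools3].
Definition all_basis : seq basis :=
  [seq E i | i <- axes] ++ [seq H i | i <- axes] ++ [seq F i | i <- axes] ++ [seq Q s | s <-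
      bools3].

(** * The tensor algebra acting on modules, and the universal property of Verma modules *)

Section Ext.
Variables (K : numFieldType) (V : lmodType K).
Notation T := {malg K[{fmonom basis}]}.

(** The linear extension of a function on words to the free algebra. *)
Definition malg_lift (h : seq basis -> V) (t : T) : V :=
  \sum_(k <- msupp t) t@_k *: h k.

Lemma malg_liftEw (d : {fset {fmonom basis}}) h t :
  (msupp t `<=` d)%fset -> malg_lift h t = \sum_(k <- d) t@_k *: h k.
Proof.
move=> le_td; rewrite /malg_lift (big_fset_incl _ le_td) // => k _ /mcoeff_outdom ->.
by rewrite scale0r.
Qed.

Lemma malg_lift_is_linear h : linear (malg_lift h).
Proof.
move=> a t u; pose d := (msupp t `|` msupp u `|` msupp (a *: t + u))%fset.
rewrite !(@malg_liftEw d) ?fsubsetUr //; try by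
  rewrite /d -fsetUA ?fsubsetUl // fsetUCA fsubsetUl.
rewrite scaler_sumr -big_split; apply: eq_bigr => k _.
by rewrite mcoeffD mcoeffZ scalerDl scalerA.
Qed.
HB.instance Definition _ h := GRing.isLinear.Build K T V _ (malg_lift h) (malg_lift_is_linear h).

Lemma malg_liftU h c k : malg_lift h << c *g k >> = c *: h k.
Proof.
rewrite (@malg_liftEw [fset k]%fset) ?msuppU_le // big_seq_fset1.
by rewrite mcoeffU eqxx.
Qed.

Lemma eq_malg_lift h g t : h =1 g -> malg_lift h t = malg_lift g t.
Proof. by move=> e; apply: eq_bigr => k _; rewrite e. Qed.

Lemma malg_lift_mul h t u :
  malg_lift h (t * u) = malg_lift (fun a => malg_lift (fun b => h (a ++ b)) u) t.
Proof.
rewrite [t in LHS]monalgE mulr_suml linear_sum /=; apply: eq_bigr => k _.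
rewrite [u in LHS]monalgE mulr_sumr linear_sum /= scaler_sumr.
apply: eq_bigr => l _; rewrite malgM_def fgmulUU malg_liftU scalerA.
by rewrite fmM.
Qed.

Lemma malg_lift_gen h x : malg_lift h (gen K x) = h [:: x].
Proof. by rewrite malg_liftU scale1r fmU. Qed.
Lemma malg_lift_1 h : malg_lift h 1 = h [::].
Proof. by rewrite -mpolyC1E malg_liftU scale1r fm1. Qed.
End Ext.

Section Universal.
Variables (K : numFieldType) (zeta : K).
Notation T := {malg K[{fmonom basis}]}.

Definition singular (M : gmodule zeta) (mu : weight) (u : M) : Prop :=
  weight_vector mu u /\ forall x, in_nplus x -> act M x u = 0.

Section Act.
Variable M : gmodule zeta.
Implicit Types (u v : M) (t s : T).

Definition tensor_act u t : M := malg_lift (fun w => word_act w u) t.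
HB.instance Definition _ u := GRing.isLinear.Build K T M _ (tensor_act u) (malg_lift_is_linear _).

Lemma tensor_act_mul u t s : tensor_act u (t * s) = tensor_act (tensor_act u s) t.
Proof.
rewrite /tensor_act malg_lift_mul; apply: eq_malg_lift => a.
rewrite [in RHS]/malg_lift linear_sum /=; apply: eq_bigr => b _.
by rewrite linearZ /= -word_act_cat.
Qed.
Lemma tensor_act_gen u x : tensor_act u (gen K x) = act M x u.
Proof. exact: malg_lift_gen. Qed.
Lemma tensor_act_1 u : tensor_act u 1 = u.
Proof. exact: malg_lift_1. Qed.
Lemma tensor_act_0 t : tensor_act 0 t = 0.
Proof. by rewrite /tensor_act /malg_lift big1 // => k _; rewrite linear0 scaler0. Qed.

Lemma tensor_act_lin u (s : seq (K * basis)) :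
  tensor_act u (\sum_(p <- s) p.1 *: gen K p.2) = \sum_(p <- s) p.1 *: act M p.2 u.
Proof.
rewrite (linear_sum (tensor_act u)); apply: eq_bigr => p _.
by rewrite linearZ /= tensor_act_gen.
Qed.

(** By induction on the generation of the left ideal: the bracket relations hold
    in every module, the others say that [u] is singular of weight [mu], and
    left multiples of elements killing [u] kill it. *)
Lemma tensor_act_rel mu u t : singular mu u -> verma_rel zeta mu t -> tensor_act u t = 0.
Proof.
move=> [wu su]; elim=> {t}
  [t s _ ht _ hs|t s _ hs|x y t|x px|i].
- by rewrite linearD /= ht hs addr0.
- by rewrite tensor_act_mul hs tensor_act_0.
- have lin3 w (a p q : T) (k : K) : tensor_act w (a - k *: p - q) = tensor_act w a - k *:
    tensor_act w p - tensor_act w q.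
    by rewrite !linearB linearZ.
  rewrite tensor_act_mul lin3 -[RHS](subrr (\sum_(p <- bracket zeta x y) p.1 *: act M p.2
      (tensor_act u t))).
  congr (_ - _); last exact: tensor_act_lin.
  by rewrite -act_bracket; congr (_ - _ *: _); rewrite tensor_act_mul !tensor_act_gen.
- by rewrite tensor_act_gen su.
by rewrite linearB /= linearZ /= tensor_act_gen tensor_act_1 wu subrr.
Qed.
End Act.

Section Hom.
Variables (mu : weight) (M : gmodule zeta) (u : M).
Hypothesis su : singular mu u.

(** The universal property: a singular vector [u] of weight [mu] is the image of
    the generator of the Verma module, t |-> t u being zero on its ideal. *)
Definition verma_map (y : verma_hw zeta mu) : M := tensor_act u (repr y).

Lemma verma_map_pi t : verma_map (vpi zeta mu t) = tensor_act u t.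
Proof.
apply/eqP; rewrite -subr_eq0 -linearB; apply/eqP.
by apply: tensor_act_rel su _; apply/vpiP; exact: vpiK.
Qed.

Lemma verma_map_is_linear : linear verma_map.
Proof.
move=> a y z; have -> : a *: y + z = vpi zeta mu (a *: repr y + repr z).
  by rewrite vpi_is_linear !vpiK.
by rewrite verma_map_pi linearP.
Qed.

Definition verma_hom : {linear verma_hw zeta mu -> M} :=
  HB.pack verma_map (GRing.isLinear.Build K (verma_hw zeta mu) M _ verma_map verma_map_is_linear).

Lemma verma_hom_is_hom : is_hom verma_hom.
Proof.
move=> x y /=; rewrite -{1}[y]vpiK verma_act_pi verma_map_pi tensor_act_mul tensor_act_gen.
by [].
Qed.
End Hom.

Definition verma_top (mu : weight) : verma_hw zeta mu := vpi zeta mu 1.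

Lemma verma_map_top mu (M : gmodule zeta) (u : M) : singular mu u -> verma_map (M := M) (mu :=
    mu) u (verma_top mu) = u.
Proof. by move=> su; rewrite (verma_map_pi su) tensor_act_1. Qed.

Lemma vpi_tensor_act mu t : vpi zeta mu t = tensor_act (verma_top mu) t.
Proof.
rewrite [t in LHS]monalgE linear_sum; apply: eq_bigr => k _ /=.
have -> : << t@_k *g k >> = t@_k *: (<< k >> : T).
  apply/malgP => l; rewrite mcoeffZ !mcoeffU.
  by case: eqP => _; rewrite ?mulr0n ?mulr0 ?mulr1n ?mulr1.
rewrite linearZ; congr (_ *: _) => /=.
case: k => w; elim: w => [|x w IH] /=.
  by rewrite /verma_top -mpolyC1E; congr (vpi zeta mu << _ *g _ >>); apply/eqP; rewrite fmP fm1.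
rewrite -IH verma_act_pi; congr (vpi zeta mu).
rewrite /gen malgM_def fgmulUU mul1r; congr (<< _ *g _ >>).
by apply/eqP; rewrite fmP fmM fmU.
Qed.

Lemma verma_top_singular mu : singular mu (verma_top mu).
Proof.
split=> [i|x px]; rewrite /= verma_act_pi mulr1.
  transitivity (vpi zeta mu ((at3 mu i)%:~R *: 1)); last exact: vpiZ.
  by apply/vpiP; exact: VermaRelH.
rewrite -[0](linear0 (vpi zeta mu)); apply/vpiP.
by rewrite subr0; exact: VermaRelPos.
Qed.

Lemma verma_top_gen mu (N : verma_hw zeta mu -> Prop) :
  is_submod N -> N (verma_top mu) -> forall y, N y.
Proof.
move=> [N0 NL Nact] Nv y; rewrite -[y]vpiK vpi_tensor_act /tensor_act /malg_lift.
apply: (big_ind N) => // [a b Na Nb|k _]; first by rewrite -[a]scale1r; exact: NL.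
rewrite -[_ *: _]addr0; apply: NL => //.
by elim: (k : seq basis) => //= x w; exact: Nact.
Qed.
End Universal.

(** * Right action on functions of PBW monomials *)

Definition addw (d e : weight) : weight := (d.1.1 + e.1.1, d.1.2 + e.1.2, d.2 + e.2).
Definition unitw (i : axis) (c : int) : weight :=
  match i with Delta => (c, 0, 0) | Eps1 => (0, c, 0) | Eps2 => (0, 0, c) end.
Definition exponent_var (i : axis) : nat := (axis_code i + 4)%N.

(** The product F^(m + d) x is encoded by the pair of [d] and [x].  The terms
    are those of
      x F_i^m = F_i^m x + m F_i^(m-1) [x, F_i]
                + m (m-1) / 2 F_i^(m-2) [[x, F_i], F_i],
    where the double bracket is nonzero only for x = E_i, when it is
    [H_i, F_i] = - 2 F_i.  The coefficients use the variable m even when the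
    exponent of F_i has been shifted: the three F_i are passed in turn, and
    each of them is shifted only while it is passed. *)
Definition commute_past (i : axis) (d : weight) (x : basis) : lincomb (weight * basis) :=
  (coef_1, (d, x))
  :: scale_lin (1, [:: exponent_var i]) [seq (t.1, (addw d (unitw i (-1)), t.2)) | t <-
      sym_bracket x (F i)]
  ++ (if x == E i then
        [:: ((-1, [:: exponent_var i; exponent_var i]), (addw d (unitw i (-2)), F i));
            ((1, [:: exponent_var i]), (addw d (unitw i (-2)), F i))]
      else [::]).
Definition commute_past_all (x : basis) : lincomb (weight * basis) :=
  bind_lin (bind_lin (commute_past Delta 0 x) (fun p => commute_past Eps1 p.1 p.2))
        (fun p => commute_past Eps2 p.1 p.2).
Definition F_exponents (w : seq basis) : weight :=
  ((count_mem (F Delta) w)%:Z, (count_mem (F Eps1) w)%:Z, (count_mem (F Eps2) w)%:Z).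

Definition table := seq (seq (lincomb (nat * weight))).
Definition entry (tab : table) (x : basis) (j : nat) : lincomb (nat * weight) :=
  nth [::] (nth [::] tab (index x all_basis)) j.
Definition mktable (f : basis -> nat -> lincomb (nat * weight)) : table :=
  [seq [seq collect (f x j) | j <- iota 0 16] | x <- all_basis].

(** Products of a basis vector by an odd word applied to a highest weight vector
    of symbolic weight: position of the odd word, exponents of the F-word. *)
Definition action_table : table := Eval vm_compute in
  mktable (fun x j => [seq (t.1, (index (filter odd_basis t.2) odd_words, F_exponents t.2))
                      | t <- straighten (hw_base generic_weight) fuel x (nth [::] odd_words j)]).
(** The products x F^m Q^I v for symbolic exponents m: [x] first passes F^m,
    then acts on Q^I v. *)
Definition operator_table : table := Eval vm_compute in
  mktable (fun x j => bind_lin (commute_past_all x) (fun p =>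
    [seq (t.1, (t.2.1, addw p.1 t.2.2)) | t <- entry action_table p.2 j])).
Definition operator_row := entry operator_table.

Definition shiftv (d : weight) (v : nat) : int :=
  match v with 4 => d.1.1 | 5 => d.1.2 | 6 => d.2 | _ => 0 end.
(** Expansion of a monomial after the substitution m |-> m + d of the exponents.
    It is needed to compose two operators, the second of which acts on the
    monomials, with shifted exponents, that the first has produced. *)
Fixpoint shiftm (d : weight) (m : seq nat) : seq coefmon :=
  if m is v :: m' then
    let L := shiftm d m' in
    [seq coefmon_mul (1, [:: v]) c | c <- L] ++
    (if shiftv d v == 0 then [::] else [seq coefmon_mul (shiftv d v, [::]) c | c <- L])
  else [:: coef_1].
Definition shiftl T (d : weight) (L : lincomb T) : lincomb T :=
  flatten [seq [seq (coefmon_mul (t.1.1, [::]) c, t.2) | c <- shiftm d t.1.2] | t <- L].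

Definition compose_rows (x y : basis) (j : nat) : lincomb (nat * weight) :=
  bind_lin (operator_row y j) (fun p =>
    [seq (t.1, (t.2.1, addw p.2 t.2.2)) | t <- shiftl p.2 (operator_row x p.1)]).

Definition super_sign (x y : basis) : coefmon := if odd_basis x && odd_basis y then coef_N1 else
    coef_1.

Definition relcheck x y j : bool :=
  collect (compose_rows x y j
    ++ scale_lin (coefmon_mul coef_N1 (super_sign x y)) (compose_rows y x j)
    ++ scale_lin coef_N1 (bind_lin (sym_bracket x y) (fun z => operator_row z j))) == [::].

Definition posQ : seq basis :=
  [:: Q (true, true, true); Q (true, true, false);
      Q (true, false, true); Q (true, false, false)].
Definition low_basis : seq basis :=
  [seq E i | i <- axes] ++ [seq H i | i <- axes] ++ [seq F i | i <- axes] ++ negQ.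
(** The pairs for which the bracket relation is verified by computation.  By
    symmetry it suffices to take them in one order, and the remaining pairs,
    which involve a positive odd root vector, follow from these by
    [right_rel_lift]. *)
Definition checked_pairs : seq (basis * basis) :=
  [seq xy <- [seq (x, y) | x <- low_basis, y <- low_basis] | (pbw_rank xy.1 <= pbw_rank xy.2)%N]
  ++ [seq (x, y) | x <- posQ, y <- E Delta :: negQ].

Lemma model_check : all (fun xy => all (relcheck xy.1 xy.2) (iota 0 16)) checked_pairs.
Proof. by vm_compute. Qed.

Lemma sym_check : all (fun x => all (fun y =>
  collect (sym_bracket y x ++ scale_lin (super_sign x y) (sym_bracket x y)) == [::]) all_basis)
      all_basis.
Proof. by vm_compute. Qed.

Lemma mem_all_basis x : x \in all_basis.
Proof. by case: x => [[]|[]|[]|[[[] []] []]]. Qed.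

(** The relation [E_delta, q] = p, and the super Jacobi identity for E_delta,
    [q] and [y]. *)
Definition liftable (q p y : basis) : bool :=
  [&& collect (sym_bracket (E Delta) q) == [:: (coef_1, p)],
      collect (bind_lin (sym_bracket q y) (sym_bracket (E Delta)) ++ scale_lin coef_N1 (bind_lin
          (sym_bracket (E Delta) y) (sym_bracket q))
           ++ scale_lin coef_N1 (sym_bracket p y)) == [::],
      all (fun t => odd_basis t.2 == odd_basis y) (sym_bracket (E Delta) y) &
      all (mem low_basis) (unzip2 (sym_bracket (E Delta) y) ++ unzip2 (sym_bracket q y))].
Lemma lift_check : all (fun qp => all (liftable qp.1 qp.2)
   ([:: E Eps1; E Eps2; H Delta; H Eps1; H Eps2; F Delta; F Eps1; F Eps2] ++ posQ)) (zip negQ posQ).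
Proof. by vm_compute. Qed.

Section Lift.
Variables (K : numFieldType) (V : lmodType K) (env : nat -> K).
Variable A : basis -> {linear V -> V}.

(** For a right action, with f . x = [A x f], this is the relation
    f . (x y) = +- f . (y x) + f . [x, y]. *)
Definition right_rel x y := forall f, A y (A x f) =
  ev_coef env (super_sign x y) *: A x (A y f) + ev_lin env (fun z => A z f) (sym_bracket x y).

Lemma right_rel_sym x y : right_rel x y -> right_rel y x.
Proof.
move=> Rxy f; have /eqP := allP (allP sym_check _ (mem_all_basis x)) _ (mem_all_basis y).
move=> /(ev_lin_zero env (fun z => A z f)) /eqP.
rewrite ev_lin_cat ev_lin_scale addr_eq0 => /eqP ->.
rewrite Rxy scalerDr scalerA.
have -> : ev_coef env (super_sign y x) = ev_coef env (super_sign x y).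
  by rewrite /super_sign andbC.
have -> : ev_coef env (super_sign x y) * ev_coef env (super_sign x y) = 1.
  by rewrite /super_sign; case: ifP => _; rewrite ?ev_coef_N1 ?ev_coef_1 ?mulr1 ?mulrNN ?mulr1.
by rewrite scale1r addrK.
Qed.

Lemma linear_ev_lin T x (g : T -> V) L : A x (ev_lin env g L) = ev_lin env (A x \o g) L.
Proof. by rewrite linear_sum; apply: eq_bigr => t _; rewrite linearZ. Qed.

(** Every positive odd root vector is p = [E_delta, q] with q negative, so the
    operator of [p] is the commutator of those of E_delta and [q]; its relation
    with [y] then follows from the relations among E_delta, [q] and [y] by the
    Jacobi identity. *)
Lemma right_rel_lift q p y :
  odd_basis q -> odd_basis p -> liftable q p y ->
  right_rel (E Delta) q -> right_rel (E Delta) y -> right_rel q y ->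
  (forall z, z \in low_basis -> right_rel q z) -> (forall z, z \in low_basis -> right_rel (E
      Delta) z) ->
  right_rel p y.
Proof.
move=> oq op /and4P[/eqP epq /eqP J ody]; rewrite all_cat => /andP[/allP le /allP lq].
move: le lq ody J epq; set e := E Delta => le lq ody J epq.
have oe : odd_basis e = false by [].
move=> Req Rey Rqy Rqz Rez f.
have Ap g : A p g = A q (A e g) - A e (A q g).
  rewrite Req -[ev_lin _ _ (sym_bracket e q)]ev_lin_collect epq ev_lin_cons ev_lin_nil !ev_coef_1.
  by rewrite !scale1r addr0 addrC addKr.
pose s := ev_coef env (super_sign q y).
have se x g : ev_coef env (super_sign e x) *: g = g by rewrite /super_sign oe ev_coef_1 scale1r.
have -> : ev_coef env (super_sign p y) = s by rewrite /s /super_sign op oq.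
have E1 : A y (A q (A e f)) = s *: A q (A e (A y f))
    + s *: ev_lin env (fun z => A q (A z f)) (sym_bracket e y)
    + ev_lin env (fun z => A e (A z f)) (sym_bracket q y)
    + ev_lin env (fun z => ev_lin env (fun z' => A z' f) (sym_bracket e z)) (sym_bracket q y).
  rewrite Rqy Rey se linearD linear_ev_lin scalerDr -/s -!addrA; congr (_ + (_ + _)).
  rewrite /ev_lin -big_split; apply: eq_big_seq => t ht /=.
  by rewrite Rez ?se ?scalerDr //; apply: lq; apply/mapP; exists t.
have E2 : A y (A e (A q f)) = s *: A e (A q (A y f))
    + ev_lin env (fun z => A e (A z f)) (sym_bracket q y)
    + s *: ev_lin env (fun z => A q (A z f)) (sym_bracket e y)
    + ev_lin env (fun z => ev_lin env (fun z' => A z' f) (sym_bracket q z)) (sym_bracket e y).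
  rewrite Rey se Rqy linearD linearZ linear_ev_lin -/s -!addrA; congr (_ + (_ + _)).
  rewrite /ev_lin scaler_sumr -big_split; apply: eq_big_seq => t ht /=.
  rewrite Rqz; last by apply: le; apply/mapP; exists t.
  have -> : super_sign q t.2 = super_sign q y by rewrite /super_sign (eqP (allP ody _ ht)).
  by rewrite scalerDr !scalerA mulrC.
have {}J := ev_lin_zero env (fun z => A z f) J.
move: J; rewrite !ev_lin_cat !ev_lin_scale !ev_lin_bind ev_coef_N1 !scaleN1r => /eqP.
rewrite addrA subr_eq0 => /eqP <-.
rewrite !Ap !linearB /= E1 E2.
have abel (a b c d a' e' : V) :
    a + b + c + d - (a' + c + b + e') = a - a' + (d - e').
  by rewrite -(addrA a) -(addrA a') (addrC c b) opprD addrACA (opprD a') (addrACA a) subrr addr0.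
exact: abel.
Qed.
End Lift.

Section Model.
Variables (K : numFieldType) (zeta : K) (p : axis -> K).

Definition pbw_env (m : weight) (v : nat) : K :=
  match v with
  | 0 => zeta | 1 => p Delta | 2 => p Eps1 | 3 => p Eps2
  | 4 => m.1.1%:~R | 5 => m.1.2%:~R | 6 => m.2%:~R | _ => 0
  end.
Notation X := (nat * weight -> K^o).

(** The value of f . x at the monomial F^m Q^I v is the value of f at the
    expansion of x F^m Q^I v; [e.1] is the position of I and [e.2] is m.  The
    exponents range over all integers, negative ones included: the relations,
    being polynomial identities, still hold, and no boundary case arises. *)
Definition right_op (x : basis) (f : X) : X :=
  fun e => ev_lin (pbw_env e.2) (fun t => f (t.1, addw e.2 t.2)) (operator_row x e.1).

Lemma addXE (f g : X) e : (f + g) e = f e + g e. Proof. by []. Qed.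
Lemma scaleXE a (f : X) e : (a *: f) e = a *: f e. Proof. by []. Qed.
Lemma evlXE T v (g : T -> X) L e : ev_lin v g L e = ev_lin v (fun t => g t e) L.
Proof.
elim: L => [|t L IH]; first by rewrite !ev_lin_nil.
by rewrite !ev_lin_cons addXE scaleXE IH.
Qed.

Lemma right_op_is_linear x : linear (right_op x).
Proof.
move=> a f g; apply/funext => e; rewrite addXE scaleXE /right_op /ev_lin.
rewrite scaler_sumr -big_split; apply: eq_bigr => t _ /=.
by rewrite addXE scaleXE scalerDr !scalerA mulrC.
Qed.
HB.instance Definition _ x := GRing.isLinear.Build K X X _ (right_op x) (right_op_is_linear x).

Lemma addwA d e f : addw d (addw e f) = addw (addw d e) f.
Proof. by rewrite /addw /= !addrA. Qed.

Lemma pbw_env_shift m d v : pbw_env (addw m d) v = pbw_env m v + (shiftv d v)%:~R.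
Proof. by case: v => [|[|[|[|[|[|[|v]]]]]]] //=; rewrite ?addr0 // intrD. Qed.

Lemma shiftmE m d s :
  \sum_(c <- shiftm d s) ev_coef (pbw_env m) c = \prod_(v <- s) pbw_env (addw m d) v.
Proof.
elim: s => [|v s IH] /=; first by rewrite big_seq1 big_nil ev_coef_1.
rewrite big_cat big_cons pbw_env_shift mulrDl -IH; congr (_ + _).
  rewrite big_map mulr_sumr; apply: eq_bigr => c _.
  by rewrite ev_coef_mul /ev_coef /= big_seq1 mul1r.
case: eqP => [->|_]; first by rewrite mul0r big_nil.
rewrite big_map mulr_sumr; apply: eq_bigr => c _.
by rewrite ev_coef_mul {1}/ev_coef /= big_nil mulr1.
Qed.

Lemma ev_lin_shiftl T (V : lmodType K) (g : T -> V) m d L :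
  ev_lin (pbw_env m) g (shiftl d L) = ev_lin (pbw_env (addw m d)) g L.
Proof.
elim: L => [|t L IH]; first by rewrite !ev_lin_nil.
rewrite /shiftl /= ev_lin_cat -/(shiftl d L) IH ev_lin_cons; congr (_ + _).
rewrite /ev_lin big_map /= -scaler_suml; congr (_ *: _).
rewrite [RHS]/ev_coef -shiftmE mulr_sumr; apply: eq_bigr => c _.
by rewrite ev_coef_mul {1}/ev_coef /= big_nil mulr1.
Qed.

(** For a right action the operator of [x] is applied first; in the expansion
    of x (y u) it is the monomials of y u that [x] meets, whence the shift. *)
Lemma compose_rowsE x y f j m :
  ev_lin (pbw_env m) (fun t => f (t.1, addw m t.2)) (compose_rows x y j)
  = right_op y (right_op x f) (j, m).
Proof.
rewrite /compose_rows ev_lin_bind; apply: eq_ev_lin => t.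
rewrite (ev_lin_map _ _ (fun s => (s.1, addw t.2 s.2))) ev_lin_shiftl.
by apply: eq_ev_lin => s /=; rewrite addwA.
Qed.

Lemma operator_row_big x j : (16 <= j)%N -> operator_row x j = [::].
Proof.
move=> j16; rewrite /operator_row /entry nth_default // (leq_trans _ j16) //.
have := mem_all_basis x; rewrite -index_mem; move: (index x all_basis) => k.
have : all (fun r => size r <= 16)%N operator_table by vm_compute.
by move=> /all_nthP h kl; apply: h.
Qed.

Lemma ev_sym_bracket m (V : lmodType K) (g : basis -> V) x y :
  ev_lin (pbw_env m) g (sym_bracket x y) = ev_lin (pbw_env 0) g (sym_bracket x y).
Proof. by rewrite !sym_bracketE. Qed.

Lemma ev_super_sign m x y : ev_coef (pbw_env m) (super_sign x y) = ev_coef (pbw_env 0)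
    (super_sign x y).
Proof. by rewrite /super_sign; case: ifP; rewrite ?ev_coef_N1 ?ev_coef_1. Qed.

Lemma rel_pairs x y : (x, y) \in checked_pairs -> right_rel (pbw_env 0) right_op x y.
Proof.
move=> xy f; apply/funext => -[j m].
rewrite addXE scaleXE evlXE /=.
have [j16|j16] := leqP 16 j.
  rewrite /right_op /= !operator_row_big // !ev_lin_nil scaler0 add0r.
  by rewrite /ev_lin big1 // => t _; rewrite operator_row_big // big_nil scaler0.
have := allP (allP model_check _ xy) j; rewrite mem_iota => /(_ j16) /eqP.
move=> /(ev_lin_zero (pbw_env m) (fun t => f (t.1, addw m t.2))).
rewrite !ev_lin_cat !ev_lin_scale !compose_rowsE ev_lin_bind /= ev_coef_mul ev_coef_N1 mulN1r
    ev_super_sign.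
rewrite scaleN1r ev_sym_bracket scaleNr => /eqP; rewrite -opprD subr_eq0 => /eqP ->.
by [].
Qed.

(** The verified pairs, their symmetries and the lifts through E_delta exhaust
    all pairs. *)
Lemma right_op_rel x y : right_rel (pbw_env 0) right_op x y.
Proof.
have lowP z : (z \in low_basis) || (z \in posQ) by case: z => [[]|[]|[]|[[[] []] []]].
have low_low a b : a \in low_basis -> b \in low_basis -> right_rel (pbw_env 0) right_op a b.
  move=> la lb; wlog ab : a b la lb / (pbw_rank a <= pbw_rank b)%N => [h|].
    by case: (leqP (pbw_rank a) (pbw_rank b)) => [|/ltnW] ab; [|apply: right_rel_sym]; exact: h.
  apply: rel_pairs; rewrite mem_cat; apply/orP; left.
  rewrite mem_filter; apply/andP; split=> //.
  by apply/allpairsP; exists (a, b).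
have pos_neg a b : a \in posQ -> b \in E Delta :: negQ -> right_rel (pbw_env 0) right_op a b.
  move=> pa nb; apply: rel_pairs; rewrite mem_cat; apply/orP; right.
  by apply/allpairsP; exists (a, b).
have neg_low q : q \in negQ -> q \in low_basis by rewrite /low_basis !mem_cat => ->; rewrite !orbT.
have pos_any a b : a \in posQ -> right_rel (pbw_env 0) right_op a b.
  move=> pa; have [nb|nb] := boolP (b \in E Delta :: negQ); first exact: pos_neg.
  pose q := nth (E Delta) negQ (index a posQ).
  have ia : (index a posQ < 4)%N by rewrite index_mem.
  have nq : q \in negQ by rewrite mem_nth.
  have qa : (q, a) \in zip negQ posQ.
    apply/(nthP (E Delta, E Delta)); exists (index a posQ) => //.
    by rewrite nth_zip // nth_index.
  have /orP[lb|pb] := lowP b.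
    have lift := allP (allP lift_check _ qa) b.
    apply: (@right_rel_lift _ _ _ right_op q) => //.
    - by move: nq; rewrite !inE => /or4P[] /eqP ->.
    - by move: pa; rewrite !inE => /or4P[] /eqP ->.
    - apply: lift; move: lb nb {pa pos_neg low_low}; case: b => [[]|[]|[]|[[[] []] []]] //.
    - exact: low_low (neg_low _ nq).
    - exact: low_low.
    - exact: low_low (neg_low _ nq) _.
    - by move=> z lz; apply: low_low (neg_low _ nq) lz.
    - by move=> z lz; apply: low_low.
  apply: (@right_rel_lift _ _ _ right_op q) => //.
  - by move: nq; rewrite !inE => /or4P[] /eqP ->.
  - by move: pa; rewrite !inE => /or4P[] /eqP ->.
  - by apply: (allP (allP lift_check _ qa) b); rewrite mem_cat pb orbT.
  - exact: low_low (neg_low _ nq).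
  - by apply: right_rel_sym; exact: pos_neg.
  - by apply: right_rel_sym; apply: pos_neg; rewrite // inE nq orbT.
  - by move=> z lz; apply: low_low (neg_low _ nq) lz.
  - by move=> z lz; apply: low_low.
have /orP[lx|px] := lowP x; last exact: pos_any.
have /orP[ly|py] := lowP y; first exact: low_low.
by apply: right_rel_sym; exact: pos_any.
Qed.

(** At exponents zero a term containing an exponent variable vanishes. *)
Definition at0 (L : lincomb (nat * weight)) : lincomb (nat * weight) :=
  [seq t <- L | all (gtn 4) t.1.2].
Lemma ev_lin_at0 (g : nat * weight -> K^o) L : ev_lin (pbw_env 0) g (at0 L) = ev_lin (pbw_env 0)
    g L.
Proof.
elim: L => //= t L IH; case: ifP => [|/negbT/allPn[v vt v4]]; rewrite !ev_lin_cons IH //.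
have -> : ev_coef (pbw_env 0) t.1 = 0; last by rewrite scale0r add0r.
rewrite /ev_coef (big_rem v) //=.
by case: v v4 {vt} => [|[|[|[|[|[|[|v]]]]]]] //= _; rewrite ?mulr0z !(mul0r, mulr0).
Qed.
Lemma right_op_at0 x f j : right_op x f (j, 0) = ev_lin (pbw_env 0) (fun t => f t : K^o) (at0
    (operator_row x j)).
Proof.
rewrite ev_lin_at0; apply: eq_ev_lin => t; congr f.
by case: t => t1 [[a b] c]; rewrite /addw /= !add0r.
Qed.

(** At the monomial v itself: positive root vectors kill v, [H i] multiplies it
    by its weight, and a negative odd root vector q gives the monomial q v.
    The last item holds at every monomial, F_i raising its own exponent. *)
Lemma rows_at0 : [&&
  all (fun x => in_nplus x ==> (at0 (operator_row x 0) == [::])) all_basis,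
  all (fun i => at0 (operator_row (H i) 0) == [:: ((1, [:: (axis_code i).+1]), (0%N, 0))]) axes,
  all (fun j => nth [::] odd_words j == [:: nth (E Delta) negQ j.-1]) (iota 1 4),
  all (fun j => at0 (operator_row (nth (E Delta) negQ j.-1) 0) == [:: (coef_1, (j, 0))]) (iota 1
      4) &
  all (fun i => all (fun j => operator_row (F i) j == [:: (coef_1, (j, unitw i 1))]) (iota 0 16))
      axes].
Proof. by vm_compute. Qed.

Definition right_word (f : X) (w : seq basis) : X := foldl (fun g x => right_op x g) f w.

Lemma right_word_linear w a f g : right_word (a *: f + g) w = a *: right_word f w + right_word g w.
Proof. by elim: w f g => //= x w IH f g; rewrite linearP IH. Qed.
Lemma right_word_cat f w w' : right_word f (w ++ w') = right_word (right_word f w) w'.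
Proof. by rewrite /right_word foldl_cat. Qed.

Definition right_tensor (f : X) (t : {malg K[{fmonom basis}]}) : X := malg_lift (right_word f) t.
HB.instance Definition _ f :=
  GRing.isLinear.Build K _ X _ (right_tensor f) (malg_lift_is_linear _).

Lemma right_tensor_0 t : right_tensor 0 t = 0.
Proof.
rewrite /right_tensor /malg_lift big1 // => k _; have -> : right_word 0 k = 0; last by rewrite
    scaler0.
by elim: (k : seq _) => //= x w; rewrite linear0.
Qed.
Lemma right_tensor_is_linear t : linear (right_tensor^~ t).
Proof.
move=> a f g; rewrite /right_tensor /malg_lift scaler_sumr -big_split; apply: eq_bigr => k _.
by rewrite right_word_linear scalerDr !scalerA mulrC.
Qed.
Lemma right_tensor_mul f t u : right_tensor f (t * u) = right_tensor (right_tensor f t) u.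
Proof.
have addl g h : right_tensor (g + h) u = right_tensor g u + right_tensor h u.
  by rewrite -[g]scale1r right_tensor_is_linear !scale1r.
have -> : right_tensor (right_tensor f t) u = \sum_(k <- msupp t) t@_k *: right_tensor
    (right_word f k) u.
  rewrite {2}/right_tensor /malg_lift (big_morph (right_tensor^~ u) addl (right_tensor_0 u)).
  by apply: eq_bigr => k _; rewrite -[_ *: _]addr0 right_tensor_is_linear right_tensor_0 addr0.
rewrite {1}/right_tensor malg_lift_mul; apply: eq_bigr => k _; congr (_ *: _).
by apply: eq_malg_lift => b; rewrite right_word_cat.
Qed.
Lemma right_tensor_gen f x : right_tensor f (gen K x) = right_op x f.
Proof. exact: malg_lift_gen. Qed.
Lemma right_tensor_1 f : right_tensor f 1 = f.
Proof. exact: malg_lift_1. Qed.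

(** Evaluating f . t at v amounts to evaluating f at t v; so f |-> (f . t)(v) is
    zero for every t in the ideal defining the Verma module. *)
Lemma right_tensor_rel mu f t : (forall i, p i = (at3 mu i)%:~R) ->
  verma_rel zeta mu t -> right_tensor f t (0%N, 0) = 0.
Proof.
have /and5P[rpos rH _ _ _] := rows_at0.
move=> pmu rt; elim: rt f => {t} [t s _ ht _ hs|t s _ hs|x y t|x px|i] f.
- by rewrite linearD /= addXE ht hs addr0.
- by rewrite right_tensor_mul.
- rewrite right_tensor_mul; have -> : right_tensor f (gen K x * gen K y
      - (-1) ^+ (odd_basis x && odd_basis y) *: (gen K y * gen K x)
      - \sum_(q <- bracket zeta x y) q.1 *: gen K q.2) = 0; last by rewrite right_tensor_0.
  have lin3 (a q r : {malg K[{fmonom basis}]}) (k : K) :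
      right_tensor f (a - k *: q - r) = right_tensor f a - k *: right_tensor f q - right_tensor f r.
    by rewrite !linearB linearZ.
  rewrite lin3; apply/eqP; rewrite subr_eq0; apply/eqP.
  transitivity (\sum_(q <- bracket zeta x y) q.1 *: right_op q.2 f); last first.
    by rewrite (linear_sum (right_tensor f)); apply: eq_bigr => q _; rewrite linearZ /=
        right_tensor_gen.
  have mulE u v : right_tensor f (gen K u * gen K v) = right_op v (right_op u f) by rewrite
      right_tensor_mul !right_tensor_gen.
  have sgnE : ev_coef (pbw_env 0) (super_sign x y) = (-1) ^+ (odd_basis x && odd_basis y).
    by rewrite /super_sign; case: ifP => _; rewrite ?ev_coef_N1 ?ev_coef_1 ?expr1 ?expr0.
  transitivity (right_op y (right_op x f)
      - (-1) ^+ (odd_basis x && odd_basis y) *: right_op x (right_op y f)).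
    by congr (_ - _ *: _); exact: mulE.
  by rewrite right_op_rel sym_bracketE sgnE addrC addKr.
- rewrite right_tensor_gen right_op_at0; have := allP rpos x (mem_all_basis x).
  by rewrite px => /eqP ->; rewrite ev_lin_nil.
rewrite linearB linearZ /= right_tensor_gen right_tensor_1 addXE right_op_at0.
have /eqP -> : at0 (operator_row (H i) 0) == [:: ((1, [:: (axis_code i).+1]), (0%N, 0))].
  by apply: (allP rH); case: i.
rewrite ev_lin_cons ev_lin_nil addr0 /ev_coef big_seq1 mul1r -pmu.
by case: i => /=; rewrite subrr.
Qed.

Lemma right_word_F f ws j m : all isF ws -> (j < 16)%N ->
  right_word f ws (j, m) = f (j, addw (F_exponents ws) m).
Proof.
have /and5P[_ _ _ _ rF] := rows_at0.
move=> + j16; elim/last_ind: ws m => [|ws x IH] m.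
  by case: m => [[a b] c]; rewrite /addw /= !add0r.
rewrite all_rcons => /andP[Fx Fws]; case: x Fx => // i _.
rewrite -cats1 right_word_cat /= /right_op /=.
have /eqP -> : operator_row (F i) j == [:: (coef_1, (j, unitw i 1))].
  by apply: (allP (allP rF i _)); [case: i | rewrite mem_iota].
rewrite ev_lin_cons ev_lin_nil ev_coef_1 scale1r addr0 /= IH //; congr (f (_, _)).
rewrite /addw /F_exponents !count_cat /=.
by case: i; case: m => [[a b] c]; rewrite /= ?eqxx /= ?addr0 ?addn0 ?PoszD
  -?[in RHS]addrA ?[1 + _]addrC.
Qed.
End Model.

(** The functional t |-> (f . t)(v), where f is the indicator function of the
    monomial [e], passes to the Verma module.  The bound 5 restricts to odd
    words of size at most one, which are the ones used below. *)
Lemma verma_coord (K : numFieldType) (zeta : K) mu (e : nat * weight) :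
  exists l : verma_hw zeta mu -> K, linear (l : _ -> K^o) /\
    forall ws j, all isF ws -> (j < 5)%N ->
      l (word_act (ws ++ nth [::] odd_words j) (verma_top zeta mu)) = ((j, F_exponents ws) == e)%:R.
Proof.
pose p i : K := (at3 mu i)%:~R; pose f (e' : nat * weight) : K^o := (e' == e)%:R.
pose l (y : verma_hw zeta mu) : K := right_tensor zeta p f (repr y) (0%N, 0).
have lpi t : l (vpi zeta mu t) = right_tensor zeta p f t (0%N, 0).
  apply/eqP; rewrite -subr_eq0; apply/eqP.
  rewrite /l -[LHS]/((right_tensor zeta p f _ - right_tensor zeta p f _) _) -linearB.
  by apply: right_tensor_rel => //; apply/vpiP; exact: vpiK.
exists l; split.
  move=> a y z; have -> : a *: y + z = vpi zeta mu (a *: repr y + repr z).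
    by rewrite vpi_is_linear !vpiK.
  by rewrite lpi linearP.
have /and5P[_ _ sub1 rq _] := rows_at0.
move=> ws j Fws j5.
have -> : word_act (ws ++ nth [::] odd_words j) (verma_top zeta mu)
    = vpi zeta mu << FMonom (ws ++ nth [::] odd_words j) >>.
  by rewrite vpi_tensor_act /tensor_act malg_liftU scale1r.
rewrite lpi /right_tensor malg_liftU scale1r /= right_word_cat.
have -> : right_word zeta p (right_word zeta p f ws) (nth [::] odd_words j) (0%N, 0)
   = right_word zeta p f ws (j, 0).
  case: j j5 => [|j] j5; first by [].
  have /eqP -> : nth [::] odd_words j.+1 == [:: nth (E Delta) negQ j].
    by apply: (allP sub1 j.+1); rewrite mem_iota.
  rewrite /= right_op_at0.
  have /eqP -> : at0 (operator_row (nth (E Delta) negQ j) 0) == [:: (coef_1, (j.+1, 0))].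
    by apply: (allP rq j.+1); rewrite mem_iota.
  by rewrite ev_lin_cons ev_lin_nil ev_coef_1 scale1r addr0.
rewrite right_word_F //; last exact: leq_trans j5 _.
by rewrite /f; congr ((_, _) == _)%:R; case: (F_exponents ws) => [[a b] c];
  rewrite /addw /= !addr0.
Qed.

(** * Subspaces and weight vectors *)

Section Span.
Variables (K : numFieldType) (V : lmodType K).
Implicit Types (P S : V -> Prop) (u v : V).

Definition subspace S := S 0 /\ forall (a : K) u v, S u -> S v -> S (a *: u + v).

Lemma subsp0 S : subspace S -> S 0. Proof. by case. Qed.
Lemma subspZ S a u : subspace S -> S u -> S (a *: u).
Proof. by case=> S0 SL Su; rewrite -[_ *: _]addr0; apply: SL. Qed.
Lemma subspD S u v : subspace S -> S u -> S v -> S (u + v).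
Proof. by case=> S0 SL Su Sv; rewrite -[u]scale1r; apply: SL. Qed.
Lemma subspN S u : subspace S -> S u -> S (- u).
Proof. by move=> sS Su; rewrite -scaleN1r; apply: subspZ. Qed.
Lemma subspB S u v : subspace S -> S u -> S v -> S (u - v).
Proof. by move=> sS Su Sv; apply: subspD => //; apply: subspN. Qed.
Lemma subspBl S u v : subspace S -> S v -> S (u - v) -> S u.
Proof. by move=> sS Sv Suv; rewrite -(subrK v u); apply: subspD. Qed.
Lemma subsp_sum S T (r : seq T) (f : T -> V) (Q : pred T) : subspace S ->
  (forall i, Q i -> S (f i)) -> S (\sum_(i <- r | Q i) f i).
Proof. by move=> sS h; apply: big_ind => //; [exact: subsp0|move=> *; apply: subspD]. Qed.
Lemma subspZ_inv S a u : subspace S -> a != 0 -> S (a *: u) -> S u.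
Proof. by move=> sS a0 /(subspZ a^-1 sS); rewrite scalerA mulVf // scale1r. Qed.

Inductive span P : V -> Prop :=
  | span_0 : span P 0
  | span_add a u v : P u -> span P v -> span P (a *: u + v).

Lemma span_subspace P : subspace (span P).
Proof.
split=> [|a u v + sv]; first exact: span_0.
elim=> [|b w x Pw _ IH]; first by rewrite scaler0 add0r.
by rewrite scalerDr scalerA -addrA; apply: span_add.
Qed.
Lemma span_gen P u : P u -> span P u.
Proof. by move=> Pu; rewrite -[u]addr0 -[u]scale1r; apply: span_add => //; exact: span_0. Qed.
Lemma span_sub P S u : subspace S -> (forall x, P x -> S x) -> span P u -> S u.
Proof. by move=> [S0 SL] PS; elim=> // a x y /PS Sx _ Sy; apply: SL. Qed.
Lemma span_act P S (f : {linear V -> V}) u : subspace S ->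
  (forall x, P x -> S (f x)) -> span P u -> S (f u).
Proof.
move=> [S0 SL] PS; elim=> [|a x y /PS Sx _ Sy]; first by rewrite linear0.
by rewrite linearP; apply: SL.
Qed.

Definition sumsp S S' : V -> Prop := fun u => exists x y, [/\ S x, S' y & u = x + y].
Lemma sumsp_subspace S S' : subspace S -> subspace S' -> subspace (sumsp S S').
Proof.
move=> sS sS'; split; first by exists 0, 0; split; [exact: subsp0|exact: subsp0|rewrite addr0].
move=> a _ _ [x [y [Sx Sy ->]]] [x' [y' [Sx' Sy' ->]]].
exists (a *: x + x'), (a *: y + y'); split; first by case: sS => _; apply.
  by case: sS' => _; apply.
by rewrite scalerDr addrACA.
Qed.
Lemma sumspl S S' u : subspace S' -> S u -> sumsp S S' u.
Proof. by move=> sS' Su; exists u, 0; split=> //; [exact: subsp0|rewrite addr0]. Qed.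
Lemma sumspr S S' u : subspace S -> S' u -> sumsp S S' u.
Proof. by move=> sS Su; exists 0, u; split=> //; [exact: subsp0|rewrite add0r]. Qed.
End Span.

Definition root (x : basis) : weight :=
  match x with
  | E i => unitw i 2 | H _ => 0 | F i => unitw i (-2)
  | Q s => ((if s.1.1 then 1 else -1), (if s.1.2 then 1 else -1), (if s.2 then 1 else -1))
  end.

Lemma at3D (m m' : weight) i : at3 (m + m') i = at3 m i + at3 m' i.
Proof. by case: i. Qed.
Lemma at3N (m : weight) i : at3 (- m) i = - at3 m i.
Proof. by case: i. Qed.
Lemma at3_inj (m m' : weight) : (forall i, at3 m i = at3 m' i) -> m = m'.
Proof.
case: m m' => [[a b] c] [[a' b'] c'] h.
by move: (h Delta) (h Eps1) (h Eps2) => /= -> -> ->.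
Qed.

Lemma at3_unitw j c i : at3 (unitw j c) i = if i == j then c else 0.
Proof. by case: i; case: j. Qed.

Section Weights.
Variables (K : numFieldType) (zeta : K) (M : gmodule zeta).
Implicit Types (u v : M) (mu nu : weight) (S : M -> Prop).

Lemma wv_subspace mu : subspace (weight_vector (M := M) mu).
Proof.
split=> [i|a u v hu hv i]; first by rewrite linear0 scaler0.
by rewrite linearP hu hv scalerDr !scalerA mulrC.
Qed.

Lemma wv_act x mu u : weight_vector mu u -> weight_vector (mu + root x) (act M x u).
Proof.
move=> hu i; have := act_bracket (H i) x u; rewrite hu linearZ /= expr0 scale1r.
move=> /eqP; rewrite subr_eq => /eqP ->.
rewrite at3D intrD scalerDl addrC; congr (_ + _); first by rewrite ?linearZ.
case: x => [j|j|j|[[a b] c]] /=; rewrite ?big_seq1 ?big_nil //=.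
- by rewrite at3_unitw; case: eqP => [->|_]; rewrite ?big_seq1 ?big_nil ?scale0r ?intrN.
- by case: i; rewrite scale0r.
- by rewrite at3_unitw; case: eqP => [->|_]; rewrite ?big_seq1 ?big_nil ?scale0r ?intrN.
- by case: i => /=; [case: a | case: b | case: c].
Qed.

Lemma wv_uniq mu nu u : weight_vector mu u -> weight_vector nu u -> u != 0 -> mu = nu.
Proof.
move=> hm hn u0; apply: at3_inj => i; apply/eqP; rewrite -(eqr_int K) -subr_eq0.
by have := hm i; rewrite hn => /eqP; rewrite -subr_eq0 -scalerBl scaler_eq0 (negbTE u0) orbF
  -opprB oppr_eq0.
Qed.

Definition Hstable S := forall i u, S u -> S (act M (H i) u).

(** Vandermonde argument: for a coordinate i where two of the weights differ,
    applying H_i minus its eigenvalue on one component removes this component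
    and rescales the others, those of different eigenvalue by a nonzero
    factor. *)
Lemma weight_components S (s : seq weight) (c : weight -> M) : subspace S -> Hstable S ->
  uniq s -> (forall mu, weight_vector mu (c mu)) ->
  S (\sum_(mu <- s) c mu) -> forall mu, mu \in s -> S (c mu).
Proof.
move=> sS hS; elim: s c => //= mu s IH c /andP[ms us] wc Sc.
have Sr nu : nu \in s -> S (c nu).
  move=> ns; have [i ni] : exists i, at3 nu i != at3 mu i.
    apply/existsP; apply: contraT; rewrite negb_exists => /forallP h.
    suff e : nu = mu by rewrite -e ns in ms.
    by apply: at3_inj => i; apply/eqP; have := h i; rewrite negbK.
  have d0 : (at3 nu i)%:~R - (at3 mu i)%:~R != 0 :> K by rewrite subr_eq0 eqr_int.
  apply: (subspZ_inv sS d0).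
  pose c' lam : M := ((at3 lam i)%:~R - (at3 mu i)%:~R) *: c lam.
  apply: (IH c') => //; first by move=> lam; exact: (subspZ _ (wv_subspace lam) (wc lam)).
  have := subspB sS (hS i _ Sc) (subspZ (at3 mu i)%:~R sS Sc).
  rewrite linear_sum /= scaler_sumr -sumrB big_cons wc subrr add0r.
  by congr S; apply: eq_bigr => lam _; rewrite wc -scalerBl.
move=> nu; rewrite inE => /orP[/eqP ->|]; last exact: Sr.
move: Sc; rewrite big_cons addrC => Sc; rewrite -[c mu](addKr (\sum_(lam <- s) c lam)).
apply: subspD => //; apply: subspN => //; rewrite big_seq_cond.
by apply: subsp_sum => // lam; rewrite andbT => /Sr.
Qed.

(** The form used for congruences modulo [S]: if a sum of weight components is
    congruent to a weight vector, its component of that weight is too. *)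
Lemma weight_component S (s : seq weight) (c : weight -> M) nu y : subspace S -> Hstable S ->
  uniq s -> (forall mu, weight_vector mu (c mu)) -> (forall mu, mu \notin s -> c mu = 0) ->
  weight_vector nu y -> S (\sum_(mu <- s) c mu - y) -> S (c nu - y).
Proof.
move=> sS hS us wc c0 wy Sy.
pose c' mu := if mu == nu then c nu - y else c mu.
have wc' mu : weight_vector mu (c' mu).
  by rewrite /c'; case: eqP => [->|_] //; exact: (subspB (wv_subspace nu)).
have {}Sy : S (\sum_(mu <- undup (nu :: s)) c' mu).
  move: Sy; congr S; rewrite /=; case: ifP => [ns|/negbT ns].
    rewrite undup_id // !(big_rem nu ns) /= {1}/c' eqxx addrAC; congr (_ + _).
    rewrite !big_seq; apply: eq_bigr => mu; rewrite mem_rem_uniq // inE.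
    by rewrite /c' => /andP[/negbTE ->].
  rewrite big_cons {1}/c' eqxx c0 // undup_id // add0r addrC; congr (_ + _).
  rewrite !big_seq; apply: eq_bigr => mu ms; rewrite /c'; case: eqP => // e.
  by rewrite -e ms in ns.
have := weight_components sS hS (undup_uniq _) wc' Sy (mu := nu).
by rewrite mem_undup mem_head /c' eqxx; apply.
Qed.

Lemma span_weight_components (P : M -> Prop) x : (forall u, P u -> exists mu, weight_vector mu u) ->
  span P x -> exists (s : seq weight) (c : weight -> M),
    [/\ uniq s, forall mu, weight_vector mu (c mu), forall mu, mu \notin s -> c mu = 0,
     forall mu, span (fun u => P u /\ weight_vector mu u) (c mu)
     & x = \sum_(mu <- s) c mu].
Proof.
move=> Pw; elim=> [|a u v Pu _ [s [c [us wc c0 Pc ->]]]].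
  exists [::], (fun _ => 0); split=> // [mu|mu|]; last by rewrite big_nil.
    exact: (subsp0 (wv_subspace mu)).
  exact: span_0.
have [mu wu] := Pw u Pu.
exists (undup (mu :: s)), (fun nu => if nu == mu then a *: u + c mu else c nu).
split=> [|nu|nu|nu|]; first exact: undup_uniq.
- by case: eqP => [->|_] //; apply: (wv_subspace mu).2.
- by rewrite mem_undup inE negb_or; case: eqP => //= _; exact: c0.
- case: eqP => [->|_] //; apply: (span_subspace _).2 => //.
  by apply: span_gen.
rewrite /=; case: ifP => [ns|/negbT ns].
  rewrite undup_id // !(big_rem mu ns) /= eqxx addrA; congr (_ + _).
  rewrite !big_seq; apply: eq_bigr => nu; rewrite mem_rem_uniq // inE.
  by move=> /andP[/negbTE ->].
rewrite big_cons eqxx c0 // addr0 undup_id //; congr (_ + _).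
rewrite !big_seq; apply: eq_bigr => nu ms; case: eqP => // e.
by rewrite -e ms in ns.
Qed.
End Weights.

(** * Highest weight modules and category O *)

Definition neg_basis (x : basis) : bool :=
  match x with F _ => true | Q s => ~~ s.1.1 | _ => false end.

(** The functionals x, x + y, x + z are nonnegative on the positive roots and
    separate points, so this is a partial order, and it contains the usual one,
    by sums of positive roots. *)
Definition weight_le (nu mu : weight) : bool :=
  [&& nu.1.1 <= mu.1.1, nu.1.1 + nu.1.2 <= mu.1.1 + mu.1.2
    & nu.1.1 + nu.2 <= mu.1.1 + mu.2].

Lemma weight_le_refl mu : weight_le mu mu. Proof. by rewrite /weight_le !lexx. Qed.
Lemma weight_le_trans : transitive weight_le.
Proof. by move=> b a c; rewrite /weight_le => /and3P[? ? ?] /and3P[? ? ?]; apply/and3P; split;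
    lia. Qed.
Lemma weight_le_anti a b : weight_le a b -> weight_le b a -> a = b.
Proof.
case: a b => [[a1 a2] a3] [[b1 b2] b3]; rewrite /weight_le /=.
by move=> /and3P[? ? ?] /and3P[? ? ?]; congr (_, _, _); lia.
Qed.
Lemma weight_le_root mu x : neg_basis x -> weight_le (mu + root x) mu && (mu + root x != mu).
Proof.
case: mu => [[a b] c]; case: x => [i|i|i|[[s0 s1] s2]] //=.
  by move=> _; apply/andP; split; [|apply/eqP]; case: i => /=;
    rewrite ?/weight_le /=; try (by apply/and3P; split; lia); case; lia.
move=> /negbTE ->; apply/andP; split; [|apply/eqP]; case: s1; case: s2;
    rewrite ?/weight_le /=; try (by apply/and3P; split; lia); case; lia.
Qed.

Definition word_root (w : seq basis) : weight := \sum_(x <- w) root x.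

Lemma weight_le_word_root mu w : all neg_basis w -> weight_le (mu + word_root w) mu /\ (mu +
    word_root w = mu -> w = [::]).
Proof.
elim: w mu => [|x w IH] mu /=; first by rewrite /word_root big_nil addr0 weight_le_refl.
move=> /andP[nx nw]; have /andP[l1 n1] := weight_le_root mu nx.
have [l2 _] := IH (mu + root x) nw.
rewrite /word_root big_cons addrA -/(word_root w); split; first exact: weight_le_trans l2 l1.
by move=> e; rewrite e in l2; rewrite (weight_le_anti l1 l2) eqxx in n1.
Qed.

Section HighestWeight.
Variables (K : numFieldType) (zeta : K) (M : gmodule zeta).
Implicit Types (u v : M) (mu nu : weight) (S : M -> Prop).

Lemma act_swap x y v : act M x (act M y v) =
  (-1) ^+ (odd_basis x && odd_basis y) *: act M y (act M x v)
  + \sum_(p <- bracket zeta x y) p.1 *: act M p.2 v.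
Proof. by rewrite -act_bracket addrC subrK. Qed.

Lemma submod_subspace (N : M -> Prop) : is_submod N -> subspace N.
Proof. by case. Qed.

(** Bounding the length of the words keeps the spans finite dimensional, as
    local finiteness under the positive part requires; [None] is for no bound. *)
Definition words (l : option nat) u : M -> Prop :=
  fun x => exists w, [/\ all neg_basis w, (if l is Some l' then size w <= l' else true)%N & x =
      word_act w u].

Lemma words_act_neg l u x v : neg_basis x -> span (words l u) v ->
  span (words (omap succn l) u) (act M x v).
Proof.
move=> nx; apply: span_act; first exact: span_subspace.
move=> _ [w [nw lw ->]]; apply: span_gen; exists (x :: w); split=> //=; first by rewrite nx.
by case: l lw.
Qed.

Lemma words_mono l l' u v : (if l' is Some k' then if l is Some k then (k <= k')%N else false
    else true) ->
  span (words l u) v -> span (words l' u) v.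
Proof.
move=> h; apply: span_sub; first exact: span_subspace.
move=> _ [w [nw lw ->]]; apply: span_gen; exists w; split=> //.
by case: l' l h lw => [k'|] // [k|] // kk wk; apply: leq_trans kk.
Qed.

(** Moving a letter that is not negative to the right through the word either
    reaches [u] or creates a bracket, one letter in place of two; the word never
    becomes longer than [w]. *)
Lemma word_act_pos mu u x w : singular mu u -> ~~ neg_basis x -> all neg_basis w ->
  span (words (Some (size w)) u) (act M x (word_act w u)).
Proof.
move=> [wu su]; elim: w x => [|y w IH] x nx /=.
  move=> _; case: x nx => [i|i|//|s] nx.
  - by rewrite su //; exact: span_0.
  - by rewrite wu; apply: (subspZ _ (span_subspace _)); apply: span_gen; exists [::].
  by rewrite su; [exact: span_0|move: nx; rewrite /= negbK].
move=> /andP[ny nw]; rewrite act_swap.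
apply: (subspD (span_subspace _)).
  apply: (subspZ _ (span_subspace _)).
  by apply: (@words_act_neg (Some (size w))) => //; apply: IH.
apply: (subsp_sum _ (span_subspace _)).
move=> [c z] _; apply: (subspZ _ (span_subspace _)).
have [nz|nz] := boolP (neg_basis z) => /=.
  by apply: span_gen; exists (z :: w); rewrite /= nz.
by apply: (@words_mono (Some (size w))) => //=; apply: IH.
Qed.

Definition hw_sub u : M -> Prop := span (words None u).

Lemma hw_sub_top u : hw_sub u u.
Proof. by apply: span_gen; exists [::]. Qed.

Lemma hw_sub_submod mu u : singular mu u -> is_submod (hw_sub u).
Proof.
move=> su; have [U0 UL] := span_subspace (words None u); split=> // x v.
apply: span_act => // _ [w [nw _ ->]].
have [nx|nx] := boolP (neg_basis x).
  by apply: span_gen; exists (x :: w); rewrite /= nx.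
by apply: (@words_mono (Some (size w))) => //; exact: word_act_pos su nx nw.
Qed.

Lemma word_act_wv mu u w : weight_vector mu u -> weight_vector (mu + word_root w) (word_act w u).
Proof.
move=> wu; elim: w => [|x w IH] /=; first by rewrite /word_root big_nil addr0.
by rewrite /word_root big_cons addrCA addrC; apply: wv_act.
Qed.

Lemma sum0_subspace : subspace (fun v : M => v = 0).
Proof. by split=> // a u v -> ->; rewrite scaler0 addr0. Qed.

Lemma span_wv (P : M -> Prop) nu v : (forall u, P u -> exists mu, weight_vector mu u) ->
  span P v -> weight_vector nu v -> span (fun u => P u /\ weight_vector nu u) v.
Proof.
move=> Pw /(span_weight_components Pw)[s [c [us wc c0 Pc e]]] wv.
suff -> : v = c nu by exact: Pc.
apply/esym/eqP; rewrite -subr_eq0; apply/eqP.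
apply: (weight_component sum0_subspace _ us wc c0 wv); last by rewrite e subrr.
by move=> i x ->; rewrite linear0.
Qed.

Lemma words_wv mu u : weight_vector mu u ->
  forall l x, words l u x -> exists nu, weight_vector nu x.
Proof. by move=> wu l _ [w [_ _ ->]]; exists (mu + word_root w); apply: word_act_wv. Qed.

(** A word in negative root vectors lowers the weight strictly unless it is
    empty. *)
Lemma hw_sub_weight mu nu u y : weight_vector mu u -> hw_sub u y -> weight_vector nu y -> y != 0 ->
  weight_le nu mu /\ (nu = mu -> exists a, y = a *: u).
Proof.
move=> wu Uy wy y0; have {Uy} := span_wv (words_wv wu (l := None)) Uy wy => Sy.
split=> [|enu].
  apply: contraNT y0 => nle; apply/eqP; apply: (span_sub sum0_subspace _ Sy).
  move=> x [[w [nw _ ex]] wx]; apply/eqP; apply: contraNT nle => x0.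
  have wx' : weight_vector (mu + word_root w) x by rewrite ex; apply: word_act_wv.
  by rewrite (wv_uniq wx wx' x0); have [] := weight_le_word_root mu nw.
apply: (span_sub (S := fun y => exists a, y = a *: u) _ _ Sy).
  split; first by exists 0; rewrite scale0r.
  by move=> a _ _ [b ->] [c ->]; exists (a * b + c); rewrite scalerDl scalerA.
move=> x [[w [nw _ ex]] wx]; have [->|x0] := eqVneq x 0; first by exists 0; rewrite scale0r.
have wx' : weight_vector (mu + word_root w) x by rewrite ex; apply: word_act_wv.
have := (weight_le_word_root mu nw).2; rewrite -(wv_uniq wx wx' x0) => /(_ enu) w0.
by exists 1; rewrite ex w0 scale1r.
Qed.
End HighestWeight.

Section VermaO.
Variables (K : numFieldType) (zeta : K) (mu : weight).
Notation M := (verma_hw zeta mu).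
Notation v0 := (verma_top zeta mu).

Lemma verma_hw_sub y : hw_sub v0 y.
Proof. exact: verma_top_gen (hw_sub_submod (verma_top_singular zeta mu)) (hw_sub_top _) y. Qed.

Lemma in_spanP (s : seq M) x : span (fun u => u \in s) x -> in_span s x.
Proof.
elim=> [|a u v us _ [c ->]].
  by exists (fun=> 0); rewrite big1 // => i _; rewrite scale0r.
have ius : (index u s < size s)%N by rewrite index_mem.
exists (fun i => (if i == Ordinal ius then a else 0) + c i).
under [in RHS]eq_bigr do rewrite scalerDl.
rewrite big_split /=; congr (_ + _).
rewrite (bigD1 (Ordinal ius)) //= eqxx nth_index // big1 ?addr0 // => i /negbTE ->.
by rewrite scale0r.
Qed.

Lemma in_span_span (s : seq M) x : in_span s x -> span (fun u => u \in s) x.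
Proof.
move=> [c ->]; apply: (subsp_sum _ (span_subspace _)) => i _.
by apply: (subspZ _ (span_subspace _)); apply: span_gen; rewrite mem_nth.
Qed.

Fixpoint negwords (l : nat) : seq (seq basis) :=
  if l is l'.+1 then
    let W := negwords l' in W ++ [seq x :: w | x <- filter neg_basis all_basis, w <- W]
  else [:: [::]].
Lemma negwordsP l w : (w \in negwords l) = all neg_basis w && (size w <= l)%N.
Proof.
elim: l w => [|l IH] w; first by rewrite inE; case: w => //= x w; rewrite andbF.
rewrite [negwords _.+1]/(negwords l ++ [seq x :: w | x <- filter neg_basis all_basis, w <-
    negwords l]).
rewrite mem_cat IH; apply/orP/andP.
  case=> [/andP[-> /leqW]|/allpairsP[[x w'] [hx hw ->]]] //.
  move: hx hw; rewrite mem_filter IH => /andP[nx _] /andP[nw sw] /=.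
  by move: nx nw => /= -> ->.
case: w => [|x w]; first by left.
move=> [h sw]; have /andP[nx nw] : neg_basis x && all neg_basis w := h.
right; apply/allpairsP; exists (x, w); split=> //; last by rewrite IH nw.
by rewrite mem_filter nx mem_all_basis.
Qed.

(** The words of bounded length in the negative root vectors, applied to the
    generator, span a finite-dimensional space stable under the positive
    part. *)
Lemma verma_category_O : category_O M.
Proof.
have sv := verma_top_singular zeta mu.
split.
- exists [:: v0] => N hN hv; apply/seteqP; split=> // y _.
  by apply: verma_top_gen hN _ y; apply: hv; rewrite mem_head.
- move=> y; have := verma_hw_sub y; elim=> [|a x z [w [_ _ ex]] _ [s [-> hs]]].
    by exists [::]; rewrite big_nil; split.
  exists (a *: x :: s); rewrite big_cons; split=> // t; rewrite inE => /orP[/eqP ->|/hs //].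
  exists (mu + word_root w); apply: (subspZ a (wv_subspace _ _)).
  by rewrite ex; apply: word_act_wv; case: sv.
move=> y; have [l yl] : exists l, span (words (Some l) v0) y.
  elim: (verma_hw_sub y) => [|a x z [w [nw _ ex]] _ [l zl]].
    by exists 0; exact: span_0.
  exists (maxn (size w) l); apply: (span_subspace _).2.
    by apply: span_gen; exists w; split=> //; rewrite leq_maxl.
  by apply: words_mono zl; rewrite /= leq_maxr.
pose s := [seq word_act w v0 | w <- negwords l].
have sP x : words (Some l) v0 x <-> x \in s.
  split=> [[w [nw lw ->]]|/mapP[w]].
    by apply/mapP; exists w => //; rewrite negwordsP nw.
  by rewrite negwordsP => /andP[nw lw] ->; exists w.
exists s; split.
  apply: in_spanP; apply: span_sub yl; first exact: span_subspace.
  by move=> x /sP; exact: span_gen.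
move=> x u px /in_span_span us; apply: in_spanP.
apply: span_act us; first exact: span_subspace.
move=> _ /sP[w [nw lw ->]]; have nx : ~~ neg_basis x by case: x px => // s' /= ->.
apply: (span_sub (span_subspace _) _ (word_act_pos sv nx nw)).
move=> z [w' [nw' lw' ->]]; apply: span_gen; apply/sP; exists w'; split=> //.
exact: leq_trans lw' lw.
Qed.
End VermaO.

(** * Quotients and highest weight factors *)

Section Quotient.
Variables (K : numFieldType) (zeta : K) (M : gmodule zeta) (N : M -> Prop).
Hypothesis hN : is_submod N.

(** The proof that [N] is a submodule is an argument, so that the quotient by
    this predicate inherits its structures from it. *)
Definition qideal of is_submod N : {pred M} := fun v => `[< N v >].

Lemma qideal_zmod : zmod_closed (qideal hN).
Proof.
have [N0 NL _] := hN; split=> [|u v /asboolP hu /asboolP hv]; apply/asboolP => //.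
by rewrite addrC -scaleN1r; apply: NL.
Qed.
HB.instance Definition _ := GRing.isZmodClosed.Build M (qideal hN) qideal_zmod.

Definition quo := Quotient.quot (qideal hN).
HB.instance Definition _ := GRing.Zmodule.on quo.
HB.instance Definition _ := EqQuotient.on quo.

Definition qpi (u : M) : quo := \pi_quo u.

Lemma qpiP u v : qpi u = qpi v <-> N (u - v).
Proof.
split=> [/eqmodP|/asboolP huv]; last exact/eqmodP.
by rewrite /equiv /= => /asboolP.
Qed.
Lemma qpiK (x : quo) : qpi (repr x) = x. Proof. exact: reprK. Qed.
Lemma qpiD : {morph qpi : u v / u + v}.
Proof. by move=> u v; rewrite /qpi !piE. Qed.

Definition qscale (a : K) (x : quo) : quo := qpi (a *: repr x).
Lemma qpiZ a u : qpi (a *: u) = qscale a (qpi u).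
Proof.
by apply/qpiP; rewrite -scalerBr; apply: (subspZ _ (submod_subspace hN));
  apply/qpiP; rewrite qpiK.
Qed.
Lemma qscaleA a b x : qscale a (qscale b x) = qscale (a * b) x.
Proof. by rewrite -[x]qpiK -!qpiZ scalerA. Qed.
Lemma qscale1 : left_id 1 qscale.
Proof. by move=> x; rewrite -[x]qpiK -!qpiZ scale1r. Qed.
Lemma qscaleDr : right_distributive qscale +%R.
Proof.
by move=> a x y; rewrite -[x]qpiK -[y]qpiK -qpiD -!qpiZ -qpiD scalerDr.
Qed.
Lemma qscaleDl x : {morph qscale^~ x : a b / a + b}.
Proof. by move=> a b; rewrite -[x]qpiK -!qpiZ -qpiD scalerDl. Qed.
HB.instance Definition _ := GRing.Zmodule_isLmodule.Build K quo
  qscaleA qscale1 qscaleDr qscaleDl.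

Lemma qpi_is_linear : linear qpi.
Proof. by move=> a u v; rewrite qpiD qpiZ. Qed.
HB.instance Definition _ := GRing.isLinear.Build K M quo _ qpi qpi_is_linear.

Definition qact (x : basis) (v : quo) : quo := qpi (act M x (repr v)).
Lemma qact_pi x u : qact x (qpi u) = qpi (act M x u).
Proof.
by apply/qpiP; rewrite -linearB; case: hN => _ _; apply; apply/qpiP; rewrite qpiK.
Qed.
Lemma qact_is_linear x : linear (qact x).
Proof.
move=> a u v; have -> : a *: u + v = qpi (a *: repr u + repr v).
  by rewrite qpi_is_linear !qpiK.
by rewrite qact_pi linearP qpi_is_linear.
Qed.
HB.instance Definition _ x := GRing.isLinear.Build K quo quo _ (qact x) (qact_is_linear x).

Lemma qact_bracket x y v :
  qact x (qact y v) - (-1) ^+ (odd_basis x && odd_basis y) *: qact y (qact x v)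
  = \sum_(p <- bracket zeta x y) p.1 *: qact p.2 v.
Proof.
rewrite -[v]qpiK !qact_pi -linearZ -linearB /= act_bracket linear_sum.
by apply: eq_bigr => p _; rewrite linearZ qact_pi.
Qed.
Definition quo_module : gmodule zeta := @GModule K zeta quo qact qact_bracket.

Lemma quotientP : exists (L : gmodule zeta) (f : {linear M -> L}),
  [/\ is_hom f, forall w, exists v, f v = w & forall v, f v = 0 <-> N v].
Proof.
exists quo_module, qpi; split=> [x v|w|v]; first by rewrite /= qact_pi.
  by exists (repr w); exact: qpiK.
by rewrite -(linear0 qpi) qpiP subr0.
Qed.
End Quotient.

Section Factor.
Variables (K : numFieldType) (zeta : K) (M : gmodule zeta).
Implicit Types (A B N : set M) (u v : M).

Lemma hom_submod (M1 : gmodule zeta) (f : {linear M1 -> M}) N :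
  is_hom f -> is_submod N -> is_submod (fun v : M1 => N (f v)).
Proof.
move=> hf [N0 NL Na]; split=> [|a u v|x v]; first by rewrite linear0.
  by rewrite linearP; exact: NL.
by rewrite hf; exact: Na.
Qed.
(** The singular vector [u] gives a map from the Verma module onto A / B, and A / B
    is simple by the maximality of [B].  The quotient of the Verma module by the
    preimage of [B] is the required simple module, and the isomorphism is
    obtained by choosing preimages in the Verma module of the elements of [A]
    modulo [B]. *)
Lemma factor_hw A B u lam : is_submod A -> is_submod B -> B `<=` A ->
  singular (lam - rho) u -> ~ B u -> A u -> (forall v, A v -> sumsp (hw_sub u) B v) ->
  (forall X : set M, is_submod X -> B `<=` X -> X `<=` A -> X = B \/ X = A) ->
  factor_is A B lam.
Proof.
move=> hA hB BA su nBu Au Agen max.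
pose g := verma_hom su; have hg : is_hom g by exact: verma_hom_is_hom.
have gtop : g (verma_top zeta (lam - rho)) = u by exact: verma_map_top.
have gU v : hw_sub u v -> exists y, g y = v.
  elim=> [|a x z [w [_ _ ->]] _ [y <-]]; first by exists 0; rewrite linear0.
  exists (a *: word_act w (verma_top zeta (lam - rho)) + y); rewrite linearP; congr (_ *: _ + _).
  by elim: w => [|x' w IH]; [exact: gtop | rewrite [RHS]/= -IH -hg].
have gA y : A (g y).
  by apply: (verma_top_gen (hom_submod hg hA)); rewrite gtop.
have [L [f [hf fsurj fker]]] := quotientP (hom_submod hg hB).
have simpL : simple L.
  split.
    exists (f (verma_top zeta (lam - rho))); apply/eqP => /fker; rewrite gtop //.
  move=> N hN.
  pose X v := exists2 y, N (f y) & sumsp (fun z => z = g y) B v.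
  have XP v : X v <-> exists2 y, N (f y) & B (v - g y).
    split=> [[y Ny [_ [b [-> Bb ->]]]]|[y Ny Bv]].
      by exists y => //; rewrite addrC addKr.
    by exists y => //; exists (g y), (v - g y); split=> //; rewrite addrC subrK.
  have [B0 BL Ba] := hB; have [N0 NL Na] := hN.
  have hX : is_submod X.
    split.
    - by apply/XP; exists 0; [rewrite linear0|rewrite (linear0 g) subr0].
    - move=> a v v' /XP[y Ny Bv] /XP[y' Ny' Bv']; apply/XP.
      exists (a *: y + y'); first by rewrite linearP; apply: NL.
      by rewrite linearP opprD addrACA -scalerBr; apply: BL.
    - move=> x v /XP[y Ny Bv]; apply/XP; exists (act _ x y); first by rewrite hf; apply: Na.
      by rewrite hg -linearB; apply: Ba.
  have BX : B `<=` X by move=> v Bv; apply/XP; exists 0; [rewrite linear0|rewrite (linear0 g)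
      subr0].
  have XA : X `<=` A.
    move=> v /XP[y _ /BA Av]; rewrite -(subrK (g y) v).
    exact: (subspD (submod_subspace hA)).
  have [e|e] := max X hX BX XA; [left|right]; apply/seteqP; split=> // w.
  - have [y <-] := fsurj w => Nw; apply/fker; rewrite -e; apply/XP.
    by exists y => //; rewrite subrr.
  - by move=> ->.
  - have [y <-] := fsurj w => _; have : X (g y) by rewrite e.
    move=> /XP[y' Ny' By]; have : f (y - y') = 0 by apply/fker; rewrite linearB.
    by rewrite linearB => /eqP; rewrite subr_eq0 => /eqP ->.
have [h hh] : exists h : M -> verma_hw zeta (lam - rho), forall v, A v -> B (v - g (h v)).
  have /choice [h hh] : forall v, exists y, A v -> B (v - g y).
    move=> v; have [Av|nAv] := pselect (A v); last by exists 0.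
    have [x [b [/gU[y <-] Bb ->]]] := Agen v Av; exists y => _.
    by rewrite addrC addKr.
  by exists h.
have fB y y' : B (g y - g y') -> f y = f y'.
  by rewrite -linearB => /fker; rewrite linearB => /eqP; rewrite subr_eq0 => /eqP.
have sB := submod_subspace hB.
exists L; first by split=> //; exists f.
exists (fun v => f (h v)); split.
- move=> a v v' Av Av'; rewrite -linearP; apply: fB; rewrite linearP.
  have Avv : A (a *: v + v') by case: hA => _ + _; apply.
  have := subspB sB (sB.2 a _ _ (hh v Av) (hh v' Av')) (hh _ Avv).
  have abel (x1 y1 x2 y2 t : M) : x1 - y1 + (x2 - y2) - (x1 + x2 - t) = t - (y1 + y2).
    by rewrite (addrACA x1) -(opprD y1) (opprB (x1 + x2)) [LHS]addrC subrKA.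
  by congr B; rewrite scalerBr abel.
- move=> x v Av; rewrite -hf; apply: fB; rewrite hg.
  have Axv : A (act M x v) by case: hA => _ _; apply.
  have := subspB sB ((let: And3 _ _ Ba := hB in Ba) x _ (hh v Av)) (hh _ Axv).
  by congr B; rewrite (linearB (act M x)) /= opprB addrC addrA subrK.
- move=> w; have [y <-] := fsurj w; exists (g y) => //; apply: fB.
  by rewrite -opprB; apply: subspN => //; exact: hh.
move=> v Av; rewrite fker; split=> Bv.
  by rewrite -(subrK (g (h v)) v); apply: subspD => //; exact: hh.
by rewrite -(subKr v (g (h v))); apply: subspB => //; exact: hh.
Qed.
End Factor.

(** * Casimir elements *)

Arguments straighten : simpl never.
Definition sl2_casimir (i : axis) : lincomb (seq basis) :=
  [:: (coef_1, [:: H i; H i]); ((2, [::]), [:: H i]); ((4, [::]), [:: F i; E i])].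

Definition lin_mul (L L' : lincomb (seq basis)) : lincomb (seq basis) :=
  bind_lin L (fun w => [seq (t.1, w ++ t.2) | t <- L']).
Definition lin_commute (L L' : lincomb (seq basis)) : bool :=
  collect (bind_lin (lin_mul L L' ++ scale_lin coef_N1 (lin_mul L' L))
     (fun w => straighten_word free_base fuel w [:: (coef_1, [::])])) == [::].

(** The Casimir of g is central in U(g); each sl_2 Casimir commutes with the
    even lowering operators, which is what the filtration needs. *)
Lemma casimir_checks :
  all (fun x => lin_commute casimir [:: (coef_1, [:: x])]) all_basis &&
  all (fun i => all (fun k => lin_commute (sl2_casimir i) [:: (coef_1, [:: F k])]) axes) axes.
Proof. by vm_compute. Qed.

Section Eval.
Variables (K : numFieldType) (zeta : K) (M : gmodule zeta) (env : nat -> K).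
Hypothesis env0 : env 0 = zeta.

Definition lin_act (L : lincomb (seq basis)) (u : M) : M := ev_lin env (fun w => word_act w u) L.

Lemma lin_act_is_linear L : linear (lin_act L).
Proof.
move=> a u v; rewrite /lin_act /ev_lin scaler_sumr -big_split; apply: eq_bigr => t _ /=.
by rewrite linearP scalerDr !scalerA mulrC.
Qed.
HB.instance Definition _ L := GRing.isLinear.Build K M M _ (lin_act L) (lin_act_is_linear L).

Lemma lin_act_mul L L' u : lin_act (lin_mul L L') u = lin_act L (lin_act L' u).
Proof.
rewrite /lin_act /lin_mul ev_lin_bind; apply: eq_ev_lin => w; rewrite ev_lin_map [in RHS]/ev_lin
    linear_sum.
by apply: eq_bigr => t _; rewrite linearZ /= word_act_cat.
Qed.
Lemma lin_act1 w u : lin_act [:: (coef_1, w)] u = word_act w u.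
Proof. by rewrite /lin_act ev_lin_cons ev_lin_nil ev_coef_1 scale1r addr0. Qed.

Lemma straighten_word_sound u base w L : (forall x, act M x u = lin_act (base x) u) ->
  word_act w (lin_act L u) = lin_act (straighten_word base fuel w L) u.
Proof.
move=> hb; elim: w => [|x w IH]; first by [].
have -> : word_act (x :: w) (lin_act L u) = act M x (word_act w (lin_act L u)) by [].
rewrite IH.
have -> : straighten_word base fuel (x :: w) L = collect (bind_lin (straighten_word base fuel w
    L) (straighten base fuel x)).
  by [].
rewrite /lin_act ev_lin_collect ev_lin_bind [in LHS]/ev_lin linear_sum; apply: eq_bigr => t _.
by rewrite linearZ; congr (_ *: _); exact: straighten_sound env0 hb _ _ _.
Qed.

Lemma free_base_sound u x : act M x u = lin_act (free_base x) u.
Proof. by rewrite lin_act1. Qed.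

Lemma lin_commute_sound L L' u : lin_commute L L' -> lin_act L (lin_act L' u) = lin_act L'
    (lin_act L u).
Proof.
move=> /eqP /(ev_lin_zero env (fun w => word_act w u)); rewrite ev_lin_bind => h.
apply/eqP; rewrite -subr_eq0 -!lin_act_mul; apply/eqP; rewrite -[RHS]h.
rewrite ev_lin_cat ev_lin_scale ev_coef_N1 scaleN1r; congr (_ - _).
  by apply: eq_ev_lin => w; rewrite -[RHS](straighten_word_sound _ _ (free_base_sound u)) lin_act1.
by apply: eq_ev_lin => w; rewrite -[RHS](straighten_word_sound _ _ (free_base_sound u)) lin_act1.
Qed.
End Eval.

Section Casimir.
Variables (K : numFieldType) (zeta : K).

Definition weight_env (mu : weight) : nat -> K := pbw_env zeta (fun i => (at3 mu i)%:~R) 0.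

Lemma hw_base_sound (M : gmodule zeta) mu (u : M) x : singular mu u ->
  act M x u = lin_act (weight_env mu) (hw_base generic_weight x) u.
Proof.
move=> [wu su]; case: x => [i|i|i|s].
- by rewrite su // /lin_act ev_lin_nil.
- rewrite wu /lin_act ev_lin_cons ev_lin_nil addr0 /ev_coef big_seq1 mul1r.
  by case: i.
- by rewrite lin_act1.
rewrite /hw_base; case: ifP => ss; last by rewrite lin_act1.
by rewrite su // /lin_act ev_lin_nil.
Qed.

(** The squared length for the invariant form that gives delta, epsilon_1,
    epsilon_2 the squared lengths [sigma]. *)
Definition sq_length (lam : weight) : K :=
  \sum_(i <- axes) sigma zeta i * (at3 lam i ^+ 2)%:~R.

(** As rho has squared length 0, the usual value (lam, lam) - (rho, rho) is
    (lam, lam). *)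
Lemma casimir_value (M : gmodule zeta) lam (u : M) env : env 0 = zeta ->
  singular (lam - rho) u ->
  lin_act env casimir u = sq_length lam *: u.
Proof.
move=> e0 su.
have -> : lin_act env casimir u = lin_act (weight_env (lam - rho)) casimir u.
  rewrite /lin_act /ev_lin; rewrite /casimir.
  have ee (t : coefmon) : (all (pred1 0) t.2) -> ev_coef env t = ev_coef (weight_env (lam - rho)) t.
    move=> h; rewrite /ev_coef; congr (_ * _); apply: eq_big_seq => k /(allP h) /eqP ->.
    by rewrite e0.
  have : all (fun t => all (pred1 0) t.1.2) casimir by vm_compute.
  by move=> /allP h; apply: eq_big_seq => t /h /ee ->.
have -> : lin_act (weight_env (lam - rho)) casimir u = lin_act (weight_env (lam - rho))
    (collect (bind_lin casimir (fun w => straighten_word (hw_base generic_weight) fuel w [::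
        (coef_1, [::])]))) u.
  rewrite /lin_act ev_lin_collect ev_lin_bind; apply: eq_ev_lin => w.
  rewrite -[RHS](straighten_word_sound (erefl _) _ _ (fun x => hw_base_sound x su)).
  by rewrite lin_act1.
have -> : collect (bind_lin casimir (fun w => straighten_word (hw_base generic_weight) fuel w [::
    (coef_1, [::])]))
  = [:: (2, [:: 1%N], [::]); (2, [:: 0%N; 1%N], [::]);
           (2, [:: 2%N], [::]); (2, [:: 0%N; 3%N], [::]);
           (1, [:: 0%N; 3%N; 3%N], [::]); (1, [:: 2%N; 2%N], [::]);
           ((-1), [:: 0%N; 1%N; 1%N], [::]); ((-1), [:: 1%N; 1%N], [::])].
  by vm_compute.
rewrite /lin_act !ev_lin_cons ev_lin_nil addr0 /= -!scalerDl; congr (_ *: _).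
rewrite /ev_coef /= /sq_length !big_cons !big_nil /= !rmorphXn /=; case: lam {su} => [[x y] z] /=.
by rewrite !(rmorphB, rmorphD, rmorphN, rmorph1, rmorph0) /=; ring.
Qed.

End Casimir.

(** The Casimir is central, so it acts on the whole module by its value at the
    generator; the image of [y] in the quotient by [N] is singular and nonzero,
    and gives the value computed from [nu]. *)
Lemma casimir_norm (K : numFieldType) (zeta : K) (M : gmodule zeta) (lam : weight) (v0 : M)
    (N : M -> Prop) (nu : weight) y :
  singular (lam - rho) v0 -> (forall S, is_submod S -> S v0 -> forall x, S x) ->
  is_submod N -> ~ N y -> weight_vector (nu - rho) y ->
  (forall x, in_nplus x -> N (act M x y)) ->
  sq_length zeta nu = sq_length zeta lam.
Proof.
move=> s0 gen hN nNy wy sy; pose env : nat -> K := fun=> zeta.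
have cent x (u : M) : lin_act env casimir (act M x u) = act M x (lin_act env casimir u).
  have /andP[/allP h _] := casimir_checks.
  by have := lin_commute_sound (erefl (env 0)) u (h x (mem_all_basis x)); rewrite !lin_act1.
have scal (u : M) : lin_act env casimir u = sq_length zeta lam *: u.
  apply: (gen (fun u : M => lin_act env casimir u = sq_length zeta lam *: u)); last exact:
      casimir_value.
  split=> [|a x z hx hz|x z hz]; first by rewrite linear0 scaler0.
    by rewrite linearP /= hx hz scalerDr !scalerA mulrC.
  by rewrite cent hz linearZ.
have [L [f [hf _ fker]]] := quotientP hN.
have sfy : singular (nu - rho) (f y).
  split=> [i|x px]; first by rewrite -hf wy linearZ.
  by rewrite -hf; apply/fker; exact: sy.
have fw w (u : M) : f (word_act w u) = word_act w (f u) by elim: w => //= x w <-; rewrite hf.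
have := casimir_value (erefl (env 0)) sfy.
have -> : lin_act env casimir (f y) = f (lin_act env casimir y).
  by rewrite /lin_act /ev_lin linear_sum; apply: eq_bigr => t _; rewrite linearZ /= fw.
rewrite scal linearZ => /eqP; rewrite -subr_eq0 -scalerBl scaler_eq0 subr_eq0.
by case/orP => [/eqP -> //|/eqP /fker].
Qed.

(** * Filtration over the even part *)

Section Filtration.
Variables (K : numFieldType) (zeta : K) (M : gmodule zeta) (mu : weight) (v0 : M).
Hypothesis s0 : singular mu v0.

Definition odd_vec (j : nat) : M := word_act (nth [::] odd_words j) v0.
Definition filt_gen (j : nat) : M -> Prop :=
  fun x => exists ws i, [/\ all isF ws, (i < j)%N & x = word_act ws (odd_vec i)].
Definition filt (j : nat) : M -> Prop := span (filt_gen j).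
Definition filt_weight (j : nat) : weight := mu + word_root (nth [::] odd_words j).

Lemma filt_subspace j : subspace (filt j). Proof. exact: span_subspace. Qed.

Lemma filt_word j i ws : all isF ws -> (i < j)%N -> filt j (word_act ws (odd_vec i)).
Proof. by move=> Fws ij; apply: span_gen; exists ws, i. Qed.
Lemma filt_odd_vec j i : (i < j)%N -> filt j (odd_vec i).
Proof. exact: (@filt_word j i [::]). Qed.

Lemma filt_mono j j' x : (j <= j')%N -> filt j x -> filt j' x.
Proof.
move=> jj; apply: span_sub; first exact: filt_subspace.
by move=> _ [ws [i [Fws ij ->]]]; apply: filt_word => //; apply: leq_trans jj.
Qed.

Lemma odd_vec_wv j : weight_vector (filt_weight j) (odd_vec j).
Proof. by apply: word_act_wv; case: s0. Qed.

Lemma filt_F j k x : filt j x -> filt j (act M (F k) x).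
Proof.
apply: span_act; first exact: filt_subspace.
by move=> _ [ws [i [Fws ij ->]]]; apply: (@filt_word j i (F k :: ws)).
Qed.
Lemma filt_F_word j ws x : all isF ws -> filt j x -> filt j (word_act ws x).
Proof.
elim: ws => //= y ws IH /andP[+ /IH h] Gx; case: y => // k _; apply: filt_F; exact: h.
Qed.
Lemma filt_H j k x : filt j x -> filt j (act M (H k) x).
Proof.
apply: span_act; first exact: filt_subspace.
move=> _ [ws [i [Fws ij ->]]]; rewrite (word_act_wv _ (odd_vec_wv i)).
by apply: (subspZ _ (filt_subspace _)); exact: filt_word.
Qed.

Lemma lies_belowP j L : (j <= 16)%N -> lies_below j L ->
  filt j (ev_lin (weight_env zeta mu) (fun w => word_act w v0) L).
Proof.
move=> j16 /allP h; rewrite /ev_lin big_seq.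
apply: (subsp_sum _ (filt_subspace _)) => t /h /andP[/eqP e lt].
rewrite e word_act_cat; apply: (subspZ _ (filt_subspace _)); apply: filt_F_word.
  by rewrite all_filter; apply/allP => x _; apply/implyP.
rewrite -[filter odd_basis t.2](@nth_index _ [::] _ odd_words); first exact: filt_odd_vec.
by rewrite -index_mem; apply: leq_trans lt j16.
Qed.

Lemma act_odd_vec x i : act M x (odd_vec i) =
  ev_lin (weight_env zeta mu) (fun w => word_act w v0) (collect (straighten (hw_base
      generic_weight) fuel x (nth [::] odd_words i))).
Proof.
rewrite ev_lin_collect; apply: straighten_sound => // z; exact: hw_base_sound.
Qed.

Lemma filt_E_odd_vec k i : (i < 16)%N -> filt i (act M (E k) (odd_vec i)).
Proof.
move=> i16; rewrite act_odd_vec; apply: lies_belowP; first exact: ltnW.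
by apply: (allP (allP raising_check i _)); [rewrite mem_iota | case: k].
Qed.

Lemma act_EF k l x : act M (E k) (act M (F l) x) =
  act M (F l) (act M (E k) x) + (if k == l then act M (H k) x else 0).
Proof.
rewrite act_swap expr0 scale1r /=; congr (_ + _).
by case: ifP; rewrite ?big_seq1 ?big_nil ?scale1r.
Qed.

Lemma filt_E j k x : (j <= 16)%N -> filt j x -> filt j (act M (E k) x).
Proof.
move=> j16; apply: span_act; first exact: filt_subspace.
move=> _ [ws [i [Fws ij ->]]]; elim: ws Fws => [|y ws IH] /=.
  by move=> _; apply: (filt_mono (ltnW ij)); apply: filt_E_odd_vec; apply: leq_trans j16.
case: y => // l /= Fws; rewrite act_EF; apply: (subspD (filt_subspace _)).
  by apply: filt_F; exact: IH.
case: ifP => _; last exact: (subsp0 (filt_subspace _)).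
by apply: filt_H; exact: filt_word.
Qed.

Lemma filt_negQ q x : q \in negQ -> filt 16 x -> filt 16 (act M q x).
Proof.
move=> nq; apply: span_act; first exact: filt_subspace.
move=> _ [ws [i [Fws ij ->]]]; elim: ws q nq Fws => [|y ws IH] q nq /=.
  move=> _; rewrite act_odd_vec; apply: lies_belowP => //.
  by apply: (allP (allP odd_mul_check i _)); rewrite // mem_iota.
case: y => // l /= Fws; rewrite act_swap.
have -> : odd_basis q && odd_basis (F l) = false by rewrite andbF.
rewrite expr0 scale1r; apply: (subspD (filt_subspace _)); first by apply: filt_F; exact: IH.
rewrite big_seq; apply: (subsp_sum _ (filt_subspace _)) => -[c z] h.
apply: (subspZ _ (filt_subspace _)); apply: IH => //.
by move: nq h; rewrite !inE => /or4P[] /eqP ->; case: l => //=;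
  rewrite inE => /eqP [_ ->].
Qed.

(** Positive odd root vectors are brackets of E_delta with negative ones. *)
Lemma filt_submod : is_submod (filt 16).
Proof.
have [G0 GL] := filt_subspace 16; split=> // x v Gv.
have nq a b : Q (false, a, b) \in negQ by case: a; case: b.
case: x => [k|k|k|[[[] a] b]]; [exact: filt_E|exact: filt_H|exact: filt_F| |exact: filt_negQ].
have := act_bracket (E Delta) (Q (false, a, b)) v.
rewrite /= expr0 !scale1r big_seq1 scale1r => <-.
apply: (subspB (filt_subspace _)); first by apply: filt_E => //; exact: filt_negQ.
by apply: filt_negQ => //; exact: filt_E.
Qed.

Lemma filt_top : filt 16 v0.
Proof. exact: (@filt_odd_vec 16 0). Qed.

Definition sl2_cas i : M -> M := lin_act (fun=> zeta) (sl2_casimir i).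

Lemma sl2_casE i x : sl2_cas i x =
  act M (H i) (act M (H i) x) + 2%:R *: act M (H i) x + 4%:R *: act M (F i) (act M (E i) x).
Proof.
rewrite /sl2_cas /lin_act !ev_lin_cons ev_lin_nil ev_coef_1 scale1r addr0 addrA /ev_coef /=
    !big_nil !mulr1.
by [].
Qed.

Lemma sl2_cas_word i ws x : all isF ws -> sl2_cas i (word_act ws x) = word_act ws (sl2_cas i x).
Proof.
elim: ws => //= y ws IH; case: y => // k /= Fws; rewrite -IH //.
have /andP[_ /allP h] := casimir_checks.
have hk : lin_commute (sl2_casimir i) [:: (coef_1, [:: F k])].
  by apply: (allP (h i _)); [case: (i) | case: (k)].
by have := lin_commute_sound (erefl : (fun=> zeta) 0%N = zeta) (word_act ws x) hk; rewrite
    !lin_act1.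
Qed.

(** The value m (m + 2) of H^2 + 2H + 4FE on a singular vector of weight m. *)
Definition sl2_value (m : weight) i : K := ((at3 m i + 1) ^+ 2 - 1)%:~R.

Lemma sl2_valueE m i : sl2_value m i = (at3 m i)%:~R * (at3 m i)%:~R + 2 * (at3 m i)%:~R.
Proof. by rewrite /sl2_value rmorphB rmorphXn rmorphD /= rmorph1; ring. Qed.

Lemma sl2_cas_odd_vec i j : (j < 16)%N -> filt j (sl2_cas i (odd_vec j) - sl2_value (filt_weight
    j) i *: odd_vec j).
Proof.
move=> j16; rewrite sl2_casE !odd_vec_wv linearZ /= odd_vec_wv !scalerA.
set a : K := (at3 _ _)%:~R; rewrite -scalerDl addrAC -scalerBl.
have -> : a * a + 2 * a - sl2_value (filt_weight j) i = 0 by rewrite sl2_valueE subrr.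
rewrite scale0r add0r; apply: (subspZ _ (filt_subspace _)).
by apply: filt_F; exact: filt_E_odd_vec.
Qed.

(** Since it commutes with the F_k, the Casimir acts on the layer by its value at
    the generator Q^I v, singular modulo the previous step. *)
Lemma sl2_cas_filt i j x : (j < 16)%N -> filt j.+1 x -> filt j (sl2_cas i x - sl2_value
    (filt_weight j) i *: x).
Proof.
move=> j16 Gx; pose f : {linear M -> M} := lin_act (fun=> zeta) (sl2_casimir i).
have stab y : filt j y -> filt j (sl2_cas i y).
  move=> Gy; have j16' := ltnW j16.
  rewrite sl2_casE; do 2?apply: (subspD (filt_subspace _)).
  - by do 2!apply: filt_H.
  - by apply: (subspZ _ (filt_subspace _)); apply: filt_H.
  - by apply: (subspZ _ (filt_subspace _)); apply: filt_F; apply: filt_E.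
elim: Gx => [|a y z [ws [k [Fws kj ->]]] _ IH].
  by rewrite [sl2_cas i 0](linear0 f) scaler0 subr0; exact: (subsp0 (filt_subspace _)).
rewrite [sl2_cas i _](linearP f) scalerDr opprD addrACA; apply: (subspD (filt_subspace _)) => //.
rewrite scalerA mulrC -scalerA -scalerBr; apply: (subspZ _ (filt_subspace _)).
move: kj; rewrite ltnS leq_eqVlt => /predU1P[->|kj].
  rewrite [f _]sl2_cas_word // -linearZ -linearB; apply: filt_F_word => //; exact: sl2_cas_odd_vec.
by apply: (subspB (filt_subspace _)); [apply: stab|apply: (subspZ _ (filt_subspace _))]; exact:
    filt_word.
Qed.
End Filtration.

Definition F_word (a b c : nat) : seq basis :=
  nseq a (F Delta) ++ nseq b (F Eps1) ++ nseq c (F Eps2).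
Definition F_count (i : axis) (ws : seq basis) : nat := count_mem (F i) ws.

Lemma F_word_isF a b c : all isF (F_word a b c).
Proof. by rewrite !all_cat !all_nseq !orbT. Qed.

Lemma F_count_word a b c : [/\ F_count Delta (F_word a b c) = a, F_count Eps1 (F_word a b c) = b
  & F_count Eps2 (F_word a b c) = c].
Proof.
by rewrite /F_count !count_cat !count_nseq /= !mul1n !mul0n ?addn0 ?add0n.
Qed.

Lemma word_root_F ws i : all isF ws -> at3 (word_root ws) i = - (2 * (F_count i ws)%:Z).
Proof.
elim: ws => [|y ws IH]; first by rewrite /word_root big_nil; case: i.
case: y => // k /= /IH h; rewrite /word_root big_cons at3D -/(word_root ws) h at3_unitw /F_count /=.
have -> : (F k == F i) = (i == k) by case: (i); case: (k).
by case: (i == k) => /=; lia.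
Qed.

Section FModule.
Variables (K : numFieldType) (zeta : K) (M : gmodule zeta).

Lemma act_FF k l (x : M) : act M (F k) (act M (F l) x) = act M (F l) (act M (F k) x).
Proof. by rewrite act_swap /= big_nil expr0 scale1r addr0. Qed.

Lemma act_F_nseq k l n (x : M) :
  act M (F k) (word_act (nseq n (F l)) x) = word_act (nseq n (F l)) (act M (F k) x).
Proof. by elim: n => //= n IH; rewrite act_FF IH. Qed.

Lemma word_act_F ws (x : M) : all isF ws ->
  word_act ws x = word_act (F_word (F_count Delta ws) (F_count Eps1 ws) (F_count Eps2 ws)) x.
Proof.
have wS a b c k (u : M) : act M (F k) (word_act (F_word a b c) u) =
    word_act (match k with Delta => F_word a.+1 b c | Eps1 => F_word a b.+1 c | Eps2 => F_word a
        b c.+1 end) u.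
  by case: k; rewrite /F_word !word_act_cat; [|rewrite act_F_nseq|rewrite 2!act_F_nseq].
elim: ws => // y ws IH; case: y => // k Fws.
have -> : word_act (F k :: ws) x = act M (F k) (word_act ws x) by [].
by rewrite IH // wS; case: k {Fws}.
Qed.
End FModule.

Section Form.
Variables (K : numFieldType) (zeta : K) (M : gmodule zeta) (mu : weight) (v0 : M).
Hypothesis s0 : singular mu v0.
Hypothesis gen : forall S, is_submod S -> S v0 -> forall x, S x.

(** Take the least step [j.+1] of the filtration that contains [y] modulo [N].
    The sl_2 Casimirs act on [y] by the values attached to [nu] modulo [N], and
    by those of the layer [j] modulo [N] and the step [j]; if the values were
    different [y] would belong to the step [j] modulo [N].  In the layer, two
    F-words of the same weight have the same exponents, so the component of
    weight [nu] is a multiple of a single vector.  The last conclusion equates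
    the values m (m + 2) + 1, for the unshifted weights. *)
Lemma singular_mod_filt (N : M -> Prop) nu y : is_submod N ->
  ~ N y -> weight_vector nu y -> (forall x, in_nplus x -> N (act M x y)) ->
  exists j a b c (alpha : K),
   [/\ (j < 16)%N /\ alpha != 0, ~ sumsp (filt v0 j) N (word_act (F_word a b c) (odd_vec v0 j)),
       sumsp (filt v0 j) N (y - alpha *: word_act (F_word a b c) (odd_vec v0 j)),
       nu = filt_weight mu j + word_root (F_word a b c)
     & forall i, (at3 nu i + 1) ^+ 2 = (at3 (filt_weight mu j) i + 1) ^+ 2].
Proof.
move=> hN nNy wy sy; have sN := submod_subspace hN.
have sS j : subspace (sumsp (filt v0 j) N) by apply: sumsp_subspace => //; exact: filt_subspace.
pose Q j := `[< sumsp (filt v0 j) N y >].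
have ex : exists j, Q j.
  exists 16%N; apply/asboolP; apply: sumspl => //.
  exact: (gen (filt_submod s0) (filt_top v0)).
have [[|j] /asboolP Qj min] := ex_minnP ex.
  case: Qj => x [n [Gx Nn e]]; case: nNy; rewrite e.
  suff -> : x = 0 by rewrite add0r.
  apply: (span_sub (S := fun x => x = 0) _ _ Gx); first exact: sum0_subspace.
  by move=> z [ws [i [_ i0 _]]].
have j16 : (j < 16)%N.
  apply: (min 16%N); apply/asboolP; apply: sumspl => //.
  exact: (gen (filt_submod s0) (filt_top v0)).
have nQ : ~ sumsp (filt v0 j) N y.
  by move=> h; have := min j (introT (asboolP _) h); rewrite ltnn.
have [g [n [Gg Nn ey]]] := Qj.
(* otherwise the difference of the two values would bring [y] one step down *)
have sq i : (at3 nu i + 1) ^+ 2 = (at3 (filt_weight mu j) i + 1) ^+ 2.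
  have Na x z : N z -> N (act M x z) by case: hN => _ _; apply.
  have Ns z : N z -> N (sl2_cas i z).
    move=> Nz; rewrite sl2_casE; apply: (subspD sN); first apply: (subspD sN).
    - by apply/Na/Na.
    - by apply: (subspZ _ sN); apply: Na.
    - by apply: (subspZ _ sN); apply/Na/Na.
  have h1 : N (sl2_cas i y - sl2_value K nu i *: y).
    rewrite sl2_casE !wy linearZ /= wy !scalerA -scalerDl sl2_valueE addrAC -scalerBl subrr.
    by rewrite scale0r add0r; apply: (subspZ _ sN); apply: Na; apply: sy.
  have h2 : sumsp (filt v0 j) N (sl2_cas i y - sl2_value K (filt_weight mu j) i *: y).
    pose f : {linear M -> M} := lin_act (fun=> zeta) (sl2_casimir i).
    rewrite ey [sl2_cas i _](linearD f) scalerDr opprD addrACA; apply: (subspD (sS j)).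
      by apply: sumspl => //; exact: sl2_cas_filt.
    by apply: sumspr; [exact: filt_subspace|apply: (subspB sN); [exact: Ns|apply: (subspZ _ sN)]].
  have : sumsp (filt v0 j) N ((sl2_value K nu i - sl2_value K (filt_weight mu j) i) *: y).
    have := subspB (sS j) h2 (sumspr (filt_subspace v0 j) h1).
    by congr sumsp; rewrite opprB addrC subrKA -scalerBl.
  have [/eqP + _|d0 h] := eqVneq (sl2_value K nu i - sl2_value K (filt_weight mu j) i) 0.
    by rewrite subr_eq0 eqr_int => /eqP; lia.
  by case: nQ; exact: (subspZ_inv (sS j) d0 h).
(* replace [y] by its part along the generator of the layer, which is a sum of
   weight vectors, then by its component of weight [nu] *)
pose P x := exists2 ws, all isF ws & x = word_act ws (odd_vec v0 j).
have [x [Px Sx]] : exists x, span P x /\ sumsp (filt v0 j) N (x - y).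
  have [x [Px Gx]] : exists x, span P x /\ filt v0 j (g - x).
    elim: Gg => [|a z t [ws [i [Fws ij ->]]] _ [x [Px Gx]]].
      by exists 0; split; [exact: span_0|rewrite subr0; exact: (subsp0 (filt_subspace _ _))].
    move: ij; rewrite ltnS leq_eqVlt => /predU1P[->|ij].
      exists (a *: word_act ws (odd_vec v0 j) + x); split; first by apply: span_add => //; exists
          ws.
      by rewrite opprD addrACA subrr add0r.
    exists x; split=> //; rewrite -addrA; apply: (filt_subspace v0 j).2 => //.
    exact: filt_word.
  exists x; split=> //; rewrite -opprB; apply: (subspN (sS j)).
  rewrite ey addrAC; apply: (subspD (sS j)); first exact: sumspl.
  by apply: sumspr => //; exact: filt_subspace.
have Pw z : P z -> exists m, weight_vector m z.
  by case=> ws _ ->; eexists; apply: word_act_wv; exact: (odd_vec_wv s0).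
have [s [c [us wc c0 Pc ex']]] := span_weight_components Pw Px.
have hS : Hstable (sumsp (filt v0 j) N).
  move=> i _ [z [t [Gz Nt ->]]]; rewrite linearD; exists (act M (H i) z), (act M (H i) t).
  by split=> //; [exact: (filt_H s0)|case: hN => _ _; apply].
have Sc : sumsp (filt v0 j) N (c nu - y).
  by apply: (weight_component (sS j) hS us wc c0 wy); rewrite -ex'.
have [ws [Fws wws ws0]] : exists ws, [/\ all isF ws,
    weight_vector nu (word_act ws (odd_vec v0 j)) & word_act ws (odd_vec v0 j) != 0].
  apply: contrapT => no; apply: nQ; rewrite -opprB in Sc.
  have c00 : c nu = 0.
    apply: (span_sub (S := fun z => z = 0) _ _ (Pc nu)); first exact: sum0_subspace.
    move=> z [[ws Fws ez] wz]; apply: contrapT => z0; apply: no; exists ws.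
    by rewrite -ez; split=> //; apply/eqP.
  by move: Sc; rewrite c00 subr0 => /(subspN (sS j)); rewrite opprK.
have enu : nu = filt_weight mu j + word_root ws.
  by apply: (wv_uniq wws) ws0; apply: word_act_wv; exact: (odd_vec_wv s0).
pose F0 := F_word (F_count Delta ws) (F_count Eps1 ws) (F_count Eps2 ws).
have [alpha ea] : exists alpha, c nu = alpha *: word_act F0 (odd_vec v0 j).
  apply: (span_sub (S := fun z => exists al, z = al *: word_act F0 (odd_vec v0 j)) _ _ (Pc nu)).
    split; first by exists 0; rewrite scale0r.
    by move=> a _ _ [b ->] [d ->]; exists (a * b + d); rewrite scalerDl scalerA.
  move=> z [[ws' Fws' ez] wz]; have [->|z0] := eqVneq z 0; first by exists 0; rewrite scale0r.
  have e2 : nu = filt_weight mu j + word_root ws'.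
    by apply: (wv_uniq wz) z0; rewrite ez; apply: word_act_wv; exact: (odd_vec_wv s0).
  have e3 : word_root ws' = word_root ws by apply: (addrI (filt_weight mu j)); rewrite -e2 -enu.
  have ec i : F_count i ws' = F_count i ws.
    by have := congr1 (fun m : weight => at3 m i) e3; rewrite /= !word_root_F //; lia.
  by exists 1; rewrite scale1r ez word_act_F // !ec.
have enu' : nu = filt_weight mu j + word_root F0.
  rewrite enu; congr (_ + _); apply: at3_inj => i; rewrite !word_root_F ?F_word_isF // /F0.
  have [h1 h2 h3] := F_count_word (F_count Delta ws) (F_count Eps1 ws) (F_count Eps2 ws).
  by case: i; rewrite ?h1 ?h2 ?h3.
have Sy : sumsp (filt v0 j) N (y - alpha *: word_act F0 (odd_vec v0 j)).
  by rewrite -ea -opprB; apply: (subspN (sS j)).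
have nF : ~ sumsp (filt v0 j) N (alpha *: word_act F0 (odd_vec v0 j)).
  by move=> h; apply: nQ; exact: (subspBl (sS j) h Sy).
exists j, (F_count Delta ws), (F_count Eps1 ws), (F_count Eps2 ws), alpha; split=> //.
  split=> //; apply/eqP => a0; apply: nF; rewrite a0 scale0r; exact: (subsp0 (sS j)).
by move=> h; apply: nF; apply: (subspZ _ (sS j)).
Qed.
End Form.

(** * Powers of even lowering operators that give singular vectors *)

Section Singular.
Variables (K : numFieldType) (zeta : K).
Hypothesis irr : forall q : rat, zeta <> ratr q.

Lemma ratr_intK (x : int) : ratr x%:~R = x%:~R :> K.
Proof. by rewrite ratr_int. Qed.

(** With x, y, z the three squares, (y - x) + zeta (z - x) = 0, and zeta would be
    rational if z - x were not 0. *)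
Lemma sq_length_eq0 lam : sq_length zeta lam = 0 ->
  at3 lam Eps1 ^+ 2 = at3 lam Delta ^+ 2 /\ at3 lam Eps2 ^+ 2 = at3 lam Delta ^+ 2.
Proof.
rewrite /sq_length !big_cons big_nil /= addr0.
set x := _ ^+ 2; set y := _ ^+ 2; set z := _ ^+ 2 => h.
have h' : (y - x)%:~R + zeta * (z - x)%:~R = 0.
  by rewrite -[RHS]h !rmorphB /=; ring.
have zx : z = x.
  apply/eqP; rewrite -subr_eq0; apply: contraT => nz.
  have nzK : (z - x)%:~R != 0 :> K by rewrite intr_eq0.
  case: (irr (q := (x - y)%:~R / (z - x)%:~R)).
  rewrite rmorphM fmorphV /= !ratr_intK; apply: (mulIf nzK); rewrite divfK //.
  move/eqP: h'; rewrite addrC addr_eq0 => /eqP ->.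
  by rewrite -rmorphN opprB.
split=> //; move: h'; rewrite zx subrr mulr0 addr0 => /eqP; rewrite intr_eq0 subr_eq0.
by move/eqP.
Qed.

Lemma sq_length_W n a b c : sq_length zeta (sgn_weight n a b c) = 0.
Proof.
rewrite /sq_length !big_cons big_nil /=.
have sq s : (signz s * n%:Z) ^+ 2 = n%:Z ^+ 2 by case: s; rewrite /=; ring.
by rewrite !sq; ring.
Qed.

(** The simple root vectors generate the positive part.  The root vector of
    2 delta is a bracket of odd ones up to the factor 1 + zeta, nonzero as zeta
    is irrational. *)
Lemma simple_singular (M : gmodule zeta) (u : M) :
  act M (E Eps1) u = 0 -> act M (E Eps2) u = 0 -> act M (Q (true, false, false)) u = 0 ->
  forall x, in_nplus x -> act M x u = 0.
Proof.
move=> e1 e2 q0.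
have q1 : act M (Q (true, true, false)) u = 0.
  have := act_bracket (E Eps1) (Q (true, false, false)) u.
  by rewrite /= big_seq1 q0 e1 !(linear0, scaler0, oppr0, addr0) /= scale1r => <-.
have q2 : act M (Q (true, false, true)) u = 0.
  have := act_bracket (E Eps2) (Q (true, false, false)) u.
  by rewrite /= big_seq1 q0 e2 !(linear0, scaler0, oppr0, addr0) /= scale1r => <-.
have q3 : act M (Q (true, true, true)) u = 0.
  have := act_bracket (E Eps1) (Q (true, false, true)) u.
  by rewrite /= big_seq1 q2 e1 !(linear0, scaler0, oppr0, addr0) /= scale1r => <-.
have s0 : 1 + zeta != 0.
  apply/eqP => h; apply: (irr (q := -1)); rewrite rmorphN rmorph1.
  by apply/eqP; rewrite -addr_eq0 addrC h.
have ed : act M (E Delta) u = 0.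
  have := act_bracket (Q (true, true, true)) (Q (true, false, false)) u.
  rewrite /= q0 q3 !(linear0, scaler0, oppr0, addr0) !big_cons big_nil /odd_term /= /psi /=.
  rewrite !(mulr0, mul0r, mulr1, oppr0, scale0r, addr0) => /esym /eqP.
  by rewrite scaler_eq0 mulf_eq0 oppr_eq0 (negbTE s0) pnatr_eq0 /= => /eqP.
by case=> [[]|[]|[]|[[[] []] []]].
Qed.

Lemma act_E_nseq (M : gmodule zeta) k (u : M) (h : K) m :
  act M (H k) u = h *: u -> act M (E k) u = 0 ->
  act M (E k) (word_act (nseq m (F k)) u)
    = (m%:R * (h - m%:R + 1)) *: word_act (nseq m.-1 (F k)) u.
Proof.
move=> hu eu.
have hF l : act M (H k) (word_act (nseq l (F k)) u) = (h - l%:R * 2) *: word_act (nseq l (F k)) u.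
  elim: l => [|l IH]; first by rewrite mul0r subr0.
  rewrite [word_act (nseq l.+1 _) u]/(act M (F k) (word_act (nseq l (F k)) u)) act_swap IH /= eqxx.
  rewrite expr0 scale1r linearZ big_seq1 /= -scalerDl; congr (_ *: _).
  by rewrite -addn1 natrD; ring.
elim: m => [|m IH]; first by rewrite mul0r scale0r.
rewrite [word_act (nseq m.+1 _) u]/(act M (F k) (word_act (nseq m (F k)) u)) act_EF eqxx IH hF.
rewrite linearZ /=; case: m {IH} => [|m].
  by rewrite mul0r scale0r add0r mul0r mul1r; congr (_ *: _); ring.
rewrite [act M (F k) _]/(word_act (nseq m.+1 (F k)) u) -scalerDl; congr (_ *: _).
by rewrite -!natr1; ring.
Qed.

Lemma act_comm_nseq (M : gmodule zeta) x k (u : M) m :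
  bracket zeta x (F k) = [::] -> act M x u = 0 -> act M x (word_act (nseq m (F k)) u) = 0.
Proof.
move=> br xu; elim: m => //= m IH.
by rewrite act_swap IH linear0 scaler0 br big_nil addr0.
Qed.

(** The factor h - m + 1 vanishes for h = m - 1.  The root 2 delta must be
    excluded: F_delta does not commute with the simple odd root vector, as F_1
    and F_2 do. *)
Lemma singular_F (M : gmodule zeta) mu k (m : nat) (u : M) :
  k != Delta -> at3 mu k = m%:Z - 1 -> singular mu u ->
  singular (mu + unitw k (- (2 * m%:Z))) (word_act (nseq m (F k)) u).
Proof.
move=> kD hm [wu su]; split.
  have -> : unitw k (- (2 * m%:Z)) = word_root (nseq m (F k)).
    apply: at3_inj => i; rewrite word_root_F ?all_nseq ?orbT // at3_unitw /F_count count_nseq /=.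
    by case: (i) => /=; case: (k) => /=; lia.
  exact: word_act_wv.
have hE l : act M (E l) (word_act (nseq m (F k)) u) = 0.
  have [->|lk] := eqVneq l k.
    rewrite (@act_E_nseq _ _ _ (at3 mu k)%:~R) ?wu ?su //.
    have -> : (at3 mu k)%:~R - m%:R + 1 = 0 :> K by rewrite hm intrB -pmulrn; ring.
    by rewrite mulr0 scale0r.
  by apply: act_comm_nseq; rewrite ?su //= (negbTE lk).
apply: simple_singular => //; apply: act_comm_nseq; last by rewrite su.
by case: k kD {hm hE}.
Qed.
End Singular.

(** * Weights of vectors singular modulo a submodule *)

Definition odd_word_roots : seq weight :=
  [:: (0, 0, 0); (-1, 1, 1); (-1, 1, -1); (-1, -1, 1); (-1, -1, -1);
      (-2, 2, 0); (-2, 0, 2); (-2, 0, 0); (-2, 0, 0); (-2, 0, -2); (-2, -2, 0);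
      (-3, 1, 1); (-3, 1, -1); (-3, -1, 1); (-3, -1, -1); (-4, 0, 0)].

Lemma word_root_foldr w : word_root w = foldr (fun x m => root x + m) 0 w.
Proof. by elim: w => [|x w IH]; rewrite /word_root ?big_nil // big_cons -/(word_root w) IH. Qed.

Lemma word_root_odd_words j : (j < 16)%N -> word_root (nth [::] odd_words j) = nth 0
    odd_word_roots j.
Proof.
move=> j16; rewrite word_root_foldr; apply/eqP.
have : all (fun j => foldr (fun x m => root x + m) 0 (nth [::] odd_words j) == nth 0
    odd_word_roots j) (iota 0 16).
  by vm_compute.
by move/allP; apply; rewrite mem_iota.
Qed.

(** The coordinates X, Y, Z are those of the rho-shifted weight of y, [m] is the
    sum of the roots in I, and e1, e2 are the signs b, c.  The first equations
    come from the Casimir of g, the others from those of the three sl_2, with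
    X + 2 because the coordinate of rho along delta is -1.  Each equation
    x^2 = y^2 splits into x = y or x = -y, which leaves linear arithmetic for
    each [m]. *)
Lemma weight_arith (n e1 e2 a b c X Y Z : int) (m : weight) :
  m \in odd_word_roots -> 1 <= n -> 0 <= a -> 0 <= b -> 0 <= c ->
  (e1 == 1) || (e1 == -1) -> (e2 == 1) || (e2 == -1) ->
  X = - n + m.1.1 - 2 * a -> Y = e1 * n + m.1.2 - 2 * b -> Z = e2 * n + m.2 - 2 * c ->
  Y ^+ 2 = X ^+ 2 -> Z ^+ 2 = X ^+ 2 -> (X + 2) ^+ 2 = (- n + m.1.1 + 2) ^+ 2 ->
  Y ^+ 2 = (e1 * n + m.1.2) ^+ 2 -> Z ^+ 2 = (e2 * n + m.2) ^+ 2 ->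
  [/\ a = 0, (m == 0) || (m == (-1, e1, e2)),
    (b == 0) || (e1 == 1) && (b == n - m.1.1) & (c == 0) || (e2 == 1) && (c == n - m.1.1)].
Proof.
move=> hm n1 a0 b0 c0 h1 h2 eX eY eZ.
have sq (x y : int) : x ^+ 2 = y ^+ 2 -> x = y \/ x = - y.
  by move/eqP; rewrite eqf_sqr => /orP[] /eqP; [left|right].
move=> /sq q1 /sq q2 /sq q3 /sq q4 /sq q5; move: hm eX eY eZ q3 q4 q5.
rewrite !inE.
by case/orP: h1 => /eqP ->; case/orP: h2 => /eqP ->; repeat (case/orP); move=> /eqP -> /= eX eY
    eZ q3 q4 q5;
  (have ea : a = 0 by lia); split=> //; rewrite ?eqxx //=; try lia.
Qed.

Definition flip (f : bool) (s : sign) : sign := if f then Minus else s.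
Definition flips (s : sign) : seq bool := if s is Plus then [:: true; false] else [:: false].
(** A mark is a triple (f, g, k).  The flags f and g tell whether F_1 and F_2
    reflect a sign + to -; they are false when the sign is already -.  The flag
    k tells whether the level is n + 1 rather than n, that is whether the set I
    is a singleton rather than empty.  True comes first in the enumeration, so
    that the lower weights do: see [marks_order]. *)
Definition marks (b c : sign) : seq (bool * bool * bool) :=
  [seq (fg, k) | fg <- [seq (f, g) | f <- flips b, g <- flips c], k <- [:: true; false]].
Definition mark_weight (n : nat) (b c : sign) (m : bool * bool * bool) : weight :=
  sgn_weight (n + m.2) Minus (flip m.1.1 b) (flip m.1.2 c).
Definition is_plus (s : sign) : bool := if s is Plus then true else false.
Definition mark_level (b c : sign) (k : bool) : nat :=
  if k then index [:: Q (false, is_plus b, is_plus c)] odd_words else 0.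
(** At the level n + k a coordinate of sign + is reflected by F_i^(n + k). *)
Definition mark_word (n : nat) (m : bool * bool * bool) : seq basis :=
  F_word 0 (m.1.1 * (n + m.2)) (m.1.2 * (n + m.2)).

Lemma exponent_flag (s : sign) (n m : nat) (k : bool) :
  (m%:Z == 0) || (signz s == 1) && (m%:Z == n%:Z - - k%:Z) ->
  m = ((m != 0)%N * (n + k))%N /\ ((m != 0)%N -> s = Plus).
Proof. by case: m => [|m] //=; rewrite mul1n; case: s => //= /eqP; case: k; split=> //; lia. Qed.

(** The roots of I determine the odd word in the two cases left by
    [weight_arith]. *)
Lemma mark_levelP b c : all (fun j =>
  ((nth 0 odd_word_roots j == 0) || (nth 0 odd_word_roots j == (-1, signz b, signz c)))
    ==> (j == mark_level b c (j != 0)%N)) (iota 0 16).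
Proof. by case: b; case: c; vm_compute. Qed.

Section Verma.
Variables (K : numFieldType) (zeta : K).
Hypothesis irr : forall q : rat, zeta <> ratr q.
Variables (n : nat) (b c : sign).
Hypothesis n_ge1 : (1 <= n)%N.

Notation lam := (sgn_weight n Minus b c).
Notation M := (verma zeta lam).
Definition v0 : M := verma_top zeta (lam - rho).

Lemma v0_sing : singular (lam - rho) v0.
Proof. exact: verma_top_singular. Qed.
Lemma v0_gen (S : M -> Prop) : is_submod S -> S v0 -> forall x, S x.
Proof. exact: verma_top_gen. Qed.

Definition mark_vec (m : bool * bool * bool) : M := word_act (mark_word n m) (odd_vec v0
    (mark_level b c m.2)).

(** This combines the equations given by the four Casimirs with the solution of
    these equations in [weight_arith]. *)
Lemma singular_mod_mark (N : M -> Prop) nu (y : M) : is_submod N -> ~ N y ->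
  weight_vector (nu - rho) y -> (forall x, in_nplus x -> N (act M x y)) ->
  exists m (alpha : K), [/\ alpha != 0, m \in marks b c, nu = mark_weight n b c m,
    ~ sumsp (filt v0 (mark_level b c m.2)) N (mark_vec m)
    & sumsp (filt v0 (mark_level b c m.2)) N (y - alpha *: mark_vec m)].
Proof.
move=> hN nNy wy sy.
have := casimir_norm v0_sing v0_gen hN nNy wy sy; rewrite sq_length_W.
move=> /(sq_length_eq0 irr)[q1 q2].
have [j [a [be [ga [alpha [[j16 a0] nS yS enu sq]]]]]] :=
  singular_mod_filt v0_sing v0_gen hN nNy wy sy.
have [f1 f2 f3] := F_count_word a be ga.
pose st := nth 0 odd_word_roots j.
have filt_weightE i : at3 (filt_weight (lam - rho) j) i = at3 lam i - at3 rho i + at3 st i.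
  by rewrite /filt_weight word_root_odd_words // !at3D at3N.
have nuE i : at3 nu i = at3 lam i + at3 st i - 2 * (F_count i (F_word a be ga))%:Z.
  have := congr1 (fun m : weight => at3 m i) enu.
  by rewrite (at3D nu) (at3D (filt_weight _ _)) at3N filt_weightE word_root_F ?F_word_isF // =>
      /(canRL (subrK _)) ->; ring.
have sg s : (signz s == 1) || (signz s == -1) by case: s.
have st_in : st \in odd_word_roots by rewrite mem_nth.
have := sq Delta; have := sq Eps1; have := sq Eps2.
rewrite !filt_weightE !(at3D nu) !at3N /= => sq2 sq1 sq0.
have e0 : nu.1.1 = - n%:Z + st.1.1 - 2 * a%:Z.
  by rewrite -[LHS]/(at3 nu Delta) nuE f1 /= mulN1r.
have e1 : nu.1.2 = signz b * n%:Z + st.1.2 - 2 * be%:Z.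
  by rewrite -[LHS]/(at3 nu Eps1) nuE f2.
have e2 : nu.2 = signz c * n%:Z + st.2 - 2 * ga%:Z.
  by rewrite -[LHS]/(at3 nu Eps2) nuE f3.
have g0 : (nu.1.1 + 2) ^+ 2 = (- n%:Z + st.1.1 + 2) ^+ 2.
  by move: sq0; congr (_ ^+ 2 = _ ^+ 2); ring.
have g1 : nu.1.2 ^+ 2 = (signz b * n%:Z + st.1.2) ^+ 2.
  by move: sq1; congr (_ ^+ 2 = _ ^+ 2); ring.
have g2 : nu.2 ^+ 2 = (signz c * n%:Z + st.2) ^+ 2.
  by move: sq2; congr (_ ^+ 2 = _ ^+ 2); ring.
have [a00 hst hb hc] := weight_arith st_in (n_ge1 : 1 <= n%:Z) (isT : 0 <= a%:Z)
  (isT : 0 <= be%:Z) (isT : 0 <= ga%:Z) (sg b) (sg c) e0 e1 e2 q1 q2 g0 g1 g2.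
have {}a00 : a = 0%N by case: a00.
pose k := (j != 0)%N.
have ej : j = mark_level b c k.
  by apply/eqP; apply: implyP hst; apply: (allP (mark_levelP b c)); rewrite mem_iota.
have est : st = if k then (-1, signz b, signz c) else 0.
  by rewrite /st ej; case: (k); case: (b); case: (c).
pose m := (be != 0, ga != 0, k)%N.
have stk : st.1.1 = - k%:Z by rewrite est; case: (k).
have [hbe fb] : be = (m.1.1 * (n + m.2))%N /\ (m.1.1 -> b = Plus).
  by apply: exponent_flag; rewrite -stk.
have [hga fc] : ga = (m.1.2 * (n + m.2))%N /\ (m.1.2 -> c = Plus).
  by apply: exponent_flag; rewrite -stk.
exists m, alpha; split; first exact: a0.
- by move: fb fc; rewrite /m; case: (be != 0)%N => [/(_ isT) ->|_];
    case: (ga != 0)%N => [/(_ isT) ->|_]; case: (k); case: (b); case: (c).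
- move: e0 e1 e2; rewrite a00 hbe hga est.
  case: (nu) => [[x y'] z]; rewrite /mark_weight /sgn_weight /= => -> -> ->.
  move: fb fc; rewrite /m /=; clear.
  case: (be != 0)%N => [/(_ isT) ->|_]; case: (ga != 0)%N => [/(_ isT) ->|_];
    case: (k); congr (_, _, _); rewrite /= ?(mul0n, mul1n, addn0, addn1); lia.
- by move: nS; rewrite /mark_vec /mark_word -hbe -hga -ej a00.
- by move: yS; rewrite /mark_vec /mark_word -hbe -hga -ej a00.
Qed.
End Verma.

(** * A singular vector one level down *)

(** The odd part of g is the tensor product of three natural modules C^2.  In
    the first one the vector v_- is taken; the other two contribute a factor
    each, for epsilon_1 and epsilon_2.  In C^2 tensored with the Verma module of
    generator u over sl_2, of weight n - 1 or -n - 1 according to the sign, the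
    singular vector to take is v_+ u for the sign +, of weight one more, and
    F (v_+ u) + n v_- u for the sign -, of weight one less.  The boolean selects
    v_+ or v_-, and variable 1 stands for n. *)
Definition odd_factor (k : axis) (s : sign) : lincomb (seq basis * bool) :=
  if s is Plus then [:: (coef_1, ([::], true))]
  else [:: (coef_1, ([:: F k], true)); ((1, [:: 1%N]), ([::], false))].
Definition odd_singular (b c : sign) : lincomb (seq basis) :=
  bind_lin (odd_factor Eps1 b) (fun x =>
    [seq (t.1, x.1 ++ t.2.1 ++ [:: Q (false, x.2, t.2.2)]) | t <- odd_factor Eps2 c]).
(** The weight (-n, bn, cn) - rho as a polynomial in n.  The shifted weight is
    orthogonal to the odd root -delta + b epsilon_1 + c epsilon_2, which is why
    the odd raising operators annihilate the vector above. *)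
Definition special_weight (b c : sign) (i : axis) : seq coefmon :=
  match i with
  | Delta => [:: (1, [::]); (-1, [:: 1%N])]
  | Eps1 => [:: (signz b, [:: 1%N]); (-1, [::])]
  | Eps2 => [:: (signz c, [:: 1%N]); (-1, [::])]
  end.

(** An identity of polynomials in n and zeta. *)
Lemma odd_singular_check b c : all (fun x => in_nplus x ==>
  (collect (bind_lin (odd_singular b c) (straighten (hw_base (special_weight b c)) fuel x)) ==
      [::])) all_basis.
Proof. by case: b; case: c; vm_compute. Qed.

Lemma odd_singular_root b c : all (fun t =>
  foldr (fun x m => root x + m) 0 t.2 == (-1, signz b, signz c)) (odd_singular b c).
Proof. by case: b; case: c; vm_compute. Qed.

Section Verma.
Variables (K : numFieldType) (zeta : K).
Hypothesis irr : forall q : rat, zeta <> ratr q.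
Variables (n : nat) (b c : sign).
Hypothesis n_ge1 : (1 <= n)%N.

Notation lam := (sgn_weight n Minus b c).
Notation M := (verma zeta lam).
Notation v0 := (v0 zeta n b c).

Definition n_env (v : nat) : K := if v is 0 then zeta else n%:R.
Definition odd_sing_vec : M := lin_act n_env (odd_singular b c) v0.

Lemma odd_sing_vec_sing : singular (sgn_weight n.+1 Minus b c - rho) odd_sing_vec.
Proof.
have [wv sv] := v0_sing zeta n b c.
have bs x : act M x v0 = lin_act n_env (hw_base (special_weight b c) x) v0.
  case: x => [i|i|i|s].
  - by rewrite sv // /lin_act ev_lin_nil.
  - rewrite wv /lin_act /ev_lin big_map -scaler_suml; congr (_ *: _).
    case: i; rewrite !big_cons big_nil /ev_coef /= ?big_seq1 ?big_nil.
    + by rewrite opprK intrD mulN1r intrN -pmulrn; ring.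
    + by rewrite intrB intrM -pmulrn; ring.
    + by rewrite intrB intrM -pmulrn; ring.
  - by rewrite lin_act1.
  rewrite /hw_base; case: ifP => ss; last by rewrite lin_act1.
  by rewrite sv // /lin_act ev_lin_nil.
split.
  rewrite /odd_sing_vec /lin_act /ev_lin big_seq; apply: (subsp_sum _ (wv_subspace _ _)) => t ht.
  apply: (subspZ _ (wv_subspace _ _)).
  have -> : sgn_weight n.+1 Minus b c - rho = lam - rho + word_root t.2.
    have := allP (odd_singular_root b c) t ht; rewrite word_root_foldr => /eqP ->.
    apply: at3_inj => i; rewrite !at3D !at3N.
    by case: i; case: (b); case: (c); rewrite /= -addn1 PoszD; ring.
  exact: word_act_wv.
move=> x px; have := allP (odd_singular_check b c) x (mem_all_basis x); rewrite px => /eqP.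
move=> /(ev_lin_zero n_env (fun w => word_act w v0)); rewrite ev_lin_bind => <-.
rewrite /odd_sing_vec /lin_act [in LHS]/ev_lin linear_sum; apply: eq_bigr => t _.
rewrite linearZ; congr (_ *: _).
exact: (straighten_sound (erefl : n_env 0 = zeta) bs).
Qed.

Definition chain_vec (m : bool * bool * bool) : M :=
  word_act (mark_word n m) (if m.2 then odd_sing_vec else v0).

Lemma chain_vec_sing m : m \in marks b c -> singular (mark_weight n b c m - rho) (chain_vec m).
Proof.
case: m => [[f g] k] hm.
have [fb gc] : (f -> b = Plus) /\ (g -> c = Plus).
  by move: hm; case: (b); case: (c); case: f; case: g; case: k.
pose u : M := if k then odd_sing_vec else v0.
have su : singular (sgn_weight (n + k) Minus b c - rho) u.
  by rewrite /u; case: (k); rewrite ?addn1 ?addn0; [exact: odd_sing_vec_sing|exact: v0_sing].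
have sF j (s : bool) mu (x : M) : j != Delta -> (s -> at3 mu j = (n + k)%:Z - 1) ->
   singular mu x ->
   singular (mu + unitw j (- (2 * (s * (n + k))%N%:Z))) (word_act (nseq (s * (n + k)) (F j)) x).
  move=> jD; case: s => h sx.
    by rewrite mul1n; apply: (singular_F irr) => //; exact: h.
  rewrite mul0n mulr0 oppr0; have -> : unitw j 0 = 0 by case: (j).
  by rewrite addr0.
rewrite /chain_vec /mark_word /F_word /= !word_act_cat -/u.
have s2 := sF Eps2 g _ _ isT _ su.
have s1 := sF Eps1 f _ _ isT _ (s2 _).
have -> : mark_weight n b c (f, g, k) - rho = sgn_weight (n + k) Minus b c - rho
   + unitw Eps2 (- (2 * (g * (n + k))%N%:Z)) + unitw Eps1 (- (2 * (f * (n + k))%N%:Z)).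
  apply: at3_inj => i; rewrite !at3D !at3N !at3_unitw.
  case: i => /=; first by rewrite !addr0.
    move: fb; case: (f) => [/(_ isT) ->|_] /=; rewrite ?mul1n ?mul0n; lia.
  move: gc; case: (g) => [/(_ isT) ->|_] /=; rewrite ?mul1n ?mul0n; lia.
apply: s1.
  by move=> /fb eb; rewrite !at3D !at3N at3_unitw eb /=; lia.
by move=> /gc ec; rewrite at3D at3N ec /=; lia.
Qed.

(** At level n it is a monomial.  At level n + 1 its coordinate on a monomial
    with the odd root vector Q (-, +, +) is 1: this odd vector occurs only in
    the product of the terms of [odd_factor] with coefficient 1. *)
Lemma chain_vec_neq0 m : chain_vec m != 0.
Proof.
pose w1 (s : sign) k := if s is Plus then [::] else [:: F k].
pose ws := if m.2 then w1 b Eps1 ++ w1 c Eps2 else [::].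
have [l [ll lE]] := verma_coord zeta (lam - rho) ((m.2 : nat), F_exponents (mark_word n m ++ ws)).
pose L : {linear M -> K^o} := HB.pack l (GRing.isLinear.Build K M K^o _ l ll).
suff l1 : L (chain_vec m) = 1.
  by apply/eqP => t0; move: l1; rewrite t0 linear0 => /eqP; rewrite eq_sym oner_eq0.
have Lw j ws' (x := mark_word n m ++ ws' ++ nth [::] odd_words j) : all isF ws' -> (j < 5)%N ->
    L (word_act x v0) = ((j, F_exponents (mark_word n m ++ ws')) == ((m.2 : nat), F_exponents
        (mark_word n m ++ ws)))%:R.
  move=> Fws j5; rewrite -[L _]/(l _) /x catA lE //.
  by rewrite all_cat Fws F_word_isF.
have first_sub : nth [::] odd_words 0 = [::] by vm_compute.
have sub1 s t : exists2 j, (j < 5)%N && (((s, t) == (true, true)) == (j == 1%N)) &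
    nth [::] odd_words j = [:: Q (false, s, t)].
  by case: s; case: t; [exists 1%N|exists 2%N|exists 3%N|exists 4%N].
rewrite /chain_vec; move: Lw; rewrite /ws; case: (m.2) => Lw; last first.
  by have := Lw 0%N [::] isT isT; rewrite first_sub !cats0 word_act_cat eqxx => ->.
have LQ s t ws' : all isF ws' -> L (word_act (mark_word n m) (word_act (ws' ++ [:: Q (false, s,
    t)]) v0))
    = ((s, t) == (true, true))%:R * (F_exponents (mark_word n m ++ ws') == F_exponents (mark_word
        n m ++ w1 b Eps1 ++ w1 c Eps2))%:R.
  move=> Fws; have [j /andP[j5 /eqP ->] <-] := sub1 s t.
  by rewrite -word_act_cat Lw // xpair_eqE -natrM mulnb.
have lowF k s (x : coefmon * (seq basis * bool)) : x \in odd_factor k s -> all isF x.2.1.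
  by case: s; rewrite /= !inE; [move=> /eqP ->|case/orP=> /eqP ->].
have -> : L (word_act (mark_word n m) odd_sing_vec) = ev_lin (V := K^o) n_env (fun x => ev_lin (V
    := K^o) n_env (fun y =>
    ((x.2, y.2) == (true, true))%:R
    * (F_exponents (mark_word n m ++ x.1 ++ y.1) == F_exponents (mark_word n m ++ w1 b Eps1 ++ w1
        c Eps2))%:R)
    (odd_factor Eps2 c)) (odd_factor Eps1 b).
  have Lz k z : L (word_act (mark_word n m) (k *: z)) = k *: L (word_act (mark_word n m) z).
    by rewrite (_ : word_act (mark_word n m) (k *: z) = k *: word_act (mark_word n m) z) ?linearZ
        //; exact: linearZ.
  have Ls T (r : seq (coefmon * T)) (g : T -> M) :
      L (word_act (mark_word n m) (ev_lin n_env g r)) = ev_lin n_env (fun x => L (word_act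
          (mark_word n m) (g x))) r.
    elim: r => [|x r IH]; first by rewrite !ev_lin_nil (linear0 (word_act (mark_word n m))) linear0.
    by rewrite !ev_lin_cons -IH (linearD (word_act (mark_word n m))) (linearD L) Lz.
  rewrite /odd_sing_vec /lin_act /odd_singular ev_lin_bind Ls; apply: eq_big_seq => x hx; congr
      (_ *: _).
  rewrite (ev_lin_map _ _ (fun y => x.2.1 ++ y.1 ++ [:: Q (false, x.2.2, y.2)])) Ls.
  apply: eq_big_seq => y hy; congr (_ *: _).
  rewrite /= catA -[l _]/(L _) LQ ?all_cat ?(lowF _ _ _ hx) ?(lowF _ _ _ hy) //.
by rewrite /w1 /odd_factor; case: (b); case: (c);
  rewrite !(ev_lin_cons, ev_lin_nil) /= ?ev_coef_1 ?scale1r ?eqxx ?(mul1r, mul0r, scaler0, addr0).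
Qed.
End Verma.

(** * Highest weights of factors *)

(** A functional with positive values on all positive roots, 1 on the odd simple
    root. *)
Definition height (m : weight) : int := 3 * m.1.1 + m.1.2 + m.2.

Lemma height_pos x (m : weight) : in_nplus x -> height m < height (m + root x).
Proof.
case: m => [[a b] c]; case: x => [i|i|i|[[s0 s1] s2]] //=.
  by case: i; rewrite /height /= => _; lia.
by move=> ->; case: s1; case: s2; rewrite /height /=; lia.
Qed.

Lemma height_leW (m m' : weight) : weight_le m m' -> height m <= height m'.
Proof. by case: m m' => [[a b] c] [[a' b'] c'] /and3P[/= h1 h2 h3]; rewrite /height /=; lia. Qed.

Section TopVector.
Variables (K : numFieldType) (zeta : K) (mu : weight).
Notation M := (verma_hw zeta mu).
Implicit Types N : M -> Prop.

(** Start from a weight component of [z] outside [N] and apply positive root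
    vectors as long as the result is not in [N].  This terminates because the
    height increases and is bounded by that of the highest weight. *)
Lemma top_vector N N' z : is_submod N -> is_submod N' -> N' z -> ~ N z ->
  exists nu y, [/\ N' y, ~ N y, weight_vector nu y & forall x, in_nplus x -> N (act M x y)].
Proof.
move=> hN hN' N'z nNz; have sN := submod_subspace hN; have sN' := submod_subspace hN'.
have [wv sv] := verma_top_singular zeta mu.
have [s [c [us wc _ _ ez]]] := span_weight_components (words_wv wv (l := None)) (verma_hw_sub z).
have hS (S : M -> Prop) : is_submod S -> Hstable S by case=> _ _ h i u; exact: h.
have Nc' nu : nu \in s -> N' (c nu).
  by apply: (weight_components sN' (hS _ hN') us wc); rewrite -ez.
have [nu [ns nNc]] : exists nu, nu \in s /\ ~ N (c nu).
  apply: contrapT => no; apply: nNz; rewrite ez big_seq; apply: subsp_sum => // nu ns.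
  by apply: contrapT => nNc; apply: no; exists nu.
have : exists d y nu, [/\ (height mu - height nu <= d%:Z), N' y, ~ N y & weight_vector nu y].
  exists `|height mu - height nu|%N, (c nu), nu.
  by split; [clear; lia|exact: Nc'|exact: nNc|exact: wc].
move=> [d]; elim: d => [|d IH] [y [nu' [hd N'y nNy wy]]].
  exists nu', y; split=> // x px; have [->|xy0] := eqVneq (act M x y) 0; first by case: hN.
  have [le _] := hw_sub_weight wv (verma_hw_sub _) (wv_act x wy) xy0.
  by move: (height_leW le) (height_pos nu' px) hd; clear; lia.
have [h|] := pselect (forall x, in_nplus x -> N (act M x y)); first by exists nu', y.
move=> /existsNP[x /not_implyP[px nNxy]]; apply: IH.
exists (act M x y), (nu' + root x).
split; [|by case: hN' => _ _; apply|exact: nNxy|exact: wv_act].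
by move: (height_pos nu' px) hd; clear; lia.
Qed.
End TopVector.

Section FactorUniq.
Variables (K : numFieldType) (zeta : K) (M : gmodule zeta).

(** The image of [y] and the image of the Verma generator are singular vectors
    that both generate the simple module, so each of the two weights is below
    the other. *)
Lemma factor_uniq (A B : set M) lam nu y : is_submod A -> is_submod B ->
  factor_is A B lam -> A y -> ~ B y -> weight_vector (nu - rho) y ->
  (forall x, in_nplus x -> B (act M x y)) -> lam = nu.
Proof.
move=> hA hB [L [[_ simpL] [f hf fsurj]] [h [hlin hact hsurj hker]]] Ay nBy wy sy.
have A0 : A 0 by case: hA.
have Aact x v : A v -> A (act M x v) by case: hA => _ _; apply.
have h0 : h 0 = 0 by apply/(hker 0 A0); case: hB.
have hZ a v : A v -> h (a *: v) = a *: h v.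
  by move=> Av; rewrite -[a *: v]addr0 hlin // h0 addr0.
have shy : singular (nu - rho) (h y).
  split=> [i|x px]; first by rewrite -hact // wy hZ.
  by rewrite -hact //; apply/hker; [exact: Aact|exact: sy].
have hy0 : h y != 0 by apply/eqP => /(hker y Ay).
pose z := f (verma_top zeta (lam - rho)).
have sz : singular (lam - rho) z.
  have [wv sv] := verma_top_singular zeta (lam - rho).
  split=> [i|x px]; rewrite -hf; first by rewrite wv linearZ.
  by rewrite sv // linear0.
have z0 : z != 0.
  apply/eqP => ez; move: hy0; have [v <-] := fsurj (h y); rewrite -[v]vpiK vpi_tensor_act.
  rewrite /tensor_act /malg_lift linear_sum big1 ?eqxx // => k _; rewrite linearZ /=.
  have -> : f (word_act k (verma_top zeta (lam - rho))) = 0; last by rewrite scaler0.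
  elim: (k : seq basis) => // x w IH.
  by rewrite [word_act _ _]/(act _ x (word_act w (verma_top zeta (lam - rho)))) hf IH linear0.
have full m u : singular m u -> u != 0 -> forall t, hw_sub (M := L) u t.
  move=> su u0 t; have [e|e] := simpL _ (hw_sub_submod su).
    by have := hw_sub_top u; rewrite -[hw_sub u u]/((hw_sub u : set L) u) e => /eqP; rewrite
        (negbTE u0).
  by rewrite -[hw_sub u t]/((hw_sub u : set L) t) e.
have [l1 _] := hw_sub_weight (proj1 shy) (full _ _ shy hy0 z) (proj1 sz) z0.
have [l2 _] := hw_sub_weight (proj1 sz) (full _ _ sz z0 (h y)) (proj1 shy) hy0.
exact: (addIr (- rho) (weight_le_anti l1 l2)).
Qed.
End FactorUniq.

(** * The chain of submodules generated by singular vectors *)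

Lemma count_lt (T : eqType) (p q : pred T) (s : seq T) x :
  (forall y, p y -> q y) -> x \in s -> q x -> ~~ p x -> (count p s < count q s)%N.
Proof.
move=> pq xs qx px; have sub : subpred p q by [].
elim: s xs => //= y s IH; rewrite inE => /orP[/eqP <-|/IH lt].
  by rewrite qx (negbTE px) add0n add1n ltnS; exact: sub_count.
rewrite -addnS; apply: leq_add => //.
by case: (boolP (p y)) => // /pq ->.
Qed.

Definition mark0 : bool * bool * bool := (false, false, false).

Lemma mark_mem b c i : nth mark0 (marks b c) i \in marks b c.
Proof.
have [lt|ge] := ltnP i (size (marks b c)); first exact: mem_nth.
by rewrite nth_default //; case: b {ge}; case: c.
Qed.

Lemma marks_last b c : (0 < size (marks b c))%N /\
  nth mark0 (marks b c) (size (marks b c)).-1 = mark0.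
Proof. by case: b; case: c. Qed.

(** This keeps each singular vector out of the sum of the submodules generated
    by the earlier ones. *)
Lemma marks_order n b c i k : (1 <= n)%N -> (i < k < size (marks b c))%N ->
  ~~ weight_le (mark_weight n b c (nth mark0 (marks b c) k)) (mark_weight n b c (nth mark0 (marks
      b c) i)).
Proof.
move=> n1 /andP[ik ks].
have pw : pairwise (fun m m' => ~~ weight_le (mark_weight n b c m') (mark_weight n b c m)) (marks
    b c).
  by case: (b); case: (c); rewrite /= /mark_weight /weight_le /= ?addn0 ?addn1; lia.
exact: (pairwiseP mark0 pw i k (ltn_trans ik ks) ks ik).
Qed.

Section Chain.
Variables (K : numFieldType) (zeta : K).
Hypothesis irr : forall q : rat, zeta <> ratr q.
Variables (n : nat) (b c : sign).
Hypothesis n_ge1 : (1 <= n)%N.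

Notation lam := (sgn_weight n Minus b c).
Notation M := (verma zeta lam).
Notation v0 := (v0 zeta n b c).
Notation r := (size (marks b c)).
Notation mk i := (nth mark0 (marks b c) i).
Notation tt i := (chain_vec zeta n b c (mk i)).

Definition chain (i : nat) : set M :=
  span (fun x => exists k, (k < i)%N /\ words None (tt k) x).

Let tsing i : singular (mark_weight n b c (mk i) - rho) (tt i).
Proof. by apply: (chain_vec_sing irr n_ge1); exact: mark_mem. Qed.

Lemma chain_submod i : is_submod (chain i).
Proof.
have [S0 SL] := span_subspace (fun x => exists k, (k < i)%N /\ words None (tt k) x).
split=> // x v; apply: span_act; first exact: span_subspace.
move=> y [k [ki wy]]; have [_ _ Ua] := hw_sub_submod (tsing k).
apply: (span_sub (span_subspace _) _ (Ua x y (span_gen wy))) => z wz.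
by apply: span_gen; exists k.
Qed.

Lemma chain_mono i j : (i <= j)%N -> chain i `<=` chain j.
Proof.
move=> ij x; apply: span_sub; first exact: span_subspace.
by move=> y [k [ki wy]]; apply: span_gen; exists k; split=> //; apply: leq_trans ij.
Qed.

Lemma chain_top i : chain i.+1 (tt i).
Proof. by apply: span_gen; exists i; split=> //; exists [::]. Qed.

Lemma chain_full x : chain r x.
Proof.
apply: (v0_gen (chain_submod r)).
have [r0 e] := marks_last b c.
by have := chain_top r.-1; rewrite prednK // e.
Qed.

Lemma chain_step i x : chain i.+1 x -> sumsp (hw_sub (tt i)) (chain i) x.
Proof.
have sA : subspace (sumsp (hw_sub (tt i)) (chain i)).
  by apply: sumsp_subspace; exact: span_subspace.
apply: span_sub => // y [k [+ wy]]; rewrite ltnS leq_eqVlt => /predU1P[ek|ki].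
  by apply: sumspl; [exact: span_subspace|rewrite ek in wy; exact: span_gen].
by apply: sumspr; [exact: span_subspace|apply: span_gen; exists k].
Qed.

(** All weights of the step [i] are below the weight of some earlier singular
    vector. *)
Lemma chain_strict i : (i < r)%N -> ~ chain i (tt i).
Proof.
move=> ir Ct; have [wt_t _] := tsing i.
have Pw x : (exists k, (k < i)%N /\ words None (tt k) x) -> exists m, weight_vector m x.
  by case=> k [_ wx]; exact: (words_wv (proj1 (tsing k)) wx).
have /eqP t0 := chain_vec_neq0 zeta n b c (mk i); apply: t0.
apply: (span_sub (sum0_subspace _) _ (span_wv Pw Ct wt_t)) => x [[k [ki wx]] wx'].
apply: contrapT => /eqP x0.
have [le _] := hw_sub_weight (proj1 (tsing k)) (span_gen wx) wx' x0.
have := @marks_order n b c k i n_ge1; rewrite ki ir => /(_ isT) /negP; apply.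
by move: le; rewrite /weight_le /=; lia.
Qed.

(** The number of marks reached by [N] plays the role of its length. *)
Definition reach (N : set M) (m : bool * bool * bool) : bool :=
  `[< sumsp (filt v0 (mark_level b c m.2)) N (mark_vec zeta n b c m) >].

(** A vector of [N'] outside [N] that is singular modulo [N] exists, and it is
    congruent to a multiple of a mark that [N] does not reach. *)
Lemma reach_lt (N N' : set M) x : is_submod N -> is_submod N' -> N `<=` N' ->
  N' x -> ~ N x -> (count (reach N) (marks b c) < count (reach N') (marks b c))%N.
Proof.
move=> hN hN' NN' N'x nNx.
have [nu [y [N'y nNy wy sy]]] := top_vector hN hN' N'x nNx.
have wy' : weight_vector (nu + rho - rho) y by rewrite addrK.
have [m [al [al0 mm _ nS yS]]] := singular_mod_mark irr n_ge1 hN nNy wy' sy.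
have sG j : subspace (filt v0 j) by exact: filt_subspace.
have mono m' : reach N m' -> reach N' m'.
  move=> /asboolP[g [z [Gg Nz e]]]; apply/asboolP; exists g, z; split=> //; exact: NN'.
apply: (count_lt mono mm); last by apply/asboolP.
apply/asboolP.
have sS := sumsp_subspace (sG (mark_level b c m.2)) (submod_subspace hN').
have yN' : sumsp (filt v0 (mark_level b c m.2)) N' y by apply: sumspr.
have dN' : sumsp (filt v0 (mark_level b c m.2)) N' (y - al *: mark_vec zeta n b c m).
  by case: yS => g [z [Gg Nz e]]; exists g, z; split=> //; exact: NN'.
have := subspB sS yN' dN'; rewrite opprB addrC subrK.
exact: subspZ_inv.
Qed.

Lemma chain_reach_step i : (i < r)%N ->
  (count (reach (chain i)) (marks b c) < count (reach (chain i.+1)) (marks b c))%N.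
Proof.
move=> ir; apply: (reach_lt (chain_submod i) (chain_submod i.+1) (chain_mono (leqnSn i))).
  exact: chain_top.
exact: chain_strict.
Qed.

(** The number of marks reached increases strictly along the chain, whose number
    of steps is the number of marks; so it increases by exactly one at each
    step. *)
Lemma chain_reach i : (i <= r)%N -> count (reach (chain i)) (marks b c) = i.
Proof.
move=> ir; apply/eqP; rewrite eqn_leq; apply/andP; split; last first.
  elim: i ir => // i IH ir; apply: leq_ltn_trans (chain_reach_step ir).
  exact: IH (ltnW ir).
have up j : (i + j <= r)%N ->
    (count (reach (chain i)) (marks b c) + j <= count (reach (chain (i + j))) (marks b c))%N.
  elim: j => [|j IH]; first by rewrite !addn0.
  rewrite !addnS => ijr; apply: leq_ltn_trans (chain_reach_step ijr).
  exact: IH (ltnW ijr).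
have := up (r - i)%N; rewrite subnKC // => /(_ (leqnn _)) h.
by move: (leq_trans h (count_size _ _)) ir; clear; lia.
Qed.

(** A submodule strictly between two steps would reach a number of marks strictly
    between two consecutive integers. *)
Lemma chain_max i (X : set M) : (i < r)%N -> is_submod X -> chain i `<=` X ->
  X `<=` chain i.+1 -> X = chain i \/ X = chain i.+1.
Proof.
move=> ir hX CX XC.
have [[x [Xx nCx]]|no1] := pselect (exists x, X x /\ ~ chain i x); last first.
  left; apply/seteqP; split=> // x Xx; apply: contrapT => nCx; apply: no1.
  by exists x.
have [[y [Cy nXy]]|no2] := pselect (exists x, chain i.+1 x /\ ~ X x); last first.
  right; apply/seteqP; split=> // y Cy; apply: contrapT => nXy; apply: no2.
  by exists y.
have l1 := reach_lt (chain_submod i) hX CX Xx nCx.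
have l2 := reach_lt hX (chain_submod i.+1) XC Cy nXy.
have := leq_ltn_trans l1 l2.
by rewrite !chain_reach ?ltnn // ltnW.
Qed.

Lemma chain_factor i : (i < r)%N ->
  factor_is (chain i.+1) (chain i) (mark_weight n b c (mk i)).
Proof.
move=> ir; apply: (factor_hw (chain_submod _) (chain_submod _) _ (tsing i)).
- exact: chain_mono.
- exact: chain_strict.
- exact: chain_top.
- exact: chain_step.
- by move=> X hX CX XC; exact: chain_max.
Qed.

Lemma chain_factor_uniq i nu : (i < r)%N ->
  factor_is (chain i.+1) (chain i) nu -> nu = mark_weight n b c (mk i).
Proof.
move=> ir fac; have [wt_t st] := tsing i.
apply: (factor_uniq (chain_submod i.+1) (chain_submod i) fac (chain_top i) (chain_strict ir)) => //.
by move=> x px; rewrite st //; case: (chain_submod i).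
Qed.

Lemma verma_comp_factors : comp_factors M [seq mark_weight n b c m | m <- marks b c].
Proof.
move=> nu; exists r, chain; split.
  split.
  - apply/seteqP; split=> x; last by move=> ->; exact: span_0.
    by apply: span_sub; [exact: sum0_subspace|move=> y [k []]].
  - by apply/seteqP; split=> // x _; exact: chain_full.
  - by move=> i _; exact: chain_submod.
  - move=> i ir; split; first exact: chain_mono.
    by have [L [sL _] q] := chain_factor ir; exists L.
rewrite count_map -sum1_count (big_nth mark0) big_mkord -sum1_card; apply: eq_bigl => i /=.
rewrite inE; apply/asboolP/eqP => [fac|<-]; last exact: chain_factor.
by rewrite (chain_factor_uniq _ fac).
Qed.

(** A factor A / B need not come from the chain, but [singular_mod_mark] holds
    modulo any submodule B. *)
Lemma verma_comp_factor nu : comp_factor M nu <-> exists2 m, m \in marks b c & nu = mark_weight n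
    b c m.
Proof.
split=> [[A [B [hA hB BA fac]]]|[m mm ->]]; last first.
  exists (chain (index m (marks b c)).+1), (chain (index m (marks b c))).
  have im : (index m (marks b c) < r)%N by rewrite index_mem.
  split; [exact: chain_submod|exact: chain_submod|exact: chain_mono|].
  by have := chain_factor im; rewrite nth_index.
have [x [Ax nBx]] : exists x, A x /\ ~ B x.
  have [L [[[w w0] _] _] [h [_ _ hs hk]]] := fac.
  have [x Ax hx] := hs w; exists x; split=> // /(hk x Ax) hx0.
  by move: w0; rewrite -hx hx0 eqxx.
have [nu' [y [Ay nBy wy sy]]] := top_vector hB hA Ax nBx.
have wy' : weight_vector (nu' + rho - rho) y by rewrite addrK.
have [m [al [_ mm e _ _]]] := singular_mod_mark irr n_ge1 hB nBy wy' sy.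
exists m => //; rewrite -e; exact: (factor_uniq hA hB fac Ay nBy wy').
Qed.

(** The highest weight space is a line generating the module, and it splits along
    a direct sum decomposition, so one of the summands contains it. *)
Lemma verma_indecomposable : indecomposable M.
Proof.
have v00 : v0 != 0.
  exact: chain_vec_neq0 zeta n b c mark0.
split; first by exists v0.
move=> A B hA hB AB0 sum.
have [wv _] := v0_sing zeta n b c.
have [a [a' [Aa Ba' e]]] := sum v0.
have full (S : set M) : is_submod S -> S v0 -> S = setT.
  by move=> hS Sv; apply/seteqP; split=> // x _; exact: (v0_gen hS).
have [s [cc [us wc c0 _ es]]] := span_weight_components (words_wv wv (l := None)) (verma_hw_sub a).
have hst (S : set M) : is_submod S -> Hstable S by case=> _ _ h i u; exact: h.
have Bc : B (cc (lam - rho) - v0).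
  apply: (weight_component (submod_subspace hB) (hst _ hB) us wc c0 wv).
  rewrite -es e opprD addrA subrr add0r.
  exact: (subspN (submod_subspace hB)).
have Ac : A (cc (lam - rho)).
  have [ls|ls] := boolP (lam - rho \in s); last by rewrite c0 //; case: hA.
  by apply: (weight_components (submod_subspace hA) (hst _ hA) us wc) ls; rewrite -es.
have [c00|cn0] := eqVneq (cc (lam - rho)) 0.
  left; have Bv : B v0.
    by move: Bc; rewrite c00 sub0r => /(subspN (submod_subspace hB)); rewrite opprK.
  by rewrite -AB0 (full B hB Bv) setIT.
have [_ /(_ erefl) [al eal]] := hw_sub_weight wv (verma_hw_sub _) (wc _) cn0.
have al0 : al != 0 by apply: contraNneq cn0 => al0; rewrite eal al0 scale0r.
right; have Av : A v0 by apply: (subspZ_inv (submod_subspace hA) al0); rewrite -eal.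
by rewrite -AB0 (full A hA Av) setTI.
Qed.
End Chain.

(** * The principal block *)

Section Block.
Variables (K : numFieldType) (zeta : K).
Hypothesis irr : forall q : rat, zeta <> ratr q.

Lemma linked_factors n m m' : (1 <= n)%N ->
  m \in marks Plus Plus -> m' \in marks Plus Plus ->
  linked zeta (mark_weight n Plus Plus m) (mark_weight n Plus Plus m').
Proof.
move=> n1 hm hm'; apply: rst_step; exists (verma zeta (sgn_weight n Minus Plus Plus)).
have fac l : l \in marks Plus Plus ->
    comp_factor (verma zeta (sgn_weight n Minus Plus Plus)) (mark_weight n Plus Plus l).
  by move=> hl; apply/(verma_comp_factor irr Plus Plus n1); exists l.
split; [exact: verma_category_O|exact: verma_indecomposable|exact: fac|exact: fac].
Qed.

(** The Verma module with b = c = + has factors of all signs at both levels n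
    and n + 1, which reduces the level to 1 and the signs to +; and
    rho = (-1, 1, 1). *)
Lemma linked_rho n b c : (1 <= n)%N -> linked zeta (sgn_weight n Minus b c) rho.
Proof.
move=> n1.
have top : linked zeta (sgn_weight n Minus Plus Plus) rho.
  elim: n n1 => // [[|n]] IH _; first exact: rst_refl.
  apply: rst_trans (IH isT).
  have := linked_factors (n := n.+1) (m := (false, false, true)) (m' := mark0) isT isT isT.
  by rewrite /mark_weight /= addn0 addn1.
apply: rst_trans top.
have := linked_factors (n := n) (m := (if b is Minus then true else false,
   if c is Minus then true else false, false)) (m' := mark0) n1.
by rewrite /mark_weight /= addn0; case: b; case: c; apply.
Qed.

Lemma verma_principal_block n b c : (1 <= n)%N ->
  principal_block (verma zeta (sgn_weight n Minus b c)).
Proof.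
move=> n1; split; first exact: verma_category_O.
move=> nu /(verma_comp_factor irr b c n1)[m _ ->].
by apply: linked_rho; rewrite addn_gt0 n1.
Qed.

Lemma comp_factors_perm (M : gmodule zeta) s s' : perm_eq s s' -> comp_factors M s ->
    comp_factors M s'.
Proof. by move=> /permP e h nu; rewrite -e. Qed.

Lemma verma_W n b c s : (1 <= n)%N -> perm_eq [seq mark_weight n b c m | m <- marks b c] s ->
  principal_block (verma zeta (sgn_weight n Minus b c)) /\
  comp_factors (verma zeta (sgn_weight n Minus b c)) s.
Proof.
move=> n1 ps; split; first exact: verma_principal_block.
exact: comp_factors_perm ps (verma_comp_factors irr b c n1).
Qed.
End Block.

Local Open Scope complex_scope.

Theorem proposition3p11 (R : realType) (zeta : R[i])
    (zeta_irrational : ~ exists q : rat, zeta = ratr q)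
    (n : nat) (n_ge1 : (1 <= n)%N) :
  let W := sgn_weight in
  let M a b c := verma zeta (W n a b c) in
  [/\ principal_block (M Minus Minus Minus) /\
      comp_factors (M Minus Minus Minus)
        [:: W n Minus Minus Minus; W n.+1 Minus Minus Minus],
      principal_block (M Minus Minus Plus) /\
      comp_factors (M Minus Minus Plus)
        [:: W n Minus Minus Plus; W n Minus Minus Minus;
            W n.+1 Minus Minus Plus; W n.+1 Minus Minus Minus],
      principal_block (M Minus Plus Minus) /\
      comp_factors (M Minus Plus Minus)
        [:: W n Minus Plus Minus; W n Minus Minus Minus;
            W n.+1 Minus Plus Minus; W n.+1 Minus Minus Minus]
    & principal_block (M Minus Plus Plus) /\
      comp_factors (M Minus Plus Plus)
        [:: W n Minus Plus Plus; W n Minus Plus Minus;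
            W n Minus Minus Plus; W n Minus Minus Minus;
            W n.+1 Minus Plus Plus; W n.+1 Minus Plus Minus;
            W n.+1 Minus Minus Plus; W n.+1 Minus Minus Minus]].
Proof.
have irr (q : rat) : zeta <> ratr q by move=> e; apply: zeta_irrational; exists q.
split; apply: (verma_W irr n_ge1); rewrite /mark_weight /= ?addn0 ?addn1.
all: apply/permP => p /=.
all: lia.
Qed.
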